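(* Let $0<p,q\le\infty$ and let $\mu\in C^1(\mathbb{R}^n)$ be real-valued such that $\partial_j\mu\in W^{\infty,\infty}_{n/(\dot p\wedge\dot q)+\epsilon}$ for $j=1,\dots,n$, for some $\epsilon>0$. Then $e^{i\mu(D)}$ is bounded on $W^{p,q}$, i.e. there is $C>0$ with $\|e^{i\mu(D)}f\|_{W^{p,q}}\le C\|f\|_{W^{p,q}}$ for all $f\in\mathcal S(\mathbb{R}^n)$.
   Context: Fourier transform: $\hat f(\xi)=\int_{\mathbb{R}^n} f(x)e^{-2\pi i x\cdot\xi}dx$. $\langle x\rangle=(1+|x|^2)^{1/2}$. For a fixed nonzero Schwartz window $\phi$, the short-time Fourier transform of $f\in\mathcal S'(\mathbb{R}^n)$ is $V_\phi f(x,\xi)=\int f(y)\overline{\phi(y-x)}e^{-2\pi i y\cdot\xi}dy$. For $0<p,q\le\infty$, $s\in\mathbb{R}$, the Wiener amalgam space $W^{p,q}_s$ consists of $f\in\mathcal S'$ with $\|f\|_{W^{p,q}_s}=\big\|\,\|V_\phi f(x,\xi)\langle\xi\rangle^s\|_{L^q_\xi}\big\|_{L^p_x}<\infty$ (usual modifications for $p$ or $q=\infty$); the space is independent of $\phi$, with equivalent quasi-norms; $W^{p,q}=W^{p,q}_0$. Notation: $\dot p=\min\{1,p\}$, $\dot q=\min\{1,q\}$, $\dot p\wedge\dot q=\min\{\dot p,\dot q\}$. For real-valued $\mu$, $e^{i\mu(D)}f=\mathcal F^{-1}(e^{i\mu}\hat f)$. *)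

(* Defs.v *)
(* Points of R^n are row vectors 'rV[R]_n,
   complex numbers are R[i] (mathcomp-real-closed).  The Lebesgue integral on
   R^n is realized as an iterated Lebesgue integral over R (Tonelli), since the
   library has no Lebesgue measure on R^n. *)
From mathcomp Require Import all_boot all_order all_algebra.
From mathcomp Require Import all_classical all_reals all_analysis.
From mathcomp Require Import complex.

Set Implicit Arguments.
Unset Strict Implicit.
Unset Printing Implicit Defensive.

Import Order.TTheory GRing.Theory Num.Theory.
Import numFieldNormedType.Exports.
Local Open Scope classical_set_scope.
Local Open Scope ring_scope.
Local Open Scope complex_scope.

Section WienerAmalgam.
Variable R : realType.

Definition dotv (n : nat) (x y : 'rV[R]_n) : R := \sum_(i < n) x 0 i * y 0 i.
Definition jbr (n : nat) (x : 'rV[R]_n) : R := Num.sqrt (1 + dotv x x).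

Fixpoint iint (n : nat) (F : seq R -> \bar R) : \bar R :=
  match n with
  | 0 => F [::]
  | m.+1 => (\int[@lebesgue_measure R]_(t in [set: R]) iint m (fun s => F (t :: s)))%E
  end.

Definition vec_of_seq (n : nat) (s : seq R) : 'rV[R]_n := \row_(i < n) nth 0 s i.

Definition intRn (n : nat) (F : 'rV[R]_n -> \bar R) : \bar R :=
  iint n (fun s => F (vec_of_seq n s)).

Definition rintRn (n : nat) (g : 'rV[R]_n -> R) : R :=
  fine (intRn (fun x => (Num.max (g x) 0)%:E)) -
  fine (intRn (fun x => (Num.max (- g x) 0)%:E)).

Definition cintRn (n : nat) (h : 'rV[R]_n -> R[i]) : R[i] :=
  Complex (rintRn (fun x => complex.Re (h x))) (rintRn (fun x => complex.Im (h x))).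

Definition lebRn (n : nat) (A : set 'rV[R]_n) : \bar R :=
  intRn (fun x => (\1_A x)%:E).

Definition esssupRn (n : nat) (F : 'rV[R]_n -> \bar R) : \bar R :=
  ereal_inf [set c : \bar R | lebRn [set x | (c < F x)%E] = 0%E].

Definition LqRn (n : nat) (q : \bar R) (F : 'rV[R]_n -> \bar R) : \bar R :=
  match q with
  | r%:E => poweR (intRn (fun x => poweR (F x) r)) r^-1
  | +oo%E => esssupRn F
  | -oo%E => 0%E
  end.

Definition cabs (z : R[i]) : R :=
  Num.sqrt (complex.Re z ^+ 2 + complex.Im z ^+ 2).

Definition expi (t : R) : R[i] := Complex (cos t) (sin t).

Definition fourier (n : nat) (f : 'rV[R]_n -> R[i]) (xi : 'rV[R]_n) : R[i] :=
  cintRn (fun x => f x * expi (- (2 * pi * dotv x xi))).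

Definition ifourier (n : nat) (g : 'rV[R]_n -> R[i]) (x : 'rV[R]_n) : R[i] :=
  cintRn (fun xi => g xi * expi (2 * pi * dotv x xi)).

Definition emuD (n : nat) (mu : 'rV[R]_n -> R) (f : 'rV[R]_n -> R[i])
    : 'rV[R]_n -> R[i] :=
  ifourier (fun xi => expi (mu xi) * fourier f xi).

(* fixed (real, nonzero) Schwartz window: the Gaussian e^{-pi |x|^2} *)
Definition gwin (n : nat) (x : 'rV[R]_n) : R := expR (- (pi * dotv x x)).

Definition stft (n : nat) (f : 'rV[R]_n -> R[i]) (x xi : 'rV[R]_n) : R[i] :=
  cintRn (fun y => f y * (gwin (y - x))%:C * expi (- (2 * pi * dotv y xi))).

Definition wnorm (n : nat) (p q : \bar R) (s : R) (f : 'rV[R]_n -> R[i]) : \bar R :=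
  LqRn p (fun x => LqRn q (fun xi => (cabs (stft f x xi) * powR (jbr xi) s)%:E)).

Definition dotexp (p : \bar R) : R := fine (Order.min 1%E p).

Definition ebasis (n : nat) (j : 'I_n) : 'rV[R]_n := delta_mx 0 j.

Definition partialj (n : nat) (j : 'I_n) (g : 'rV[R]_n -> R) : 'rV[R]_n -> R :=
  fun x => 'D_(ebasis j) g x.

Definition iter_partial (n : nat) (js : seq 'I_n) (g : 'rV[R]_n -> R) :=
  foldr (fun j h => partialj j h) g js.

Definition C1 (n : nat) (mu : 'rV[R]_n -> R) : Prop :=
  (forall x, differentiable mu x) /\ (forall j : 'I_n, continuous (partialj j mu)).

Definition schwartzR (n : nat) (g : 'rV[R]_n -> R) : Prop :=
  (forall (js : seq 'I_n) x, differentiable (iter_partial js g) x) /\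
  (forall (js : seq 'I_n) (N : nat), exists C : R,
      forall x, jbr x ^+ N * `|iter_partial js g x| <= C).

Definition schwartz (n : nat) (f : 'rV[R]_n -> R[i]) : Prop :=
  schwartzR (fun x => complex.Re (f x)) /\ schwartzR (fun x => complex.Im (f x)).

(* polynomial growth (the function defines a tempered distribution) *)
Definition poly_growth (n : nat) (g : 'rV[R]_n -> R) : Prop :=
  exists (C : R) (N : nat), forall x, `|g x| <= C * jbr x ^+ N.

End WienerAmalgam.

(* Main.v *)
(** Write g for the Gaussian window, V_g for the short-time Fourier transform,
m = e^{i mu}, r = min(1, p, q) and s = n / r + eps, so that s > n and r s > n.
The hypothesis bounds V_g (d_j mu)(x, .) by C <.>^-s for almost every x.
Integrating by parts against g^{b+1} and using that the Fourier transform of a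
product is a convolution, each additional factor g gains one power of decay:
|V_{g^b} m(xi, y)| <= C <y>^-s for some b and almost every xi.

Up to a unimodular factor, V_g (e^{i mu(D)} f)(x, xi) is V_g (m \hat f)(xi, -x).
The window g is a superposition of translates of g^{b+1}, and
V_{g^{b+1}} (m \hat f)(xi, y) = int e^{2 pi i w.xi} V_g f(w, xi) V_{g^b} m(xi, y + w) dw.
Hence G = |V_g (e^{i mu(D)} f)| and F = |V_g f| (the case mu = 0) are both at most
C int int <t>^-s <w - x>^-s F(w, xi + t) dw dt. The kernel is submultiplicative, so
Peetre's trick lowers the exponents: G^r <= C int int (<t>^-s <w - x>^-s F)^r.
As r s > n and p / r, q / r >= 1, Minkowski's inequality in xi, then in x,
finishes the proof. *)
From HB Require Import structures.
Require Import Defs.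
From mathcomp Require Import all_boot all_order all_algebra.
From mathcomp Require Import all_classical all_reals all_analysis.
From mathcomp Require Import measurable_realfun ess_sup_inf complex.
From mathcomp Require Import ring lra.
Set Implicit Arguments.
Unset Strict Implicit.
Unset Printing Implicit Defensive.
Import Order.TTheory GRing.Theory Num.Theory.
Import numFieldNormedType.Exports.
Local Open Scope classical_set_scope.
Local Open Scope ring_scope.
Local Open Scope complex_scope.
Local Notation Re := complex.Re.
Local Notation Im := complex.Im.

(** * Lebesgue measure on row vectors *)

(** When [r < 1] no triangle inequality is available for the quasi-norms, and this shapes the proof:
    [s > n] serves the convolutions in the bootstrap, [r s > n] makes the kernel integrable once its
    exponents have been lowered. The case mu = 0 is there because Peetre's trick needs [F] to be
    dominated by the integral of [F] itself: the supremum S of the kernel against [F] then satisfies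
    S <= C S^(1-r) I, and S^(1-r) can be divided out as soon as S is finite. Finiteness comes from a
    bound on [F] that depends on f but enters no constant. The bootstrap consumes one Gaussian
    factor per power of decay, so the decay of V m is known for g^b with b of the order of s, not
    for g. Returning to g is possible because a wide Gaussian averages translates of a narrower one.
    The derivatives of mu are merely continuous and of polynomial growth, and the bound on their
    transforms holds almost everywhere only. The transform of a product is therefore estimated
    through a Gaussian regularization, as an inequality between moduli; no inversion theorem is
    used. *)

Section rV_measurable.
Variables (R : realType) (n : nat).

(** The sigma-algebra generated by the coordinates makes a map into row vectors measurable as soon
    as its coordinates are. *)
Let coors (i : 'I_n) (x : 'rV[R]_n) : R := x 0 i.

Let rV_set0 : g_sigma_preimage coors set0.
Proof. exact: sigma_algebra0. Qed.

Let rV_setC A : g_sigma_preimage coors A -> g_sigma_preimage coors (~` A).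
Proof. exact: sigma_algebraC. Qed.

Let rV_bigcup (F : _^nat) : (forall i, g_sigma_preimage coors (F i)) ->
  g_sigma_preimage coors (\bigcup_i (F i)).
Proof. exact: sigma_algebra_bigcup. Qed.

HB.instance Definition _ := @isMeasurable.Build default_measure_display
  'rV[R]_n (g_sigma_preimage coors) rV_set0 rV_setC rV_bigcup.

End rV_measurable.

(* The canonical instances of [m1 \x m2] only provide sigma-finiteness for
   subprobability measures. *)
Lemma product_sigma_finite d1 d2 (T1 : measurableType d1) (T2 : measurableType d2)
    (R : realType) (m1 : {sigma_finite_measure set T1 -> \bar R})
    (m2 : {sigma_finite_measure set T2 -> \bar R}) :
  sigma_finite setT (m1 \x m2)%E.
Proof.
have /sigma_finiteP[F [TF ndF Foo]] := sigma_finiteT m1.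
have /sigma_finiteP[G [TG ndG Goo]] := sigma_finiteT m2.
exists (fun k => F k `*` G k) => [|k]; last first.
  have [[mF Fk] [mG Gk]] := (Foo k, Goo k); split; first exact: measurableX.
  by rewrite product_measure1E// lte_mul_pinfty// ge0_fin_numE.
apply/esym; rewrite -subTset => -[x y] _.
have [[i _ Fx] [j _ Gy]] : (\bigcup_i F i) x /\ (\bigcup_i G i) y.
  by rewrite -TF -TG.
exists (maxn i j) => //; split => /=.
  by move: Fx; exact/subsetPset/ndF/leq_maxl.
by move: Gy; exact/subsetPset/ndG/leq_maxr.
Qed.

Section rV_measurable_theory.
Variable R : realType.

Lemma measurable_coord n (i : 'I_n) :
  measurable_fun [set: 'rV[R]_n] (fun x : 'rV[R]_n => x 0 i).
Proof.
move=> _ Y mY; rewrite setTI; apply: sub_sigma_algebra => /=.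
rewrite -bigcup_seq/=; exists i => /=; first by rewrite mem_index_enum.
by exists Y => //; rewrite setTI.
Qed.

Lemma measurable_fun_rV d (T : measurableType d) n (f : T -> 'rV[R]_n) :
  (forall i, measurable_fun setT (fun x => f x 0 i)) -> measurable_fun setT f.
Proof.
move=> mf; have : g_sigma_preimage (fun i x => f x 0 i) `<=` measurable.
  apply: smallest_sub; first exact: sigma_algebra_measurable.
  case: n => [|n] in f mf *; first by rewrite big_ord0.
  by rewrite -bigcup_mkord_ord; apply: bigcup_sub => i Ii A [B mB <-]; exact: mf.
(* Generating a sigma-algebra commutes with taking preimages along [f]. *)
have -> : (fun (i : 'I_n) x => f x 0 i) = (fun i => (fun v : 'rV[R]_n => v 0 i) \o f) by [].
rewrite g_sigma_preimage_comp => prefS _ A mA; apply: prefS.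
by exists A.
Qed.

Lemma measurable_fun_coord d (T : measurableType d) n (f : T -> 'rV[R]_n) i :
  measurable_fun setT f -> measurable_fun setT (fun x => f x 0 i).
Proof. by move=> mf; apply: (measurableT_comp (measurable_coord i)). Qed.

Section ops.
Context d (T : measurableType d) (n : nat).
Implicit Types f g : T -> 'rV[R]_n.

Lemma measurable_rVD f g : measurable_fun setT f -> measurable_fun setT g ->
  measurable_fun setT (fun x => f x + g x).
Proof.
move=> mf mg; apply: measurable_fun_rV => i.
under eq_fun do rewrite mxE.
by apply: measurable_funD; apply: measurable_fun_coord.
Qed.

Lemma measurable_rVZ (h : T -> R) f : measurable_fun setT h ->
  measurable_fun setT f -> measurable_fun setT (fun x => h x *: f x).
Proof.
move=> mh mf; apply: measurable_fun_rV => i.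
under eq_fun do rewrite mxE.
by apply: measurable_funM => //; apply: measurable_fun_coord.
Qed.

Lemma measurable_rVN f : measurable_fun setT f ->
  measurable_fun setT (fun x => - f x).
Proof.
move=> mf; under eq_fun do rewrite -scaleN1r.
exact: measurable_rVZ.
Qed.

Lemma measurable_rVB f g : measurable_fun setT f -> measurable_fun setT g ->
  measurable_fun setT (fun x => f x - g x).
Proof. by move=> mf mg; apply: measurable_rVD => //; apply: measurable_rVN. Qed.

Lemma measurable_dotv f g : measurable_fun setT f -> measurable_fun setT g ->
  measurable_fun setT (fun x => dotv (f x) (g x)).
Proof.
move=> mf mg; apply: measurable_sum => i.
by apply: measurable_funM; apply: measurable_fun_coord.
Qed.

End ops.

(** Together with [unconsv], identifies R x R^n with R^(n+1) in the way in which [iint] peels off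
    the head of a sequence. *)
Definition consv n (p : measurableTypeR R * 'rV[R]_n) : 'rV[R]_n.+1 :=
  \row_i oapp (fun j => p.2 0 j) p.1 (unlift ord0 i).

Definition unconsv n (x : 'rV[R]_n.+1) : measurableTypeR R * 'rV[R]_n :=
  (x 0 ord0, \row_j x 0 (lift ord0 j)).

Lemma consvK n : cancel (@consv n) (@unconsv n).
Proof.
move=> [t x]; rewrite /unconsv !mxE unlift_none/=; congr pair.
by apply/rowP => j; rewrite !mxE liftK.
Qed.

Lemma measurable_consv n : measurable_fun setT (@consv n).
Proof.
apply: measurable_fun_rV => i; under eq_fun do rewrite mxE.
case: (unliftP ord0 i) => [j _|_]/=; last exact: measurable_fst.
by apply: measurable_fun_coord; exact: measurable_snd.
Qed.

Lemma measurable_unconsv n : measurable_fun setT (@unconsv n).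
Proof.
apply/measurable_fun_pairP; split; first exact: measurable_coord.
apply: measurable_fun_rV => i; under eq_fun do rewrite /= mxE.
exact: measurable_coord.
Qed.

Let leb : {sigma_finite_measure set (measurableTypeR R) -> \bar R} := @lebesgue_measure R.

Section consv_measure.
Variables (n : nat) (mu : {sigma_finite_measure set 'rV[R]_n -> \bar R}).

(** Transporting the product measure along [consv] turns Tonelli's theorem into the recursion that
    defines [iint]. *)
Definition cons_measure : set 'rV[R]_n.+1 -> \bar R :=
  pushforward (leb \x mu)%E (@consv n).

Let cons_measure0 : cons_measure set0 = 0%E.
Proof. by rewrite /cons_measure /pushforward preimage_set0 measure0. Qed.

Let mconsv A : measurable A -> measurable (@consv n @^-1` A).
Proof. by move=> mA; rewrite -[X in measurable X]setTI; exact: measurable_consv. Qed.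

Let cons_measure_ge0 A : (0 <= cons_measure A)%E.
Proof. by rewrite /cons_measure /pushforward; exact: measure_ge0. Qed.

Let cons_measure_sigma_additive : semi_sigma_additive cons_measure.
Proof.
move=> F mF tF mUF; rewrite /cons_measure /pushforward preimage_bigcup.
apply: measure_semi_sigma_additive.
- by move=> k; exact: mconsv.
- apply/trivIsetP => /= i j _ _ ij; rewrite -preimage_setI.
  by move/trivIsetP : tF => /(_ _ _ _ _ ij) ->//; rewrite preimage_set0.
- by rewrite -preimage_bigcup; exact: mconsv.
Qed.

HB.instance Definition _ := isMeasure.Build _ _ _ cons_measure
  cons_measure0 cons_measure_ge0 cons_measure_sigma_additive.

Let cons_measure_sigma_finite : sigma_finite setT cons_measure.
Proof.
have [F FT Foo] := product_sigma_finite leb mu.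
exists (fun k => @unconsv n @^-1` F k).
  by rewrite -preimage_bigcup -FT preimage_setT.
move=> k; have [mF Fk] := Foo k; split.
  by rewrite -[X in measurable X]setTI; exact: measurable_unconsv.
rewrite /cons_measure /pushforward -comp_preimage.
by rewrite (_ : _ \o _ = id) ?preimage_id//; apply/funext => x; exact: consvK.
Qed.

HB.instance Definition _ := Measure_isSigmaFinite.Build _ _ _ cons_measure
  cons_measure_sigma_finite.

End consv_measure.

Section dirac_rV0.
Let diracT : sigma_finite setT (@dirac _ 'rV[R]_0 0 R).
Proof.
by apply: fin_num_fun_sigma_finite => [|A mA]; rewrite ?measure0 ?diracE.
Qed.
Definition lebn0 : set 'rV[R]_0 -> \bar R := @dirac _ 'rV[R]_0 0 R.
HB.instance Definition _ := Measure.on lebn0.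
HB.instance Definition _ := Measure_isSigmaFinite.Build _ _ _ lebn0 diracT.
End dirac_rV0.

Fixpoint lebn n : {sigma_finite_measure set 'rV[R]_n -> \bar R} :=
  match n return {sigma_finite_measure set 'rV[R]_n -> \bar R} with
  | 0 => lebn0
  | m.+1 => cons_measure (lebn m)
  end.

Local Open Scope ereal_scope.

Lemma ge0_integral_lebnS n (F : 'rV[R]_n.+1 -> \bar R) :
  measurable_fun setT F -> (forall x, 0 <= F x) ->
  \int[lebn n.+1]_x F x =
  \int[@lebesgue_measure R]_t \int[lebn n]_x F (consv (t, x)).
Proof.
move=> mF F0.
rewrite [LHS](@ge0_integral_pushforward _ _ _ _ _ _ (@measurable_consv n))//.
rewrite preimage_setT fubini_tonelli1//; last by move=> x /=.
by apply: (measurableT_comp mF); exact: measurable_consv.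
Qed.

Lemma ge0_integral_lebn0 (F : 'rV[R]_0 -> \bar R) :
  measurable_fun setT F -> (forall x, 0 <= F x) -> \int[lebn 0]_x F x = F 0%R.
Proof. by move=> mF F0; rewrite integral_dirac// diracT mul1e. Qed.

Lemma vec_of_seq_cons n t s :
  vec_of_seq n.+1 (t :: s) = consv (t, vec_of_seq n s) :> 'rV[R]_n.+1.
Proof.
apply/rowP => i; rewrite !mxE.
by case: unliftP => [j ->|->]//=; rewrite mxE.
Qed.

Lemma measurable_consvr n t : measurable_fun setT (fun x : 'rV[R]_n => consv (t, x)).
Proof. by apply: (measurableT_comp (@measurable_consv n)); apply: measurable_fun_pair. Qed.

(** The bridge from the iterated integrals of the statement to an actual measure: integrals, null
    sets and norms of the statement are all converted to [lebn] through this identity. *)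
Lemma intRnE n (F : 'rV[R]_n -> \bar R) :
  measurable_fun setT F -> (forall x, 0 <= F x) -> intRn F = \int[lebn n]_x F x.
Proof.
rewrite /intRn; elim: n F => [|n IH] F mF F0.
  by rewrite ge0_integral_lebn0//=; congr F; apply/rowP => -[].
rewrite ge0_integral_lebnS//=; apply: eq_integral => t _.
rewrite -IH//; last by apply: (measurableT_comp mF); exact: measurable_consvr.
by congr (iint n _); apply/funext => s; rewrite vec_of_seq_cons.
Qed.

End rV_measurable_theory.

(** * Changes of variables *)

Section lebesgue1_substitution.
Variable R : realType.
Local Open Scope ereal_scope.
Local Notation leb := (@lebesgue_measure R).

(** The pushforward under the translation gives every half-open interval its length, hence is
    Lebesgue measure by uniqueness. The dilation below is treated alike, after rescaling the
    pushforward by [c]. *)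
Lemma ge0_integral_shift1 (a : R) (f : R -> \bar R) :
  measurable_fun setT f -> (forall t, 0 <= f t) ->
  \int[leb]_t f (t + a)%R = \int[leb]_t f t.
Proof.
move=> mf f0; pose phi : measurableTypeR R -> measurableTypeR R := fun t => (t + a)%R.
have mphi : measurable_fun setT phi by apply: measurable_funD.
transitivity (\int[pushforward leb phi]_t f t).
  by rewrite ge0_integral_pushforward// preimage_setT.
apply: eq_measure_integral => A mA _ /=.
apply/esym/(lebesgue_measure_unique (mu := pushforward leb phi)) => //= _ [[x y]] _ <-.
rewrite /pushforward (_ : phi @^-1` _ = [set` `](x - a)%R, (y - a)%R]]); last first.
  by apply/seteqP; split => t; rewrite /phi/= !in_itv/= ltrBlDr lerBrDr.
by rewrite !lebesgue_measure_itv/= !lte_fin ltrD2r -!EFinB opprB addrA subrK.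
Qed.

Lemma ge0_integral_scale1 (c : R) (f : R -> \bar R) : (0 < c)%R ->
  measurable_fun setT f -> (forall t, 0 <= f t) ->
  \int[leb]_t f (c * t)%R = c^-1%:E * \int[leb]_t f t.
Proof.
move=> c0 mf f0; pose phi : measurableTypeR R -> measurableTypeR R := fun t => (c * t)%R.
have mphi : measurable_fun setT phi by apply: measurable_funM.
have c0' : (0 <= c)%R by exact: ltW.
pose nu0 : {measure set (measurableTypeR R) -> \bar R} :=
  mscale (NngNum c0') (pushforward leb phi).
pose nu := nu0 mphi.
have nuE : \int[nu]_t f t = \int[leb]_t f t.
  apply: eq_measure_integral => A mA _ /=.
  apply/esym/(lebesgue_measure_unique (mu := nu)) => //= _ [[x y]] _ <-.
  rewrite /nu /nu0 /mscale/= /pushforward (_ : phi @^-1` _ = [set` `](x / c)%R, (y / c)%R]]); last first.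
    by apply/seteqP; split => t; rewrite /phi/= !in_itv/= ltr_pdivrMr// ler_pdivlMr// mulrC.
  rewrite !lebesgue_measure_itv/= !lte_fin ltr_pM2r ?invr_gt0//.
  case: ifPn => _; last by rewrite mule0.
  by rewrite -!EFinB -EFinM; congr EFin; field; rewrite gt_eqF.
rewrite -nuE ge0_integral_mscale// ge0_integral_pushforward// preimage_setT.
by rewrite muleA -EFinM mulVf ?gt_eqF// mul1e.
Qed.

Lemma ge0_integral_opp1 (f : R -> \bar R) :
  measurable_fun setT f -> (forall t, 0 <= f t) ->
  \int[leb]_t f (- t)%R = \int[leb]_t f t.
Proof.
move=> mf f0; pose phi : measurableTypeR R -> measurableTypeR R := fun t => (- t)%R.
have mphi : measurable_fun setT phi by exact: measurable_funN.
transitivity (\int[pushforward leb phi]_t f t).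
  by rewrite ge0_integral_pushforward// preimage_setT.
by apply: eq_measure_integral => A mA _ /=; exact: lebesgue_measureN.
Qed.

End lebesgue1_substitution.

Section lebn_substitution.
Variable R : realType.
Local Open Scope ereal_scope.
Local Notation leb := (@lebesgue_measure R).

Lemma consv_rV n (P : forall i : 'I_n.+1, R -> R) t (x : 'rV[R]_n) :
  \row_i P i (consv (t, x) 0%R i) =
  consv (P ord0 t, \row_i P (lift ord0 i) (x 0%R i)).
Proof.
by apply/rowP => i; rewrite !mxE; case: unliftP => [j ->|->]//=; rewrite mxE.
Qed.

Lemma measurable_rV_map n (phi : 'I_n -> R -> R) :
  (forall i, measurable_fun setT (phi i)) ->
  measurable_fun setT (fun x : 'rV[R]_n => \row_i phi i (x 0%R i) : 'rV[R]_n).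
Proof.
move=> mphi; apply: measurable_fun_rV => i; under eq_fun do rewrite mxE.
by apply: (measurableT_comp (mphi i)); exact: measurable_coord.
Qed.

(** Maps acting on each coordinate separately, with the same Jacobian factor [k] for each, cover
    translations, the reflection and dilations at once. *)
Lemma ge0_integral_lebn_subst n (k : R) (phi : 'I_n -> R -> R) (F : 'rV[R]_n -> \bar R) :
  (0 <= k)%R ->
  (forall i, measurable_fun setT (phi i)) ->
  (forall i (f : R -> \bar R), measurable_fun setT f -> (forall t, 0 <= f t) ->
    \int[leb]_t f (phi i t) = k%:E * \int[leb]_t f t) ->
  measurable_fun setT F -> (forall x, 0 <= F x) ->
  \int[lebn R n]_x F (\row_i phi i (x 0%R i)) = (k ^+ n)%:E * \int[lebn R n]_x F x.
Proof.
move=> k0; elim: n phi F => [|n IH] phi F mphi phiE mF F0.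
  rewrite !ge0_integral_lebn0// ?mul1e; first by congr F; apply/rowP => -[].
  by apply: (measurableT_comp mF); exact: measurable_rV_map.
have mFc : measurable_fun setT (fun p => F (consv p)).
  by apply: (measurableT_comp mF); exact: measurable_consv.
have mFt t : measurable_fun setT (fun x => F (consv (t, x))).
  by apply: (measurableT_comp mF); exact: measurable_consvr.
rewrite ge0_integral_lebnS//; last first.
  by apply: (measurableT_comp mF); exact: measurable_rV_map.
pose I1 : measurableTypeR R -> \bar R := fun t => \int[lebn R n]_x F (consv (t, x)).
have mI : measurable_fun setT I1 by exact: (measurable_fun_fubini_tonelli_F _ mFc).
have I10 t : 0 <= I1 t by exact: integral_ge0.
transitivity (\int[leb]_t ((k ^+ n)%:E * I1 (phi ord0 t))).
  apply: eq_integral => t _; under eq_integral do rewrite consv_rV.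
  exact: (IH (fun i => phi (lift ord0 i)) (fun x => F (consv (phi ord0 t, x)))
    (fun i => mphi _) (fun i => phiE _) (mFt _) (fun x => F0 _)).
rewrite ge0_integralZl//; last 2 first.
- by apply: (measurableT_comp mI); exact: mphi.
- by rewrite lee_fin exprn_ge0.
by rewrite (phiE ord0 I1)// muleA -EFinM -exprSr -ge0_integral_lebnS.
Qed.

Lemma ge0_integral_lebn_shift n (a : 'rV[R]_n) (F : 'rV[R]_n -> \bar R) :
  measurable_fun setT F -> (forall x, 0 <= F x) ->
  \int[lebn R n]_x F (x + a)%R = \int[lebn R n]_x F x.
Proof.
move=> mF F0.
have -> : \int[lebn R n]_x F x = (1 ^+ n)%:E * \int[lebn R n]_x F x.
  by rewrite expr1n mul1e.
rewrite -(ge0_integral_lebn_subst (phi := fun i t => (t + a 0%R i)%R))//.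
- by apply: eq_integral => x _; congr F; apply/rowP => i; rewrite !mxE.
- by move=> i; apply: measurable_funD.
- by move=> i f mf f0; rewrite mul1e ge0_integral_shift1.
Qed.

Lemma ge0_integral_lebn_opp n (F : 'rV[R]_n -> \bar R) :
  measurable_fun setT F -> (forall x, 0 <= F x) ->
  \int[lebn R n]_x F (- x)%R = \int[lebn R n]_x F x.
Proof.
move=> mF F0.
have -> : \int[lebn R n]_x F x = (1 ^+ n)%:E * \int[lebn R n]_x F x.
  by rewrite expr1n mul1e.
rewrite -(ge0_integral_lebn_subst (phi := fun i t => (- t)%R))//.
- by apply: eq_integral => x _; congr F; apply/rowP => i; rewrite !mxE.
- by move=> i; exact: measurable_funN.
- by move=> i f mf f0; rewrite mul1e ge0_integral_opp1.
Qed.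

Lemma ge0_integral_lebn_scale n (c : R) (F : 'rV[R]_n -> \bar R) :
  (0 < c)%R -> measurable_fun setT F -> (forall x, 0 <= F x) ->
  \int[lebn R n]_x F (c *: x)%R = (c^-1 ^+ n)%:E * \int[lebn R n]_x F x.
Proof.
move=> c0 mF F0.
rewrite -(ge0_integral_lebn_subst (phi := fun i t => (c * t)%R))//.
- by apply: eq_integral => x _; congr F; apply/rowP => i; rewrite !mxE.
- by rewrite invr_ge0 ltW.
- by move=> i; apply: measurable_funM.
- by move=> i f mf f0; rewrite ge0_integral_scale1.
Qed.

End lebn_substitution.

(** * Measurability of continuous functions *)

Section continuous_measurable.
Variable R : realType.

(** The sigma-algebra is generated by coordinates and not by open sets. [F] is therefore the
    pointwise limit of its values at the corners of a grid of mesh 1/(k+1); such a step function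
    takes countably many values, on half-open cubes. *)
Lemma continuous_measurable_rV n (F : 'rV[R]_n -> R) :
  continuous F -> measurable_fun setT F.
Proof.
move=> cF.
pose grid k (c : 'rV[int]_n) : 'rV[R]_n := map_mx (fun z : int => z%:~R / k.+1%:R) c.
pose cell k (x : 'rV[R]_n) : 'rV[int]_n := \row_i Num.floor (k.+1%:R * x 0 i).
apply: (@measurable_fun_cvg _ _ _ _ (fun k x => F (grid k (cell k x)))).
- move=> k _ B mB; rewrite setTI.
  rewrite (_ : _ @^-1` B = \bigcup_c
      [set x | cell k x = c /\ B (F (grid k c))]); last first.
    apply/seteqP; split => [x Bx|x [c _ [<-]]//].
    by exists (cell k x).
  apply: countable_bigcupT_measurable => // c.
  have [Bc|Bc] := pselect (B (F (grid k c))); last first.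
    rewrite (_ : [set x | _] = set0)//.
    by apply/seteqP; split => x //= -[].
  rewrite (_ : [set x | _] = \bigcap_(i in [set: 'I_n])
      (fun x : 'rV[R]_n => k.+1%:R * x 0 i) @^-1`
        [set` `[(c 0 i)%:~R, (c 0 i + 1)%:~R[]); last first.
    apply/seteqP; split => [x /= [cE _] i _|x /= cE]/=.
      by rewrite in_itv/= -cE mxE floor_itv.
    split => //; apply/rowP => i; rewrite mxE; apply/eqP.
    by rewrite floor_eq; have := cE i I; rewrite /= in_itv.
  apply: fin_bigcap_measurable => // i _.
  rewrite -[X in measurable X]setTI.
  have : measurable_fun setT (fun x : 'rV[R]_n => k.+1%:R * x 0 i).
    by apply: measurable_funM => //; exact: measurable_coord.
  by apply => //; exact: measurable_itv.
- move=> x _.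
  apply: (@cvg_comp _ _ _ (fun k => grid k (cell k x)) F _ (nbhs x)); last exact: cF.
  apply/cvg_ballP => e e0; near=> k; split => // i j.
  have k0 : 0 < k.+1%:R :> R by rewrite ltr0n.
  rewrite (ord1 i) /grid /cell !mxE /ball/=.
  have /andP[] := floor_itv (k.+1%:R * x 0 j); set z := Num.floor _ => z1 z2.
  have -> : x 0 j - z%:~R / k.+1%:R = (k.+1%:R * x 0 j - z%:~R) / k.+1%:R.
    by field; rewrite gt_eqF.
  rewrite normrM normfV (gtr0_norm k0) ltr_pdivrMr// ger0_norm ?subr_ge0//.
  have : 1 <= e * k.+1%:R.
    rewrite -ler_pdivrMl// mulr1.
    by near: k; exists (Num.truncn e^-1) => // k /= ?; rewrite (le_trans (ltW (truncnS_gt _)))// ler_nat.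
  by rewrite intrD in z2; lra.
Unshelve. all: by end_near.
Qed.

End continuous_measurable.

(** * Complex-valued integrals *)

Section complex_modulus.
Variable R : realType.
Implicit Types x y : R[i].

Lemma ReD x y : Re (x + y) = Re x + Re y. Proof. by case: x y => a b []. Qed.
Lemma ImD x y : Im (x + y) = Im x + Im y. Proof. by case: x y => a b []. Qed.
Lemma ReM x y : Re (x * y) = Re x * Re y - Im x * Im y.
Proof. by case: x y => a b []. Qed.
Lemma ImM x y : Im (x * y) = Re x * Im y + Im x * Re y.
Proof. by case: x y => a b []. Qed.

Lemma complex_ext x y : Re x = Re y -> Im x = Im y -> x = y.
Proof. by case: x y => a b [c d] /= -> ->. Qed.

Lemma cabs_normc x : cabs x = ComplexField.Normc.normc x.
Proof. by case: x. Qed.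

Lemma cabs_ge0 x : 0 <= cabs x. Proof. exact: sqrtr_ge0. Qed.

Lemma cabsM x y : cabs (x * y) = cabs x * cabs y.
Proof. by rewrite !cabs_normc ComplexField.Normc.normcM. Qed.

Lemma cabsD x y : cabs (x + y) <= cabs x + cabs y.
Proof. by rewrite !cabs_normc le_normcD. Qed.

Lemma cabs_real (a : R) : cabs a%:C = `|a|.
Proof. by rewrite /cabs/= expr0n/= addr0 sqrtr_sqr. Qed.

Lemma cabs_expi (t : R) : cabs (expi t) = 1.
Proof. by rewrite /cabs/= cos2Dsin2 sqrtr1. Qed.

Lemma expiD (s t : R) : expi (s + t) = expi s * expi t.
Proof. by apply: complex_ext; rewrite ?ReM ?ImM/= ?cosD ?sinD// addrC. Qed.

Lemma expi0 : expi 0 = 1 :> R[i].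
Proof. by rewrite /expi cos0 sin0. Qed.

Lemma cabs_expiM t x : cabs (expi t * x) = cabs x.
Proof. by rewrite cabsM cabs_expi mul1r. Qed.

Lemma cabsMr (a : R) x : cabs (x * a%:C) = cabs x * `|a|.
Proof. by rewrite cabsM cabs_real. Qed.

Lemma sqr_cabs x : cabs x ^+ 2 = Re x ^+ 2 + Im x ^+ 2.
Proof. by rewrite sqr_sqrtr// addr_ge0// sqr_ge0. Qed.

Lemma normr_Re_cabs x : `|Re x| <= cabs x.
Proof. by rewrite -sqrtr_sqr ler_wsqrtr// lerDl sqr_ge0. Qed.

Lemma normr_Im_cabs x : `|Im x| <= cabs x.
Proof. by rewrite -sqrtr_sqr ler_wsqrtr// lerDr sqr_ge0. Qed.

Lemma cabs_le_ReIm x : cabs x <= `|Re x| + `|Im x|.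
Proof.
rewrite -(@ler_pXn2r _ 2) ?nnegrE ?cabs_ge0 ?addr_ge0// sqr_cabs.
rewrite sqrrD -!normrX !(ger0_norm (sqr_ge0 _)).
by rewrite lerD2r lerDl mulrn_wge0// mulr_ge0.
Qed.

(** Cauchy-Schwarz in the plane, by Lagrange's identity. *)
Lemma dot_cabs x y : Re x * Re y + Im x * Im y <= cabs x * cabs y.
Proof.
have [//|] := leP (Re x * Re y + Im x * Im y) 0.
  by move=> /le_trans; apply; rewrite mulr_ge0 ?cabs_ge0.
move=> d0; rewrite -(@ler_pXn2r _ 2) ?nnegrE ?mulr_ge0 ?cabs_ge0 ?(ltW d0)//.
rewrite exprMn !sqr_cabs.
have := sqr_ge0 (Re x * Im y - Im x * Re y).
by nra.
Qed.

End complex_modulus.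

Section complex_integral.
Context d (T : measurableType d) (R : realType) (mu : {measure set T -> \bar R}).
Implicit Types h k : T -> R[i].

Definition cmeas h := measurable_fun setT (fun x => Re (h x)) /\
  measurable_fun setT (fun x => Im (h x)).

Definition cintegrable h := mu.-integrable setT (fun x => (Re (h x))%:E) /\
  mu.-integrable setT (fun x => (Im (h x))%:E).

Definition cint h : R[i] :=
  Complex (\int[mu]_x Re (h x))%R (\int[mu]_x Im (h x))%R.

Lemma cmeasM h k : cmeas h -> cmeas k -> cmeas (fun x => h x * k x).
Proof.
move=> [hr hi] [kr ki]; split.
  under eq_fun do rewrite ReM.
  by apply: measurable_funB; apply: measurable_funM.
under eq_fun do rewrite ImM.
by apply: measurable_funD; apply: measurable_funM.
Qed.

Lemma cmeas_real (f : T -> R) : measurable_fun setT f -> cmeas (fun x => (f x)%:C).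
Proof. by move=> mf; split. Qed.

Lemma cmeas_cst (c : R[i]) : cmeas (fun=> c).
Proof. by split; apply: measurable_cst. Qed.

Lemma cmeas_expi (f : T -> R) : measurable_fun setT f -> cmeas (fun x => expi (f x)).
Proof.
move=> mf; split => /=; apply: (measurableT_comp _ mf).
- by apply: continuous_measurable_fun; exact: continuous_cos.
- by apply: continuous_measurable_fun; exact: continuous_sin.
Qed.

Lemma measurable_cabs h : cmeas h -> measurable_fun setT (fun x => cabs (h x)).
Proof.
move=> [hr hi]; apply: (measurableT_comp (f := @Num.sqrt R)).
  by apply: continuous_measurable_fun; exact: sqrt_continuous.
by apply: measurable_funD; apply: measurable_funX.
Qed.

Lemma cintegrable_meas h : cintegrable h -> cmeas h.
Proof. by move=> [/measurable_int/measurable_EFinP ? /measurable_int/measurable_EFinP ?]. Qed.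

Lemma cintegrable_dom h (g : T -> R) : cmeas h ->
  mu.-integrable setT (EFin \o g) -> (forall x, cabs (h x) <= g x) -> cintegrable h.
Proof.
move=> [hr hi] ig hg; split; (apply: le_integrable ig => //; first exact/measurable_EFinP);
  move=> x _ /=; rewrite lee_fin (le_trans _ (ler_norm _))//;
  apply: le_trans (hg x); [exact: normr_Re_cabs|exact: normr_Im_cabs].
Qed.

Lemma cintegrable_cabs h : cintegrable h -> mu.-integrable setT (fun x => (cabs (h x))%:E).
Proof.
move=> ih; have mh := cintegrable_meas ih; case: ih => ir ii.
have := integrableD measurableT (integrable_abse ir) (integrable_abse ii).
apply: le_integrable => //; first exact/measurable_EFinP/measurable_cabs.
move=> x _ /=; rewrite lee_fin ger0_norm ?cabs_ge0//.
by rewrite (le_trans (cabs_le_ReIm _))// ler_norm.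
Qed.

Lemma eq_cint h k : h =1 k -> cint h = cint k.
Proof. by move=> hk; congr cint; apply/funext. Qed.

Lemma cintD h k : cintegrable h -> cintegrable k ->
  cint (fun x => h x + k x) = cint h + cint k.
Proof.
move=> [hr hi] [kr ki]; apply: complex_ext => /=.
  by rewrite -RintegralD//; apply: eq_Rintegral => x _; rewrite ReD.
by rewrite -RintegralD//; apply: eq_Rintegral => x _; rewrite ImD.
Qed.

Lemma cintegrableZ c h : cintegrable h -> cintegrable (fun x => c * h x).
Proof.
move=> ih; have mh := cintegrable_meas ih.
apply: (@cintegrable_dom _ (fun x => cabs c * cabs (h x))).
- by apply: cmeasM => //; exact: cmeas_cst.
- exact: (integrableZl measurableT (cabs c) (cintegrable_cabs ih)).
- by move=> x; rewrite cabsM.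
Qed.

Lemma cintZ c h : cintegrable h -> cint (fun x => c * h x) = c * cint h.
Proof.
move=> [hr hi]; apply: complex_ext; rewrite ?ReM ?ImM /=.
  rewrite -!RintegralZl// -RintegralB//=; first by apply: eq_Rintegral => x _; rewrite ReM.
    exact: (integrableZl measurableT _ hr).
  exact: (integrableZl measurableT _ hi).
rewrite -!RintegralZl// -RintegralD//=; first by apply: eq_Rintegral => x _; rewrite ImM.
  exact: (integrableZl measurableT _ hi).
exact: (integrableZl measurableT _ hr).
Qed.

(** If c is the integral, |c|^2 is the integral of the planar inner product of c with [h], which
    [dot_cabs] bounds by |c| |h|. Without integrability the right-hand side is infinite. *)
Lemma cabs_cint h : cmeas h ->
  ((cabs (cint h))%:E <= \int[mu]_x (cabs (h x))%:E)%E.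
Proof.
move=> mh; have mc : measurable_fun setT (fun x => (cabs (h x))%:E).
  exact/measurable_EFinP/measurable_cabs.
have [foo|] := boolP (\int[mu]_x (cabs (h x))%:E < +oo)%E; last first.
  by rewrite -leNgt leye_eq => /eqP ->; rewrite leey.
have ic : mu.-integrable setT (fun x => (cabs (h x))%:E).
  apply/integrableP; split => //; under eq_integral do rewrite gee0_abs ?lee_fin ?cabs_ge0//.
  exact: foo.
have [hr hi] : cintegrable h by apply: (cintegrable_dom mh ic).
rewrite -(fineK (integrable_fin_num measurableT ic)) lee_fin -/(Rintegral mu setT (fun x => cabs (h x))).
set c := cint h.
have [->|c0] := eqVneq (cabs c) 0; first by apply: Rintegral_ge0 => x _; exact: cabs_ge0.
have {c0} cgt : 0 < cabs c by rewrite lt0r c0 cabs_ge0.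
rewrite -(ler_pM2l cgt) -expr2 sqr_cabs !expr2 {2 4}/c /cint /=.
rewrite -!RintegralZl// -RintegralD//=; last 2 first.
- exact: (integrableZl measurableT _ hr).
- exact: (integrableZl measurableT _ hi).
apply: le_Rintegral => //.
- exact: (integrableD measurableT (integrableZl measurableT _ hr) (integrableZl measurableT _ hi)).
- exact: (integrableZl measurableT _ ic).
- by move=> x _; exact: (dot_cabs c (h x)).
Qed.

Lemma cabs_cint_le h (g : T -> R) : cmeas h ->
  mu.-integrable setT (EFin \o g) -> (forall x, cabs (h x) <= g x) ->
  cabs (cint h) <= (\int[mu]_x g x)%R.
Proof.
move=> mh ig hg; rewrite -lee_fin fineK; last exact: integrable_fin_num.
apply: le_trans (cabs_cint mh) _; apply: ge0_le_integral => //.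
- by move=> x _; rewrite lee_fin cabs_ge0.
- exact/measurable_EFinP/measurable_cabs.
- exact: measurable_int ig.
- by move=> x _; rewrite lee_fin.
Qed.

End complex_integral.

Lemma cmeas_comp d1 d2 (T1 : measurableType d1) (T2 : measurableType d2)
    (R : realType) (h : T2 -> R[i]) (f : T1 -> T2) :
  cmeas h -> measurable_fun setT f -> cmeas (h \o f).
Proof.
by move=> [hr hi] mf; split; [apply: (measurableT_comp hr)|apply: (measurableT_comp hi)].
Qed.

Lemma measurable_slice1 d1 d2 d3 (T1 : measurableType d1) (T2 : measurableType d2)
    (T3 : measurableType d3) (f : T1 -> T2 -> T3) x :
  measurable_fun setT (fun p : T1 * T2 => f p.1 p.2) -> measurable_fun setT (f x).
Proof.
move=> mf; apply: (measurableT_comp mf (f := fun p => f p.1 p.2) (g := fun y => (x, y))).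
exact: measurable_fun_pair.
Qed.

Lemma measurable_slice2 d1 d2 d3 (T1 : measurableType d1) (T2 : measurableType d2)
    (T3 : measurableType d3) (f : T1 -> T2 -> T3) y :
  measurable_fun setT (fun p : T1 * T2 => f p.1 p.2) ->
  measurable_fun setT (fun x => f x y).
Proof.
move=> mf; apply: (measurableT_comp mf (f := fun p => f p.1 p.2) (g := fun x => (x, y))).
exact: measurable_fun_pair.
Qed.

Section parametric_integral.
Context d1 d2 (T1 : measurableType d1) (T2 : measurableType d2) (R : realType).
Variables (m1 : {sigma_finite_measure set T1 -> \bar R})
          (m2 : {sigma_finite_measure set T2 -> \bar R}).

Lemma measurable_integral2 (f : T1 -> T2 -> \bar R) :
  measurable_fun setT (fun p : T1 * T2 => f p.1 p.2) ->
  measurable_fun setT (fun x => \int[m2]_y f x y)%E.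
Proof.
move=> mf; have E (x : T1) : ((f x)^\+ = (fun y => (fun p : T1 * T2 => f p.1 p.2)^\+ (x, y)))%E.
  by apply/funext => y; rewrite !funeposE.
have E' (x : T1) : ((f x)^\- = (fun y => (fun p : T1 * T2 => f p.1 p.2)^\- (x, y)))%E.
  by apply/funext => y; rewrite !funenegE.
under eq_fun do rewrite integralE E E'.
apply: emeasurable_funB.
  exact: (measurable_fun_fubini_tonelli_F _ (measurable_funepos mf)).
exact: (measurable_fun_fubini_tonelli_F _ (measurable_funeneg mf)).
Qed.

Lemma measurable_Rintegral2 (f : T1 -> T2 -> R) :
  measurable_fun setT (fun p : T1 * T2 => f p.1 p.2) ->
  measurable_fun setT (fun x => \int[m2]_y f x y)%R.
Proof.
move=> mf; rewrite /Rintegral.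
apply: (measurableT_comp (f := fine)); first exact: fine_measurable.
by apply: measurable_integral2; exact/measurable_EFinP.
Qed.

Lemma cmeas_cint2 (F : T1 -> T2 -> R[i]) :
  cmeas (fun p : T1 * T2 => F p.1 p.2) -> cmeas (fun x => cint m2 (F x)).
Proof. by move=> [mr mi]; split => /=; exact: measurable_Rintegral2. Qed.

Lemma Rintegral_Fubini (f : T1 -> T2 -> R) :
  measurable_fun setT (fun p : T1 * T2 => f p.1 p.2) ->
  (\int[m1]_x \int[m2]_y `|f x y|%:E < +oo)%E ->
  (\int[m1]_x \int[m2]_y f x y = \int[m2]_y \int[m1]_x f x y)%R.
Proof.
move=> mf foo.
have mf' : measurable_fun setT (fun p : T1 * T2 => (f p.1 p.2)%:E).
  exact/measurable_EFinP.
have intf : (m1 \x m2)%E.-integrable setT (fun p => (f p.1 p.2)%:E).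
  exact/integrable12ltyP.
(* Sections are integrable almost everywhere only; elsewhere [fine] may replace an infinite integral
   by 0, on a null set. *)
have aux1 : (\int[m1]_x (\int[m2]_y f x y)%R%:E = \int[m1]_x \int[m2]_y (f x y)%:E)%E.
  apply: ae_eq_integral => //.
  - by apply/measurable_EFinP; exact: measurable_Rintegral2.
  - exact: measurable_integral2.
  - have := ae_integrable1 intf; apply: filterS => x /= ix _.
    by rewrite fineK//; exact: integrable_fin_num.
have aux2 : (\int[m2]_y (\int[m1]_x f x y)%R%:E = \int[m2]_y \int[m1]_x (f x y)%:E)%E.
  apply: ae_eq_integral => //.
  - apply/measurable_EFinP; apply: (measurableT_comp (f := fine)); first exact: fine_measurable.
    exact: (measurable_fubini_G intf).
  - exact: (measurable_fubini_G intf).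
  - have := ae_integrable2 intf; apply: filterS => y /= iy _.
    by rewrite fineK//; exact: integrable_fin_num.
by congr fine; rewrite aux1 aux2; exact: (Fubini intf).
Qed.

Lemma cint_Fubini (F : T1 -> T2 -> R[i]) :
  cmeas (fun p : T1 * T2 => F p.1 p.2) ->
  (\int[m1]_x \int[m2]_y (cabs (F x y))%:E < +oo)%E ->
  cint m1 (fun x => cint m2 (F x)) = cint m2 (fun y => cint m1 (F ^~ y)).
Proof.
move=> mF Foo; have [mr mi] := mF.
have mc : measurable_fun setT (fun p : T1 * T2 => (cabs (F p.1 p.2))%:E).
  by apply/measurable_EFinP; exact: measurable_cabs.
have le_fin (f : T1 -> T2 -> R) : measurable_fun setT (fun p : T1 * T2 => f p.1 p.2) ->
    (forall x y, `|f x y| <= cabs (F x y)) ->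
    (\int[m1]_x \int[m2]_y `|f x y|%:E < +oo)%E.
  move=> mf fF; apply: le_lt_trans Foo.
  have mfa : measurable_fun setT (fun p : T1 * T2 => `|f p.1 p.2|%:E).
    by apply/measurable_EFinP; exact: measurableT_comp.
  apply: ge0_le_integral => //.
  - by move=> x _; exact: integral_ge0.
  - exact: measurable_integral2.
  - exact: measurable_integral2.
  - move=> x _; apply: ge0_le_integral => //.
    + exact: (measurable_slice1 (f := fun x y => `|f x y|%:E)).
    + exact: (measurable_slice1 (f := fun x y => (cabs (F x y))%:E)).
    + by move=> y _; rewrite lee_fin.
apply: complex_ext => /=; apply: Rintegral_Fubini.
- exact: mr.
- by apply: (le_fin (fun x y => Re (F x y)) mr) => x y; exact: normr_Re_cabs.
- exact: mi.
- by apply: (le_fin (fun x y => Im (F x y)) mi) => x y; exact: normr_Im_cabs.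
Qed.

Lemma cintegrable_cint2 (F : T1 -> T2 -> R[i]) :
  cmeas (fun p : T1 * T2 => F p.1 p.2) ->
  (\int[m1]_x \int[m2]_y (cabs (F x y))%:E < +oo)%E ->
  cintegrable m1 (fun x => cint m2 (F x)).
Proof.
move=> mF Foo.
have mc : measurable_fun setT (fun p : T1 * T2 => (cabs (F p.1 p.2))%:E).
  by apply/measurable_EFinP; exact: measurable_cabs.
have mi := cmeas_cint2 mF.
apply: (@cintegrable_dom _ _ _ _ _ (fun x => cabs (cint m2 (F x)))) => //.
apply/integrableP; split; first exact/measurable_EFinP/measurable_cabs.
apply: le_lt_trans Foo; apply: ge0_le_integral => //.
- by apply: measurableT_comp => //; exact/measurable_EFinP/measurable_cabs.
- exact: measurable_integral2.
move=> x _ /=; rewrite ger0_norm ?cabs_ge0//; apply: cabs_cint.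
by apply: (cmeas_comp (f := fun y => (x, y)) mF); exact: measurable_fun_pair.
Qed.

End parametric_integral.

Section cint_lebn.
Variable R : realType.

Lemma cintRnE n (h : 'rV[R]_n -> R[i]) : cintegrable (lebn R n) h ->
  cintRn h = cint (lebn R n) h.
Proof.
have rE (g : 'rV[R]_n -> R) : (lebn R n).-integrable setT (fun x => (g x)%:E) ->
    rintRn g = (\int[lebn R n]_x g x)%R.
  move=> ig; have mg : measurable_fun setT g by exact/measurable_EFinP/measurable_int/ig.
  have pE (x : 'rV[R]_n) : (Num.max (g x) 0)%:E = ((fun x => (g x)%:E)^\+)%E x.
    by rewrite funeposE EFin_max.
  have nE (x : 'rV[R]_n) : (Num.max (- g x) 0)%:E = ((fun x => (g x)%:E)^\-)%E x.
    by rewrite funenegE EFin_max EFinN.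
  rewrite /rintRn !intRnE.
  - rewrite (eq_integral ((fun x => (g x)%:E)^\+)%E)//.
    rewrite [X in _ - fine X](eq_integral ((fun x => (g x)%:E)^\-)%E)//.
    rewrite -fineB -?integralE//.
    + exact: integrable_pos_fin_num.
    + exact: integrable_neg_fin_num.
  - by apply/measurable_EFinP; apply: measurable_maxr => //; exact: measurable_funN.
  - by move=> x; rewrite lee_fin le_max lexx orbT.
  - by apply/measurable_EFinP; apply: measurable_maxr.
  - by move=> x; rewrite lee_fin le_max lexx orbT.
by move=> [ir ii]; rewrite /cintRn !rE.
Qed.

Section subst.
Variables (n : nat) (phi : 'rV[R]_n -> 'rV[R]_n) (k : R).
Hypothesis k0 : 0 <= k.
Hypothesis mphi : measurable_fun setT phi.
Hypothesis phiE : forall F : 'rV[R]_n -> \bar R,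
  measurable_fun setT F -> (forall x, 0 <= F x)%E ->
  (\int[lebn R n]_x F (phi x) = k%:E * \int[lebn R n]_x F x)%E.

Lemma integrable_lebn_subst (f : 'rV[R]_n -> R) :
  (lebn R n).-integrable setT (fun x => (f x)%:E) ->
  (lebn R n).-integrable setT (fun x => (f (phi x))%:E).
Proof.
move=> /integrableP[mf foo]; apply/integrableP; split.
  exact: (measurableT_comp mf).
rewrite (phiE (F := fun x => `|(f x)%:E|%E))//; last exact: measurableT_comp.
by rewrite lte_mul_pinfty// ?lee_fin// ge0_fin_numE// integral_ge0.
Qed.

Lemma Rintegral_lebn_subst (f : 'rV[R]_n -> R) :
  (lebn R n).-integrable setT (fun x => (f x)%:E) ->
  (\int[lebn R n]_x f (phi x) = k * \int[lebn R n]_x f x)%R.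
Proof.
move=> fi; have /integrableP[mf foo] := fi.
rewrite /Rintegral integralE.
rewrite (_ : (fun x => (f (phi x))%:E)^\+ = fun x => (fun x => (f x)%:E)^\+ (phi x))%E; last first.
  by apply/funext => x; rewrite !funeposE.
rewrite (_ : (fun x => (f (phi x))%:E)^\- = fun x => (fun x => (f x)%:E)^\- (phi x))%E; last first.
  by apply/funext => x; rewrite !funenegE.
rewrite (phiE (measurable_funepos mf))// (phiE (measurable_funeneg mf))//.
have fp := integrable_pos_fin_num measurableT fi.
have fn := integrable_neg_fin_num measurableT fi.
rewrite -muleBr ?fin_num_adde_defl ?fin_numN//.
by rewrite -integralE fineM// integrable_fin_num.
Qed.

Lemma cint_lebn_subst (h : 'rV[R]_n -> R[i]) : cintegrable (lebn R n) h ->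
  cint (lebn R n) (fun x => h (phi x)) = k%:C * cint (lebn R n) h.
Proof.
move=> [hr hi]; apply: complex_ext; rewrite ?ReM ?ImM /= mul0r ?subr0 ?addr0.
  exact: (@Rintegral_lebn_subst (fun x => Re (h x))).
exact: (@Rintegral_lebn_subst (fun x => Im (h x))).
Qed.

End subst.

Lemma cint_lebn_shift n (a : 'rV[R]_n) (h : 'rV[R]_n -> R[i]) :
  cintegrable (lebn R n) h ->
  cint (lebn R n) (fun x => h (x + a)) = cint (lebn R n) h.
Proof.
move=> ih; rewrite (@cint_lebn_subst _ _ 1)// ?mul1r//.
by move=> F mF F0; rewrite mul1e ge0_integral_lebn_shift.
Qed.

Lemma integrable_lebn_shift n (a : 'rV[R]_n) (f : 'rV[R]_n -> R) :
  (lebn R n).-integrable setT (fun x => (f x)%:E) ->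
  (lebn R n).-integrable setT (fun x => (f (x + a))%:E).
Proof.
apply: (@integrable_lebn_subst _ _ 1) => //.
  by apply: measurable_rVD => //; exact: measurable_cst.
by move=> F mF F0; rewrite mul1e ge0_integral_lebn_shift.
Qed.

Lemma Rintegral_lebn_shift n (a : 'rV[R]_n) (f : 'rV[R]_n -> R) :
  (lebn R n).-integrable setT (fun x => (f x)%:E) ->
  (\int[lebn R n]_x f (x + a) = \int[lebn R n]_x f x)%R.
Proof.
move=> fi; rewrite (@Rintegral_lebn_subst _ _ 1)// ?mul1r//.
by move=> F mF F0; rewrite mul1e ge0_integral_lebn_shift.
Qed.

Lemma Rintegral_lebn_opp n (f : 'rV[R]_n -> R) :
  (lebn R n).-integrable setT (fun x => (f x)%:E) ->
  (\int[lebn R n]_x f (- x) = \int[lebn R n]_x f x)%R.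
Proof.
move=> fi; rewrite (@Rintegral_lebn_subst _ _ 1)// ?mul1r//.
by move=> F mF F0; rewrite mul1e ge0_integral_lebn_opp.
Qed.

Lemma cint_lebn_scale n (c : R) (h : 'rV[R]_n -> R[i]) : 0 < c ->
  cintegrable (lebn R n) h ->
  cint (lebn R n) (fun x => h (c *: x)) = (c^-1 ^+ n)%:C * cint (lebn R n) h.
Proof.
move=> c0 ih; rewrite (@cint_lebn_subst _ _ (c^-1 ^+ n))//.
by move=> F mF F0; rewrite ge0_integral_lebn_scale.
Qed.

End cint_lebn.

(** * Polynomial weights *)

Section dotv_jbr.
Variables (R : realType) (n : nat).
Implicit Types x y z : 'rV[R]_n.

Lemma dotvC x y : dotv x y = dotv y x.
Proof. by apply: eq_bigr => i _; rewrite mulrC. Qed.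

Lemma dotvDl x y z : dotv (x + y) z = dotv x z + dotv y z.
Proof. by rewrite /dotv -big_split/=; apply: eq_bigr => i _; rewrite mxE mulrDl. Qed.

Lemma dotvZl a x y : dotv (a *: x) y = a * dotv x y.
Proof. by rewrite /dotv mulr_sumr; apply: eq_bigr => i _; rewrite mxE mulrA. Qed.

Lemma dotvNl x y : dotv (- x) y = - dotv x y.
Proof. by rewrite -scaleN1r dotvZl mulN1r. Qed.

Lemma dotvBl x y z : dotv (x - y) z = dotv x z - dotv y z.
Proof. by rewrite dotvDl dotvNl. Qed.

Lemma dotvDr x y z : dotv x (y + z) = dotv x y + dotv x z.
Proof. by rewrite dotvC dotvDl !(dotvC x). Qed.

Lemma dotvZr a x y : dotv x (a *: y) = a * dotv x y.
Proof. by rewrite dotvC dotvZl (dotvC x). Qed.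

Lemma dotvNr x y : dotv x (- y) = - dotv x y.
Proof. by rewrite dotvC dotvNl dotvC. Qed.

Lemma dotvBr x y z : dotv x (y - z) = dotv x y - dotv x z.
Proof. by rewrite dotvDr dotvNr. Qed.

Lemma dotv_ge0 x : 0 <= dotv x x.
Proof. by apply: sumr_ge0 => i _; rewrite -expr2 sqr_ge0. Qed.

Lemma dotv_ebasis x (j : 'I_n) : dotv x (ebasis R j) = x 0 j.
Proof.
rewrite /dotv (bigD1 j)//= /ebasis mxE !eqxx mulr1 big1 ?addr0// => i ij.
by rewrite mxE (negbTE ij) andbF mulr0.
Qed.

Lemma sqr_coord_le x (j : 'I_n) : x 0 j ^+ 2 <= dotv x x.
Proof.
rewrite /dotv (bigD1 j)//= -expr2 lerDl; apply: sumr_ge0 => i _.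
by rewrite -expr2 sqr_ge0.
Qed.

Lemma sqr_jbr x : jbr x ^+ 2 = 1 + dotv x x.
Proof. by rewrite sqr_sqrtr// addr_ge0// dotv_ge0. Qed.

Lemma jbr_ge1 x : 1 <= jbr x.
Proof. by rewrite -[leLHS]sqrtr1 ler_wsqrtr// lerDl dotv_ge0. Qed.

Lemma jbr_gt0 x : 0 < jbr x. Proof. exact: lt_le_trans (jbr_ge1 x). Qed.
Lemma jbr_ge0 x : 0 <= jbr x. Proof. exact/ltW/jbr_gt0. Qed.

Lemma jbrN x : jbr (- x) = jbr x.
Proof. by rewrite /jbr dotvNl dotvNr opprK. Qed.

Lemma sqr_dotvD x y : dotv (x + y) (x + y) <= 2 * dotv x x + 2 * dotv y y.
Proof.
have := dotv_ge0 (x - y).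
by rewrite !(dotvDl, dotvDr, dotvNl, dotvNr) (dotvC y x); lra.
Qed.

Lemma jbrD_mul x y : jbr (x + y) <= 2 * (jbr x * jbr y).
Proof.
rewrite -(@ler_pXn2r _ 2) ?nnegrE ?mulr_ge0 ?jbr_ge0// !exprMn !sqr_jbr.
have := sqr_dotvD x y; have := dotv_ge0 x; have := dotv_ge0 y.
by nra.
Qed.

Lemma jbrD_max x y : jbr (x + y) <= 2 * Num.max (jbr x) (jbr y).
Proof.
rewrite -(@ler_pXn2r _ 2) ?nnegrE ?mulr_ge0 ?jbr_ge0 ?le_max ?jbr_ge0// exprMn.
have [xy|xy] := leP (jbr x) (jbr y).
  have : jbr x ^+ 2 <= jbr y ^+ 2 by rewrite ler_pXn2r ?nnegrE ?jbr_ge0.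
  rewrite !sqr_jbr; have := sqr_dotvD x y; lra.
have : jbr y ^+ 2 <= jbr x ^+ 2 by rewrite ler_pXn2r ?nnegrE ?jbr_ge0// ltW.
by rewrite !sqr_jbr; have := sqr_dotvD x y; lra.
Qed.

Lemma coord_le_jbr x j : `|x 0 j| <= jbr x.
Proof.
rewrite -(@ler_pXn2r _ 2) ?nnegrE ?jbr_ge0// -normrX ger0_norm ?sqr_ge0//.
by rewrite sqr_jbr (le_trans (sqr_coord_le x j))// lerDr.
Qed.

Lemma dotv_continuous (T : topologicalType) (f g : T -> 'rV[R]_n) :
  (forall i, continuous (fun t => f t 0 i)) ->
  (forall i, continuous (fun t => g t 0 i)) ->
  continuous (fun t => dotv (f t) (g t)).
Proof.
move=> cf cg t.
suff H (r : seq 'I_n) : \sum_(i <- r) f u 0 i * g u 0 i @[u --> t] -->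
    \sum_(i <- r) f t 0 i * g t 0 i by exact: H.
elim: r => [|i r IH].
  by rewrite big_nil; under eq_fun do rewrite big_nil; exact: cvg_cst.
rewrite big_cons; under eq_fun do rewrite big_cons.
by apply: cvgD => //; apply: cvgM; [exact: cf|exact: cg].
Qed.

Lemma dotvv_continuous : continuous (fun x => dotv x x).
Proof. by apply: dotv_continuous => i; exact: coord_continuous. Qed.

Lemma measurable_jbr : measurable_fun setT (@jbr R n).
Proof.
apply: (measurableT_comp (f := @Num.sqrt R)).
  by apply: continuous_measurable_fun; exact: sqrt_continuous.
by apply: measurable_funD => //; exact: measurable_dotv.
Qed.

(** The sign is chosen so that a larger [s] means more decay. *)
Definition jw (s : R) x : R := jbr x `^ (- s).

Lemma jw_ge0 s x : 0 <= jw s x. Proof. exact: powR_ge0. Qed.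
Lemma jw_gt0 s x : 0 < jw s x. Proof. by rewrite powR_gt0 ?jbr_gt0. Qed.

Lemma jwN s x : jw s (- x) = jw s x. Proof. by rewrite /jw jbrN. Qed.

Lemma jw_le1 s x : 0 <= s -> jw s x <= 1.
Proof.
move=> s0; rewrite /jw -(powRr0 (jbr x)) ler_powR ?jbr_ge1//.
by rewrite oppr_le0.
Qed.

Lemma ler_jw s t x : s <= t -> jw t x <= jw s x.
Proof. by move=> st; rewrite /jw ler_powR ?jbr_ge1// lerN2. Qed.

Lemma jwM s t x : jw s x * jw t x = jw (s + t) x.
Proof. by rewrite /jw -powRD ?opprD// (gt_eqF (jbr_gt0 x)) implybT. Qed.

Lemma jw_jbr s x : jw s x * jbr x `^ s = 1.
Proof. by rewrite /jw -powRD ?addNr ?powRr0// (gt_eqF (jbr_gt0 x)) implybT. Qed.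

Lemma measurable_jw s : measurable_fun setT (jw s).
Proof.
apply: (measurableT_comp (f := fun t => t `^ (- s))); first exact: measurable_powR.
exact: measurable_jbr.
Qed.

(** Peetre's inequality, from <x> <= 2 <x + y> <y>. In this form it says that the weights are
    submultiplicative up to [2 ^ s]. *)
Lemma jw_peetre s x y : 0 <= s -> jw s (x + y) * jw s y <= 2 `^ s * jw s x.
Proof.
move=> s0.
rewrite -(ler_pM2r (powR_gt0 s (jbr_gt0 y))) -mulrA jw_jbr mulr1.
rewrite -(ler_pM2r (powR_gt0 s (jbr_gt0 (x + y)))) jw_jbr.
rewrite -(ler_pM2l (powR_gt0 s (jbr_gt0 x))) mulr1.
rewrite (_ : _ * (_ * _ * _ * _) = 2 `^ s * (jbr (x + y) `^ s * jbr (- y) `^ s)); last first.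
  by rewrite jbrN -[RHS]mulr1 -(jw_jbr s x); ring.
rewrite -!powRM ?mulr_ge0 ?jbr_ge0//.
apply: ge0_ler_powR; rewrite ?nnegrE ?mulr_ge0 ?jbr_ge0//.
by rewrite -{1}(addrK y x) jbrD_mul.
Qed.

End dotv_jbr.

(** * Integrability of the weights *)

Section weight1.
Variable R : realType.
Local Notation leb := (@lebesgue_measure R).

Lemma is_derive_powR1D (b t : R) : 0 <= t ->
  is_derive t 1 (fun u : R => (1 + u) `^ b) (b * (1 + t) `^ (b - 1)).
Proof.
move=> t0; have t1 : 0 < 1 + t by lra.
have h : is_derive t 1 (fun u : R => 1 + u) 1.
  by have := is_deriveD (is_derive_cst (1 : R) t 1) (is_derive_id t 1); rewrite add0r.
have := @is_derive1_comp _ (fun u => u `^ b) (fun u => 1 + u) t _ _ (is_derive1_powR b t1) h.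
by rewrite mulr1.
Qed.

Lemma cvg_powR_pinfty (b : R) : 0 < b -> (1 + t) `^ (- b) @[t --> +oo] --> 0.
Proof.
move=> b0; apply/cvgrPdist_lt => e e0; near=> t.
have t0 : e `^ (- b^-1) < t by near: t; apply: nbhs_pinfty_gt; rewrite num_real.
have e1 : 0 < e `^ (- b^-1) by exact: powR_gt0.
rewrite sub0r normrN ger0_norm ?powR_ge0//.
rewrite powRN -ltf_pV2 ?posrE ?invr_gt0 ?powR_gt0//; last lra.
rewrite invrK -{1}(powR_inv1 (ltW e0)).
rewrite (_ : -1 = - b^-1 * b) ?powRrM; last by field; rewrite gt_eqF.
by apply: gt0_ltr_powR; rewrite ?nnegrE//; lra.
Unshelve. all: by end_near. Qed.

Lemma integral_powR_tail (b : R) : 1 < b ->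
  (\int[leb]_(t in `[0%R, +oo[) ((1 + t) `^ (- b))%:E = ((b - 1)^-1%R)%:E)%E.
Proof.
move=> b1; pose F (t : R) : R := - (b - 1)^-1 * (1 + t) `^ (- (b - 1)).
have b0 : b - 1 != 0 by rewrite gt_eqF// subr_gt0.
have dF (t : R) : 0 <= t -> is_derive t 1 F ((1 + t) `^ (- b)).
  move=> t0; have h := is_derive_powR1D (- (b - 1)) t0.
  apply: (is_derive_eq (is_deriveZ (- (b - 1)^-1) h)).
  rewrite /GRing.scale/= (_ : - (b - 1) - 1 = - b); first by field.
  by ring.
rewrite (@ge0_continuous_FTC2y _ _ F _ 0).
- rewrite /F addr0 powR1 mulr1 -EFinB opprK add0r.
  by [].
- by move=> x _; exact: powR_ge0.
- apply/continuous_within_itvcyP; split.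
    move=> x; rewrite in_itv/= andbT => /ltW x0.
    have := is_derive_powR1D (- b) x0.
    by move=> [] /derivable1_diffP/differentiable_continuous.
  apply: cvg_at_right_filter.
  have := is_derive_powR1D (- b) (lexx 0).
  by move=> [] /derivable1_diffP/differentiable_continuous.
- rewrite -(mulr0 (- (b - 1)^-1)); apply: cvgM; first exact: cvg_cst.
  by apply: cvg_powR_pinfty; rewrite subr_gt0.
- by move=> x x0; have [] := dF x (ltW x0).
- apply: cvg_at_right_filter.
  by have [/derivable1_diffP/differentiable_continuous] := dF 0 (lexx 0).
- by move=> x; rewrite in_itv/= andbT => /ltW x0; have := dF x x0; rewrite derive1E => -[].
Qed.

(** By symmetry the half line suffices, and there (1 + t)^2 <= 2 (1 + t^2) leads to a function with
    an explicit primitive. *)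
Lemma integral_weight1_lty (a : R) : 2^-1 < a ->
  (\int[leb]_t ((1 + t ^+ 2) `^ (- a))%:E < +oo)%E.
Proof.
move=> a12; pose f (t : R) := (1 + t ^+ 2) `^ (- a).
have ct : continuous ((fun u : R => u `^ (- a)) \o (fun t : R => 1 + t ^+ 2)).
  move=> t; have t1 : 0 < 1 + t ^+ 2 by rewrite ltr_pwDl// sqr_ge0.
  apply: continuous_comp.
    by apply: cvgD; [exact: cvg_cst|exact: exprn_continuous].
  have [/derivable1_diffP/differentiable_continuous] := is_derive1_powR (- a) t1.
  exact.
rewrite (@ge0_symfun_integralT _ f)//; last 2 first.
- by move=> t; exact: powR_ge0.
- by move=> t; rewrite /f /= sqrrN.
apply: lte_mul_pinfty => //.
have -> : [set x : R | 0 <= x] = `[0, +oo[%classic.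
  by apply/seteqP; split => x /=; rewrite in_itv/= andbT.
have mp : measurable_fun `[(0:R), +oo[ (fun t : R => ((1 + t) `^ (- (2 * a)))%:E).
  apply/measurable_EFinP/measurable_funTS.
  by apply: (measurableT_comp (f := fun t => t `^ (- (2 * a)))) => //; apply: measurable_funD.
apply: (@le_lt_trans _ _ (\int[leb]_(t in `[0%R, +oo[) ((2 `^ a)%:E * ((1 + t) `^ (- (2 * a)))%:E)))%E.
  apply: ge0_le_integral => //.
  - by move=> t _; rewrite lee_fin powR_ge0.
  - by apply/measurable_EFinP/measurable_funTS; exact: continuous_measurable_fun.
  - exact: measurable_funeM.
  move=> t; rewrite /= in_itv/= andbT => t0; rewrite -EFinM lee_fin /f.
  have t1 : 0 < 1 + t by lra.
  have t2 : 0 < 1 + t ^+ 2 by rewrite ltr_pwDl// sqr_ge0.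
  rewrite !powRN (powRrM (1 + t)) -ler_pdivrMr ?invr_gt0 ?powR_gt0// invrK.
  rewrite mulrC ler_pdivrMr ?powR_gt0// -powRM// ?(ltW t2)//.
  rewrite ge0_ler_powR ?nnegrE//; [lra|exact: powR_ge0|by rewrite mulr_ge0// ltW|].
  rewrite powR_mulrn ?(ltW t1)//; have := sqr_ge0 (1 - t); nra.
rewrite ge0_integralZl//; last by move=> t _; rewrite lee_fin powR_ge0.
  rewrite integral_powR_tail; last lra.
  by rewrite -EFinM ltry.
Qed.

End weight1.

Section product_integral.
Variable R : realType.
Local Notation leb := (@lebesgue_measure R).

Lemma integral_lebn_prod n (f : R -> R) : measurable_fun setT f ->
  (forall t, 0 <= f t) -> (\int[leb]_t (f t)%:E < +oo)%E ->
  (\int[lebn R n]_x (\prod_i f (x 0 i))%:E = ((\int[leb]_t f t)%R ^+ n)%:E)%E.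
Proof.
move=> mf f0 foo.
have mprod k : measurable_fun setT (fun x : 'rV[R]_k => (\prod_i f (x 0 i))%:E).
  apply/measurable_EFinP; apply: measurable_prod => i _.
  by apply: (measurableT_comp mf); exact: measurable_coord.
have prod0 k (x : 'rV[R]_k) : 0 <= \prod_i f (x 0 i) by apply: prodr_ge0.
have fE : (\int[leb]_t (f t)%:E = (\int[leb]_t f t)%R%:E)%E.
  by rewrite fineK// ge0_fin_numE// integral_ge0// => t _; rewrite lee_fin.
elim: n => [|n IH].
  rewrite ge0_integral_lebn0//; first by rewrite big_ord0 expr0.
  by move=> x; rewrite lee_fin.
rewrite ge0_integral_lebnS//; last by move=> x; rewrite lee_fin.
pose g : measurableTypeR R -> \bar R := fun t => (f t)%:E.
have mg : measurable_fun setT g by exact/measurable_EFinP.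
transitivity (\int[leb]_t (((\int[leb]_t f t)%R ^+ n)%:E * g t))%E.
  apply: eq_integral => t _; rewrite -IH muleC -(ge0_integralZl _ measurableT (mprod n))//; last 2 first.
  - by move=> x _; rewrite lee_fin.
  - by rewrite lee_fin.
  apply: eq_integral => x _; rewrite big_ord_recl -EFinM; congr (_ * _)%:E.
    by rewrite mxE unlift_none.
  by apply: eq_bigr => i _; rewrite mxE liftK.
rewrite ge0_integralZl//; last 2 first.
- by move=> t _; rewrite lee_fin.
- by rewrite lee_fin exprn_ge0// Rintegral_ge0.
by rewrite /g fE -EFinM -exprSr.
Qed.

End product_integral.

Section jw_integrable.
Variable R : realType.

(** Each of the [n.+1] coordinates takes an equal share of the exponent, as 1 + x_i^2 <= <x>^2. The
    factors are integrable on the line exactly when [s] exceeds the dimension. *)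
Lemma jw_le_prod n (s : R) (x : 'rV[R]_n.+1) : 0 <= s ->
  jw s x <= \prod_i (1 + x 0 i ^+ 2) `^ (- (s / (2 * n.+1%:R))).
Proof.
move=> s0; set a := s / _.
have a0 : 0 <= a by rewrite divr_ge0.
have -> : jw s x = \prod_(i < n.+1) (jbr x ^+ 2) `^ (- a).
  rewrite prodr_const card_ord -powR_mulrn ?powR_ge0// -powRrM.
  rewrite -powR_mulrn ?jbr_ge0// -powRrM /jw; congr (_ `^ _).
  have N0 : n.+1%:R != 0 :> R by rewrite pnatr_eq0.
  by rewrite /a; move: (n.+1%:R : R) N0 => N N0; field.
apply: ler_prod => i _; rewrite powR_ge0 /= !powRN.
have x1 : 0 < 1 + x 0 i ^+ 2 by rewrite ltr_pwDl// sqr_ge0.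
rewrite lef_pV2 ?posrE ?powR_gt0 ?exprn_gt0 ?jbr_gt0//.
rewrite ge0_ler_powR ?nnegrE ?sqr_ge0 ?(ltW x1)//.
by rewrite sqr_jbr lerD2l sqr_coord_le.
Qed.

Lemma integrable_jw n (s : R) : n%:R < s ->
  (lebn R n).-integrable setT (fun x => (jw s x)%:E).
Proof.
move=> ns; have s0 : 0 < s by apply: le_lt_trans ns.
have mj k : measurable_fun setT (fun x : 'rV[R]_k => (jw s x)%:E).
  by apply/measurable_EFinP; exact: measurable_jw.
apply/integrableP; split; first exact: mj.
under eq_integral do rewrite gee0_abs ?lee_fin ?jw_ge0//.
case: n ns => [|n] ns.
  rewrite (ge0_integral_lebn0 (mj 0)) ?ltry// => x.
  by rewrite lee_fin jw_ge0.
set a := s / (2 * n.+1%:R).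
have a12 : 2^-1 < a.
  by rewrite /a ltr_pdivlMr ?mulr_gt0 ?ltr0n// mulrA mulVf ?mul1r.
pose f (t : R) := (1 + t ^+ 2) `^ (- a).
have mf : measurable_fun setT f.
  apply: (measurableT_comp (f := fun t => t `^ (- a))) => //.
  by apply: measurable_funD.
have E := integral_lebn_prod n.+1 mf (fun t => powR_ge0 _ _) (integral_weight1_lty a12).
apply: (@le_lt_trans _ _ (\int[lebn R n.+1]_x (\prod_i f (x 0 i))%:E)%E).
  apply: ge0_le_integral => //.
  - by move=> x _; rewrite lee_fin jw_ge0.
  - exact: mj.
  - apply/measurable_EFinP; apply: measurable_prod => i _.
    by apply: (measurableT_comp mf); exact: measurable_coord.
  - by move=> x _; rewrite lee_fin jw_le_prod// ltW.
by rewrite E ltry.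
Qed.

Lemma integrable_dom_jw n (s C : R) (f : 'rV[R]_n -> R) : n%:R < s ->
  measurable_fun setT f -> (forall x, `|f x| <= C * jw s x) ->
  (lebn R n).-integrable setT (fun x => (f x)%:E).
Proof.
move=> ns mf fC; have := integrableZl measurableT C (integrable_jw ns).
apply: le_integrable => //; first exact/measurable_EFinP.
by move=> x _ /=; rewrite lee_fin (le_trans (fC x))// ler_norm.
Qed.

Lemma cintegrable_dom_jw n (s C : R) (h : 'rV[R]_n -> R[i]) : n%:R < s ->
  cmeas h -> (forall x, cabs (h x) <= C * jw s x) -> cintegrable (lebn R n) h.
Proof.
move=> ns mh hC; apply: (cintegrable_dom mh _ hC).
exact: (integrableZl measurableT C (integrable_jw ns)).
Qed.

(* Either [z] or [y - z] has size comparable with [y]. *)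
Lemma jw_convolution n (s a : R) (y : 'rV[R]_n) : n%:R < s -> 0 <= a <= s ->
  (\int[lebn R n]_z (jw s z * jw a (y - z))%:E <=
   (2 `^ a * 3 * (\int[lebn R n]_z jw s z)%R * jw a y)%:E)%E.
Proof.
move=> ns /andP[a0 las].
have s0 : 0 < s by apply: le_lt_trans ns.
have ij := integrable_jw ns.
have ijy : (lebn R n).-integrable setT (fun z => (jw s (z + (- y)))%:E).
  exact: (integrable_lebn_shift (- y) ij).
have mz : measurable_fun setT (fun z : 'rV[R]_n => jw a (y - z)).
  apply: (measurableT_comp (measurable_jw a)).
  by apply: measurable_rVB => //; exact: measurable_cst.
have key z : jw s z * jw a (y - z) <= 2 `^ a * jw a y * (2 * jw s z + jw s (z - y)).
  have {}key : jbr y `^ a <= 2 `^ a * (jbr z `^ a + jbr (y - z) `^ a).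
    have : jbr y <= 2 * Num.max (jbr z) (jbr (y - z)).
      by rewrite -{1}(subrK z y) addrC jbrD_max.
    move=> /(ge0_ler_powR a0) h; apply: le_trans (h _ _) _; rewrite ?nnegrE ?jbr_ge0//.
      by rewrite mulr_ge0// le_max jbr_ge0.
    rewrite powRM ?le_max ?jbr_ge0// ler_pM2l ?powR_gt0//.
    by have [_|_] := leP (jbr z) (jbr (y - z)); rewrite ?lerDl ?lerDr powR_ge0.
  rewrite -(ler_pM2r (powR_gt0 a (jbr_gt0 y))).
  rewrite (_ : 2 `^ a * jw a y * _ * _ = 2 `^ a * (2 * jw s z + jw s (z - y)) * (jw a y * jbr y `^ a)); last by ring.
  rewrite jw_jbr mulr1.
  apply: le_trans (ler_wpM2l (mulr_ge0 (jw_ge0 _ _) (jw_ge0 _ _)) key) _.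
  have e1 : jw a (y - z) * jbr (y - z) `^ a = 1 by exact: jw_jbr.
  have e2 : jw s z * jbr z `^ a = jw (s - a) z.
    by rewrite -{1}(subrK a s) -(jwM (s - a) a) -mulrA jw_jbr mulr1.
  rewrite (_ : jw s z * jw a (y - z) * _ =
      2 `^ a * (jw a (y - z) * jw (s - a) z + jw s z)); last first.
    by rewrite -e2 -[X in _ = _ * (_ + X)]mulr1 -e1; ring.
  rewrite ler_pM2l ?powR_gt0//.
  have aux (b c d : R) : b <= c + d -> b + c <= 2 * c + d by lra.
  apply: aux.
  have -> : jw s (z - y) = jw s (y - z) by rewrite -jwN opprB.
  (* The remaining mixed product is at most [jw s] at whichever of [z] and [y - z] has the smaller
     bracket. *)
  have [yz|zy] := leP (jbr z) (jbr (y - z)).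
    apply: le_trans (_ : jw a z * jw (s - a) z <= _).
      rewrite ler_wpM2r ?jw_ge0// /jw !powRN lef_pV2 ?posrE ?powR_gt0 ?jbr_gt0//.
      by rewrite ge0_ler_powR ?nnegrE ?jbr_ge0.
    by rewrite jwM addrCA subrr addr0 lerDl jw_ge0.
  apply: le_trans (_ : jw a (y - z) * jw (s - a) (y - z) <= _).
    rewrite ler_wpM2l ?jw_ge0// /jw !powRN lef_pV2 ?posrE ?powR_gt0 ?jbr_gt0//.
    by rewrite ge0_ler_powR ?nnegrE ?jbr_ge0 ?subr_ge0// ltW.
  by rewrite jwM addrCA subrr addr0 lerDr jw_ge0.
have i2 : (lebn R n).-integrable setT (fun z => (2 * jw s z + jw s (z - y))%:E).
  exact: (integrableD measurableT (integrableZl measurableT 2 ij) ijy).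
apply: (@le_trans _ _ (\int[lebn R n]_z (2 `^ a * jw a y * (2 * jw s z + jw s (z - y)))%:E)%E).
  apply: ge0_le_integral => //.
  - by move=> z _; rewrite lee_fin mulr_ge0 ?jw_ge0.
  - by apply/measurable_EFinP/measurable_funM => //; exact: measurable_jw.
  - exact: measurable_int (integrableZl measurableT (2 `^ a * jw a y) i2).
  - by move=> z _; rewrite lee_fin.
under eq_integral do rewrite EFinM.
rewrite integralZl// integralD_EFin//=; last exact: (integrableZl measurableT 2 ij).
under eq_integral do rewrite EFinM.
rewrite integralZl//.
have -> : (\int[lebn R n]_z (jw s (z - y))%:E = \int[lebn R n]_z (jw s z)%:E)%E.
  apply: (ge0_integral_lebn_shift (- y) (F := fun z => (jw s z)%:E)).
    by apply/measurable_EFinP; exact: measurable_jw.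
  by move=> x; rewrite lee_fin jw_ge0.
rewrite -(fineK (integrable_fin_num measurableT ij)) -/(Rintegral _ _ _) -!EFinM lee_fin.
rewrite -subr_ge0 le_eqVlt; apply/orP; left; apply/eqP; ring.
Qed.

End jw_integrable.

(** * Directional derivatives *)

Section directional_derivative.
Variable R : realType.

(** A derivative sees only the increments of the function, so it passes between base points and
    between a directional derivative and the derivative of a restriction to a line. *)
Lemma is_derive_transfer (V W : normedModType R) (f : V -> R) (a v : V)
    (g : W -> R) (b w : W) (df : R) :
  (forall h : R, f (h *: v + a) - f a = g (h *: w + b) - g b) ->
  is_derive a v f df -> is_derive b w g df.
Proof.
move=> fg [fav fE].
have E : (fun h : R => h^-1 *: ((f \o shift a) (h *: v) - f a)) =
         (fun h : R => h^-1 *: ((g \o shift b) (h *: w) - g b)).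
  by apply/funext => h /=; congr (_ *: _); exact: fg.
by split; [rewrite /derivable -E|rewrite -fE /derive -E].
Qed.

(** Phrased on the restriction to lines parallel to [v], so that the product rule, the chain rule
    and the mean value theorem of one variable apply. *)
Definition dirder n (v : 'rV[R]_n) (P dP : 'rV[R]_n -> R) :=
  forall x, is_derive (0 : R) 1 (fun t => P (x + t *: v)) (dP x).

Lemma dirder_line n (v : 'rV[R]_n) P dP (x : 'rV[R]_n) (t : R) : dirder v P dP ->
  is_derive t 1 (fun t => P (x + t *: v)) (dP (x + t *: v)).
Proof.
move=> /(_ (x + t *: v)); apply: is_derive_transfer => h.
by rewrite addr0 scale0r addr0 -addrA -scalerDl (addrC t).
Qed.

Lemma is_derive_dirder n (v : 'rV[R]_n) P dP :
  (forall x, is_derive x v P (dP x)) -> dirder v P dP.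
Proof.
move=> H x; have := H x; apply: is_derive_transfer => h.
by rewrite addr0 scale0r addr0 [x + _]addrC /GRing.scale/= mulr1.
Qed.

Lemma dirderM n (v : 'rV[R]_n) P dP Q dQ : dirder v P dP -> dirder v Q dQ ->
  dirder v (fun x => P x * Q x) (fun x => P x * dQ x + Q x * dP x).
Proof.
move=> dp dq x; have := is_deriveM (dp x) (dq x).
by rewrite scale0r addr0.
Qed.

Lemma dirderD n (v : 'rV[R]_n) P dP Q dQ : dirder v P dP -> dirder v Q dQ ->
  dirder v (fun x => P x + Q x) (fun x => dP x + dQ x).
Proof. by move=> dp dq x; exact: (is_deriveD (dp x) (dq x)). Qed.

Lemma dirder_comp n (v : 'rV[R]_n) P dP (f df : R -> R) :
  (forall t : R, is_derive t 1 f (df t)) -> dirder v P dP ->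
  dirder v (fun x => f (P x)) (fun x => df (P x) * dP x).
Proof.
move=> hf dp x; have hfx := hf (P x).
rewrite -{1}(addr0 x) -(scale0r v) in hfx.
exact: (@is_derive1_comp _ f (fun t => P (x + t *: v)) 0 _ _ hfx (dp x)).
Qed.

Lemma eq_dirder n (v : 'rV[R]_n) P dP dQ : dP =1 dQ -> dirder v P dP -> dirder v P dQ.
Proof. by move=> E dp x; rewrite -E. Qed.

Lemma dirder_dotv n (v y : 'rV[R]_n) : dirder v (fun x => dotv x y) (fun=> dotv v y).
Proof.
move=> x; have -> : (fun t => dotv (x + t *: v) y) = cst (dotv x y) + (dotv v y \*: (@id R)).
  by apply/funext => t; rewrite dotvDl dotvZl /= mulrC.
have h := is_deriveD (is_derive_cst (dotv x y) (0 : R) 1) (is_deriveZ (dotv v y) (is_derive_id (0 : R) 1)).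
by apply: (is_derive_eq h); rewrite add0r /GRing.scale/= mulr1.
Qed.

Lemma dirder_sqr n (v : 'rV[R]_n) : dirder v (fun x => dotv x x) (fun x => 2 * dotv x v).
Proof.
move=> x.
have -> : (fun t => dotv (x + t *: v) (x + t *: v)) =
   cst (dotv x x) + ((2 * dotv x v) \*: (@id R)) + (dotv v v \*: (@GRing.exp R ^~ 2)).
  apply/funext => t; rewrite !(dotvDl, dotvDr, dotvZl, dotvZr) (dotvC v x).
  by rewrite !fctE /= /GRing.scale/=; ring.
have h := is_deriveD (is_deriveD (is_derive_cst (dotv x x) (0 : R) 1)
  (is_deriveZ (2 * dotv x v) (is_derive_id (0 : R) 1)))
  (is_deriveZ (dotv v v) (is_deriveX 2 (is_derive_id (0 : R) 1))).
by apply: (is_derive_eq h); rewrite /GRing.scale/=; ring.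
Qed.

Lemma dirder_shift n (v a : 'rV[R]_n) P dP : dirder v P dP ->
  dirder v (fun x => P (x - a)) (fun x => dP (x - a)).
Proof. by move=> dp x; have := dp (x - a); congr is_derive; apply/funext => t; rewrite addrAC. Qed.

Lemma dirderZ n (v : 'rV[R]_n) P dP (c : R) : dirder v P dP ->
  dirder v (fun x => c * P x) (fun x => c * dP x).
Proof. by move=> dp x; exact: (is_deriveZ c (dp x)). Qed.

(* A decaying function has the same integral as its translates, hence its
   difference quotients integrate to [0]. *)
Lemma Rintegral_dirder0 n (v : 'rV[R]_n) P dP (s C : R) : n%:R < s ->
  dirder v P dP -> measurable_fun setT P -> measurable_fun setT dP ->
  (forall x, `|P x| <= C * jw s x) -> (forall x, `|dP x| <= C * jw s x) ->
  (\int[lebn R n]_x dP x = 0)%R.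
Proof.
move=> ns dp mP mdP PC dPC.
have s0 : 0 < s by apply: le_lt_trans ns.
have C0 : 0 <= C.
  by have := le_trans (normr_ge0 _) (PC 0); rewrite pmulr_lge0 ?jw_gt0.
pose h k : R := k.+1%:R^-1.
have h0 k : 0 < h k by rewrite invr_gt0 ltr0n.
have h1 k : h k <= 1 by rewrite invf_le1 ?ltr0n// ler1n.
pose D k x := (P (x + h k *: v) - P x) / h k.
have mPs k : measurable_fun setT (fun x : 'rV[R]_n => P (x + h k *: v)).
  apply: (measurableT_comp mP); apply: measurable_rVD => //; exact: measurable_cst.
have mD k : measurable_fun setT (D k).
  by apply: measurable_funM => //; apply: measurable_funB.
have iP := integrable_dom_jw ns mP PC.
have iPs k := integrable_lebn_shift (h k *: v) iP.
have DE k : (\int[lebn R n]_x D k x = 0)%R.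
  rewrite RintegralZr//=; last exact: (integrableB measurableT (iPs k) iP).
  have E := @RintegralB _ _ _ (lebn R n) setT (fun x => P (x + h k *: v)) P measurableT (iPs k) iP.
  by rewrite E (Rintegral_lebn_shift (h k *: v) iP) subrr mul0r.
(* The mean value theorem moves the argument by at most one multiple of [v]; Peetre's inequality
   pays for this with the factor 2^s <v>^s, uniformly in [k]. *)
pose K := C * (2 `^ s * jbr v `^ s).
have DK k x : `|D k x| <= K * jw s x.
  have df (t : R) : t \in `](0:R), (h k)[ -> is_derive t 1 (fun t => P (x + t *: v)) (dP (x + t *: v)).
    by move=> _; exact: dirder_line.
  have cf : {within `[(0:R), (h k)], continuous (fun t => P (x + t *: v))}.
    apply: continuous_subspaceT => t.
    by have [/derivable1_diffP/differentiable_continuous] := dirder_line x t dp.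
  have [c c0h] := MVT (h0 k) df cf.
  rewrite /D scale0r addr0 subr0 => ->; rewrite mulfK ?gt_eqF//.
  apply: le_trans (dPC _) _; rewrite /K -mulrA; apply: (ler_wpM2l C0).
  have jv : jbr (c *: v) <= jbr v.
    rewrite ler_wsqrtr// lerD2l dotvZl dotvZr mulrA -expr2 ler_piMl ?dotv_ge0//.
    move: c0h; rewrite in_itv/= => /andP[c0 ch].
    by rewrite expr_le1 ?(ltW c0)// (le_trans (ltW ch)).
  have H : jw s (x + c *: v) <= 2 `^ s * jw s x * jbr (c *: v) `^ s.
    rewrite -(ler_pM2r (jw_gt0 s (c *: v))).
    apply: le_trans (jw_peetre x (c *: v) (ltW s0)) _.
    by rewrite -[leRHS]mulrA (mulrC (jbr _ `^ s)) jw_jbr mulr1.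
  apply: le_trans H _.
  rewrite mulrAC ler_wpM2r ?jw_ge0// ler_wpM2l ?powR_ge0//.
  by rewrite ge0_ler_powR ?nnegrE ?jbr_ge0// ltW.
have Dcvg x : D k x @[k --> \oo] --> dP x.
  have [/cvg_ex[/= l lP] El] := dp x.
  have {}El : dP x = l.
    by rewrite -El /derive; apply: cvg_lim => //; move: lP.
  rewrite El.
  have hcvg : (forall k, h k != 0) /\ h k @[k --> \oo] --> 0.
    split => [k|]; first by rewrite gt_eqF.
    exact: cvg_harmonic.
  move/cvgr_dnbhsP : lP => /(_ _ hcvg).
  apply: cvg_trans; apply: near_eq_cvg; apply: nearW => k.
  by rewrite /D /= addr0 scale0r addr0 /GRing.scale/= mulr1 mulrC.
have [_ _ H] : [/\ (lebn R n).-integrable setT (fun x => (dP x)%:E),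
    [sequence \int[lebn R n]_x `|(D k x)%:E - (dP x)%:E|]_k @ \oo --> 0 &
    [sequence \int[lebn R n]_x (D k x)%:E]_k @ \oo --> \int[lebn R n]_x (dP x)%:E]%E.
  apply: (@dominated_convergence _ _ _ (lebn R n) setT measurableT
    (fun k x => (D k x)%:E) (fun x => (dP x)%:E) (fun x => (K * jw s x)%:E)).
  - by move=> k; apply/measurable_EFinP.
  - exact/measurable_EFinP.
  - by apply: aeW => x _; apply: cvg_EFin; [exact: nearW|exact: Dcvg].
  - exact: (integrableZl measurableT K (integrable_jw ns)).
  - by apply: aeW => x k _; rewrite lee_fin.
have iD k : (lebn R n).-integrable setT (fun x => (D k x)%:E).
  exact: integrable_dom_jw ns (mD k) (DK k).
suff E0 : (\int[lebn R n]_x (dP x)%:E = 0)%E by rewrite /Rintegral E0.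
apply: (cvg_unique _ H) => //.
rewrite (_ : [sequence _]_k = fun=> 0%E); first exact: cvg_cst.
apply/funext => k; rewrite /= -[LHS]fineK; first by rewrite -[fine _]/(\int[lebn R n]_x D k x)%R DE.
exact: integrable_fin_num.
Qed.

End directional_derivative.

(** * Gaussians *)

Section gauss.
Variable R : realType.

(** The real power [a] of the window [gwin]. *)
Definition gauss n (a : R) (x : 'rV[R]_n) : R := expR (- (a * (pi * dotv x x))).

Lemma gwin_gauss n (x : 'rV[R]_n) : gwin x = gauss 1 x.
Proof. by rewrite /gwin /gauss mul1r. Qed.

Lemma gauss_ge0 n a (x : 'rV[R]_n) : 0 <= gauss a x. Proof. exact: expR_ge0. Qed.

Lemma gaussN n a (x : 'rV[R]_n) : gauss a (- x) = gauss a x.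
Proof. by rewrite /gauss dotvNl dotvNr opprK. Qed.

Lemma gaussM n a b (x : 'rV[R]_n) : gauss a x * gauss b x = gauss (a + b) x.
Proof. by rewrite /gauss -expRD; congr expR; ring. Qed.

Lemma gauss_le1 n a (x : 'rV[R]_n) : 0 <= a -> gauss a x <= 1.
Proof.
move=> a0; rewrite /gauss expR_le1 oppr_le0.
by rewrite mulr_ge0// mulr_ge0 ?pi_ge0 ?dotv_ge0.
Qed.

Lemma measurable_gauss n a : measurable_fun setT (@gauss n a).
Proof.
apply: (measurableT_comp (f := @expR R)); first exact: measurable_expR.
apply: measurable_funN; apply: measurable_funM => //.
by apply: measurable_funM => //; exact: measurable_dotv.
Qed.

Lemma gauss_continuous n a : continuous (@gauss n a).
Proof.
move=> x; apply: (@continuous_comp _ _ _ (fun y => - (a * (pi * dotv y y))) (@expR R));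
  last exact: continuous_expR.
have h : a * (pi * dotv y y) @[y --> x] --> a * (pi * dotv x x).
  exact: (cvgM (cvg_cst a) (cvgM (cvg_cst pi) (@dotvv_continuous R n x))).
exact: (cvgN h).
Qed.

Lemma gauss_le_jw n (a s : R) : 0 < a -> exists C : R, 0 < C /\
  forall x : 'rV[R]_n, gauss a x <= C * jw s x.
Proof.
move=> a0; pose ap := a * pi.
have ap0 : 0 < ap by rewrite mulr_gt0// pi_gt0.
have [M sM] : exists M : nat, s <= M%:R.
  exists (Num.truncn s).+1; exact/ltW/truncnS_gt.
(* The factor [expR ap] replaces |x|^2 by <x>^2 - 1 in the exponent; the other factor comes from e^u
   >= u^(M+1) / (M+1)! at u = ap <x>^2. *)
exists (expR ap * (M.+1`!%:R / ap ^+ M.+1)); split.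
  by rewrite mulr_gt0 ?expR_gt0// divr_gt0 ?exprn_gt0// ltr0n fact_gt0.
move=> x; rewrite -(ler_pM2r (powR_gt0 s (jbr_gt0 x))) -[leRHS]mulrA jw_jbr mulr1.
have -> : gauss a x = expR ap * expR (- (ap * jbr x ^+ 2)).
  by rewrite -expRD sqr_jbr /gauss; congr expR; rewrite /ap; ring.
rewrite -mulrA ler_pM2l ?expR_gt0//.
rewrite expRN mulrC ler_pdivrMr ?expR_gt0//.
have u1 : 1 <= jbr x ^+ 2 by rewrite expr_ge1 ?jbr_ge1// jbr_ge0.
apply: (@le_trans _ _ ((jbr x ^+ 2) ^+ M.+1)).
  rewrite -exprM -powR_mulrn ?jbr_ge0// ler_powR ?jbr_ge1// (le_trans sM)// ler_nat.
  by rewrite mul2n -addnn addSn leqW// leq_addr.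
have := expR_ge1Dxn M (mulr_ge0 (ltW ap0) (le_trans ler01 u1)).
have F0 : 0 < M.+1`!%:R :> R by rewrite ltr0n fact_gt0.
rewrite exprMn => h.
rewrite -[leLHS]mul1r -(@divff _ (ap ^+ M.+1)) ?expf_neq0 ?gt_eqF//.
rewrite -(@ler_pM2r _ (ap ^+ M.+1 / M.+1`!%:R)) ?divr_gt0 ?exprn_gt0//.
rewrite (_ : _ * _ * (_ / _) = ap ^+ M.+1 * (jbr x ^+ 2) ^+ M.+1 / M.+1`!%:R); last first.
  by field; rewrite ?gt_eqF ?exprn_gt0.
rewrite (_ : _ / _ * expR _ * _ = expR (ap * jbr x ^+ 2)); last first.
  by field; rewrite ?gt_eqF ?exprn_gt0.
by lra.
Qed.

Lemma dirder_gauss n a (v : 'rV[R]_n) :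
  dirder v (gauss a) (fun x => - (2 * a * pi * dotv x v) * gauss a x).
Proof.
have h : dirder v (fun x : 'rV[R]_n => - (a * pi) * dotv x x) (fun x => - (a * pi) * (2 * dotv x v)).
  exact/dirderZ/dirder_sqr.
have := dirder_comp (@is_derive_expR R) h.
have -> : (fun x : 'rV[R]_n => expR (- (a * pi) * dotv x x)) = gauss a.
  by apply/funext => x; rewrite /gauss mulrA mulNr.
by apply: eq_dirder => x; rewrite (_ : expR _ = gauss a x); [ring|rewrite /gauss; congr expR; ring].
Qed.

Lemma integrable_gauss n a : 0 < a ->
  (lebn R n).-integrable setT (fun x => (gauss a x)%:E).
Proof.
move=> a0; have [C [C0 gC]] := gauss_le_jw n (n%:R + 1) a0.
apply: (@integrable_dom_jw _ _ (n%:R + 1) C).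
- by rewrite ltrDl.
- exact: measurable_gauss.
- by move=> x; rewrite ger0_norm ?gauss_ge0.
Qed.

(** A product of centred normal densities of variance 1/(2 pi). *)
Lemma Rintegral_gauss1 n : (\int[lebn R n]_x gauss 1 x = 1)%R.
Proof.
pose f (t : R) := expR (- (pi * t ^+ 2)).
have mf : measurable_fun setT f.
  apply: (measurableT_comp (f := @expR R)); first exact: measurable_expR.
  by apply: measurable_funN; apply: measurable_funM.
pose s : R := Num.sqrt (2 * pi)^-1.
have p0 : 0 < 2 * pi :> R by rewrite mulr_gt0 ?pi_gt0.
have s2 : s ^+ 2 = (2 * pi)^-1 by rewrite sqr_sqrtr// invr_ge0 ltW.
have s0 : s != 0 by rewrite gt_eqF// sqrtr_gt0 invr_gt0.
have fE : (\int[@lebesgue_measure R]_t (f t)%:E = 1)%E.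
  rewrite -(integral_normal_pdf 0 s); apply: eq_integral => t _; congr EFin.
  rewrite normal_pdfE// /normal_peak /normal_fun s2 subr0.
  have pi0 : pi != 0 :> R by rewrite gt_eqF ?pi_gt0.
  rewrite (_ : (2 * pi)^-1 * pi *+ 2 = 1); last by rewrite -mulrnAr -(mulr_natl pi) mulVf// gt_eqF.
  rewrite sqrtr1 invr1 mul1r /f; congr expR.
  have -> : (2 * pi)^-1 *+ 2 = pi^-1 :> R by rewrite -(mulr_natl (2 * pi)^-1) invfM mulrA divff ?mul1r.
  by rewrite invrK mulNr mulrC.
have := integral_lebn_prod n mf (fun t => expR_ge0 _).
have R1 : (\int[@lebesgue_measure R]_t f t = 1)%R by rewrite /Rintegral fE.
rewrite fE R1 expr1n => /(_ (ltry _)) E.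
rewrite /Rintegral (eq_integral (fun x : 'rV[R]_n => (\prod_i f (x 0 i))%:E)) ?E// => x _; congr EFin.
rewrite /f -expR_sum /gauss mul1r; congr expR.
by rewrite sumrN -mulr_sumr; congr (- (_ * _)); apply: eq_bigr => i _; rewrite expr2.
Qed.

(** * The Fourier transform of the Gaussian *)

Section gauss_fourier.
Variables (n : nat) (xi : 'rV[R]_n).

(** The transform along the ray through [xi]. It solves psi' = - 2 pi t |xi|^2 psi with psi(0) = 1,
    which determines psi(1). *)
Let psi (t : R) := (\int[lebn R n]_x (gauss 1 x * cos (2 * pi * t * dotv x xi)))%R.

Let f (t : R) (x : 'rV[R]_n) := gauss 1 x * cos (2 * pi * t * dotv x xi).
Let df (t : R) (x : 'rV[R]_n) :=
  gauss 1 x * (- sin (2 * pi * t * dotv x xi) * (2 * pi * dotv x xi)).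

Let is_derive_f (t : R) (x : 'rV[R]_n) : is_derive t 1 (f ^~ x) (df t x).
Proof.
have h1 : is_derive t 1 (fun t : R => 2 * pi * t * dotv x xi) (2 * pi * dotv x xi).
  have -> : (fun t : R => 2 * pi * t * dotv x xi) = (2 * pi * dotv x xi) \*: (@id R).
    by apply/funext => u /=; rewrite /GRing.scale/=; ring.
  by apply: (is_derive_eq (is_deriveZ _ (is_derive_id t 1))); rewrite /GRing.scale/= mulr1.
exact: (is_deriveZ (gauss 1 x) (is_derive1_comp (is_derive_cos _) h1)).
Qed.

Let mdot : measurable_fun setT (fun x : 'rV[R]_n => dotv x xi).
Proof. by apply: measurable_dotv => //; exact: measurable_cst. Qed.

Let mcos (t : R) : measurable_fun setT (fun x : 'rV[R]_n => cos (2 * pi * t * dotv x xi)).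
Proof.
apply: (measurableT_comp (f := @cos R)); last exact: measurable_funM.
by apply: continuous_measurable_fun; exact: continuous_cos.
Qed.

Let msin (t : R) : measurable_fun setT (fun x : 'rV[R]_n => sin (2 * pi * t * dotv x xi)).
Proof.
apply: (measurableT_comp (f := @sin R)); last exact: measurable_funM.
by apply: continuous_measurable_fun; exact: continuous_sin.
Qed.

Let mf t : measurable_fun setT (f t).
Proof. by apply: measurable_funM => //; exact: measurable_gauss. Qed.

Let ifa t : (lebn R n).-integrable setT (fun x => (f t x)%:E).
Proof.
apply: le_integrable (integrable_gauss n ltr01) => //; first exact/measurable_EFinP.
move=> x _ /=; rewrite lee_fin normrM ler_piMr//; exact: cos_max.
Qed.

Let K := \sum_i `|xi 0 i|.

Let dotv_le_jbr (x : 'rV[R]_n) : `|dotv x xi| <= jbr x * K.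
Proof.
apply: le_trans (ler_norm_sum _ _ _) _; rewrite mulr_sumr ler_sum// => i _.
by rewrite normrM ler_wpM2r// coord_le_jbr.
Qed.

(** The derivative of [gauss 1 x * sin (2 * pi * t * dotv x xi)] in the direction [xi] has integral
    zero; its two terms give the two sides. *)
Let dpsi (t : R) : (\int[lebn R n]_x df t x = - (2 * pi * t * dotv xi xi) * psi t)%R.
Proof.
pose P (x : 'rV[R]_n) := gauss 1 x * sin (2 * pi * t * dotv x xi).
pose dP (x : 'rV[R]_n) := 2 * pi * t * dotv xi xi * f t x + df t x.
have dPP : dirder xi P dP.
  have h1 : dirder xi (fun x => 2 * pi * t * dotv x xi) (fun=> 2 * pi * t * dotv xi xi).
    exact/dirderZ/dirder_dotv.
  have := dirderM (dirder_gauss 1 xi) (dirder_comp (@is_derive_sin R) h1).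
  by apply: eq_dirder => x; rewrite /dP /f /df; ring.
have [C [C0 gC]] := gauss_le_jw n (n%:R + 2) ltr01.
have mP : measurable_fun setT P.
  by apply: measurable_funM => //; exact: measurable_gauss.
have mdf : measurable_fun setT (df t).
  apply: measurable_funM; first exact: measurable_gauss.
  apply: measurable_funM; last exact: measurable_funM.
  exact: measurable_funN.
have mdP : measurable_fun setT dP.
  by apply: measurable_funD => //; apply: measurable_funM.
have jle (x : 'rV[R]_n) : jw (n%:R + 2) x <= jw (n%:R + 1) x.
  by apply: ler_jw; rewrite lerD2l ler1n.
have jj (x : 'rV[R]_n) : jw (n%:R + 2) x * jbr x <= jw (n%:R + 1) x.
  rewrite (_ : n%:R + 2 = (n%:R + 1) + 1); last by rewrite -addrA.
  by rewrite -jwM -mulrA -(powRr1 (jbr_ge0 x)) jw_jbr mulr1.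
have K0 : 0 <= K by apply: sumr_ge0.
have pi0 : 0 <= pi :> R by exact: pi_ge0.
have dfC x : `|df t x| <= C * (2 * pi * K) * jw (n%:R + 1) x.
  rewrite /df normrM ger0_norm ?gauss_ge0// normrM normrN.
  rewrite (normrM _ (dotv x xi)) (ger0_norm (_ : 0 <= 2 * pi)) ?mulr_ge0//.
  apply: (@le_trans _ _ (C * jw (n%:R + 2) x * (1 * (2 * pi * (jbr x * K))))).
    rewrite ler_pM ?gauss_ge0 ?mulr_ge0//.
    by rewrite ler_pM ?mulr_ge0 ?sin_max// ler_wpM2l// mulr_ge0.
  rewrite (_ : _ * (1 * _) = C * (2 * pi * K) * (jw (n%:R + 2) x * jbr x)); last by ring.
  by rewrite ler_wpM2l// mulr_ge0 ?(ltW C0)// !mulr_ge0.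
have ft x : `|f t x| <= C * jw (n%:R + 1) x.
  rewrite /f normrM ger0_norm ?gauss_ge0//.
  apply: (@le_trans _ _ (C * jw (n%:R + 2) x * 1)).
    by rewrite ler_pM ?gauss_ge0// cos_max.
  by rewrite mulr1 ler_wpM2l// ltW.
pose C' := C * (1 + `|2 * pi * t * dotv xi xi| + 2 * pi * K).
have n1 : n%:R < n%:R + 1 :> R by rewrite ltrDl.
have p2 : 0 <= 2 * pi * K by rewrite !mulr_ge0.
have := @Rintegral_dirder0 _ _ _ _ _ (n%:R + 1) C' n1 dPP mP mdP _ _.
have PC x : `|P x| <= C' * jw (n%:R + 1) x.
  rewrite /P normrM ger0_norm ?gauss_ge0//.
  apply: (@le_trans _ _ (C * jw (n%:R + 2) x * 1)).
    by rewrite ler_pM ?gauss_ge0// sin_max.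
  rewrite mulr1 /C' -mulrA ler_wpM2l ?(ltW C0)//.
  apply: le_trans (jle x) _; rewrite -{1}(mul1r (jw _ x)) ler_wpM2r ?jw_ge0//.
  by rewrite -addrA lerDl addr_ge0.
have dPC x : `|dP x| <= C' * jw (n%:R + 1) x.
  apply: le_trans (ler_normD _ _) _; rewrite normrM.
  apply: (@le_trans _ _ (`|2 * pi * t * dotv xi xi| * (C * jw (n%:R + 1) x) + C * (2 * pi * K) * jw (n%:R + 1) x)).
    by rewrite lerD// ler_wpM2l.
  rewrite /C' (_ : _ + _ = C * (`|2 * pi * t * dotv xi xi| + 2 * pi * K) * jw (n%:R + 1) x); last by ring.
  rewrite ler_wpM2r ?jw_ge0// ler_wpM2l ?(ltW C0)//.
  by rewrite lerD2r lerDr.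
move=> /(_ PC dPC).
have idf : (lebn R n).-integrable setT (fun x => (df t x)%:E).
  exact: integrable_dom_jw n1 mdf dfC.
pose c := 2 * pi * t * dotv xi xi.
have E1 := @RintegralD _ _ _ (lebn R n) setT (fun x => c * f t x) (df t) measurableT
  (integrableZl measurableT c (ifa t)) idf.
have E2 := @RintegralZl _ _ _ (lebn R n) setT (f t) c measurableT (ifa t).
by rewrite /dP -/c E1 E2 => E; rewrite -[LHS]subr0 -E /psi; ring.
Qed.

Let is_derive_psi (t : R) : is_derive t 1 psi (- (2 * pi * t * dotv xi xi) * psi t).
Proof.
have K0 : 0 <= K by apply: sumr_ge0.
have pi0 : 0 <= pi :> R by exact: pi_ge0.
have Ia : `]t - 1, t + 1[%classic t by rewrite /= in_itv/=; lra.
have iG : (lebn R n).-integrable setT (EFin \o (fun x => 2 * pi * K * (gauss 1 x * jbr x))).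
  have [C [C0 gC]] := gauss_le_jw n (n%:R + 2) ltr01.
  suff H : (lebn R n).-integrable setT (fun x => (gauss 1 x * jbr x)%:E).
    exact: (integrableZl measurableT (2 * pi * K) H).
  apply: (@integrable_dom_jw _ _ (n%:R + 1) C).
  - by rewrite ltrDl.
  - by apply: measurable_funM; [exact: measurable_gauss|exact: measurable_jbr].
  move=> x; rewrite ger0_norm ?mulr_ge0 ?gauss_ge0 ?jbr_ge0//.
  apply: (@le_trans _ _ (C * jw (n%:R + 2) x * jbr x)).
    by rewrite ler_wpM2r ?jbr_ge0.
  rewrite -mulrA ler_wpM2l ?(ltW C0)// (_ : n%:R + 2 = (n%:R + 1) + 1); last by rewrite -addrA.
  by rewrite -jwM -mulrA -(powRr1 (jbr_ge0 x)) jw_jbr mulr1.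
have d1 (x : R) y : `]t - 1, t + 1[%classic x -> setT y -> derivable (f ^~ y) x 1.
  by move=> _ _; have [] := is_derive_f x y.
have G0 (y : 'rV[R]_n) : 0 <= 2 * pi * K * (gauss 1 y * jbr y).
  by rewrite !mulr_ge0 ?gauss_ge0 ?jbr_ge0.
have dE x y : partial1of2 f x y = df x y.
  by rewrite partial1of2E; have [] := is_derive_f x y.
have Gub (x : R) y : `]t - 1, t + 1[%classic x -> setT y -> `|partial1of2 f x y| <= 2 * pi * K * (gauss 1 y * jbr y).
  move=> _ _; rewrite dE /df normrM ger0_norm ?gauss_ge0// normrM normrN.
  rewrite (normrM _ (dotv y xi)) (ger0_norm (_ : 0 <= 2 * pi)) ?mulr_ge0//.
  apply: (@le_trans _ _ (gauss 1 y * (1 * (2 * pi * (jbr y * K))))).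
    rewrite ler_wpM2l ?gauss_ge0// ler_pM ?mulr_ge0 ?sin_max//.
    by rewrite ler_wpM2l// mulr_ge0.
  by rewrite le_eqVlt; apply/orP; left; apply/eqP; ring.
have ifi (x : R) : `]t - 1, t + 1[%classic x -> (lebn R n).-integrable setT (EFin \o f x).
  by move=> _; exact: ifa.
have := derivable_under_integral measurableT Ia ifi d1 G0 iG Gub.
have := differentiation_under_integral measurableT Ia ifi d1 G0 iG Gub.
rewrite derive1E => E D; split => //.
rewrite -dpsi E; apply: eq_Rintegral => x _.
exact: dE.
Qed.

(** By the differential equation, psi(t) exp(pi |xi|^2 t^2) has derivative zero; its values at 0 and
    1 are compared. *)
Lemma Rintegral_gauss_cos :
  (\int[lebn R n]_x (gauss 1 x * cos (2 * pi * dotv x xi)) = gauss 1 xi)%R.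
Proof.
have h (t : R) : is_derive t 1 (fun t : R => pi * dotv xi xi * t ^+ 2) (pi * dotv xi xi * (2 * t)).
  apply: (is_derive_eq (is_deriveZ (pi * dotv xi xi) (is_deriveX 2 (is_derive_id t 1)))).
  by rewrite /GRing.scale/= mulr1.
have hh (t : R) := is_derive1_comp (is_derive_expR _) (h t).
have d0 (t : R) : is_derive t 1 (psi * (expR \o (fun t : R => pi * dotv xi xi * t ^+ 2))) 0.
  apply: (is_derive_eq (is_deriveM (is_derive_psi t) (hh t))).
  by rewrite /GRing.scale/=; ring.
have := is_derive_0_is_cst 1 0 d0.
rewrite !fctE /= expr1n mulr1 expr0n/= mulr0 expR0 mulr1.
have -> : psi 0 = 1.
  rewrite /psi -[RHS](Rintegral_gauss1 n); apply: eq_Rintegral => x _.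
  by rewrite mulr0 mul0r cos0 mulr1.
have -> : psi 1 = (\int[lebn R n]_x (gauss 1 x * cos (2 * pi * dotv x xi)))%R.
  by apply: eq_Rintegral => x _; rewrite mulr1.
move=> E; apply: (mulIf (lt0r_neq0 (expR_gt0 (pi * dotv xi xi)))).
by rewrite E {1}/gauss mul1r expRN mulVf// gt_eqF ?expR_gt0.
Qed.

Lemma gauss_fourier :
  cint (lebn R n) (fun x => (gauss 1 x)%:C * expi (- (2 * pi * dotv x xi))) = (gauss 1 xi)%:C.
Proof.
apply: complex_ext => /=.
  rewrite -Rintegral_gauss_cos; apply: eq_Rintegral => x _.
  by rewrite mul0r subr0 cosN.
(* The imaginary part is the integral of an odd function. *)
pose S := (\int[lebn R n]_x (gauss 1 x * sin (2 * pi * dotv x xi)))%R.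
have iS : (lebn R n).-integrable setT (fun x => (gauss 1 x * sin (2 * pi * dotv x xi))%:E).
  apply: le_integrable (integrable_gauss n ltr01) => //.
    apply/measurable_EFinP/measurable_funM; first exact: measurable_gauss.
    apply: (measurableT_comp (f := @sin R)); last exact: measurable_funM.
    by apply: continuous_measurable_fun; exact: continuous_sin.
  move=> x _ /=; rewrite lee_fin normrM ler_piMr//; exact: sin_max.
have S0 : S = - S.
  rewrite {1}/S -(Rintegral_lebn_opp iS) -mulN1r -RintegralZl//.
  apply: eq_Rintegral => x _.
  by rewrite gaussN dotvNl mulrN sinN mulrN mulN1r.
have {}S0 : S = 0 by lra.
transitivity (- S); last by rewrite S0 oppr0.
rewrite -mulN1r -RintegralZl//; apply: eq_Rintegral => x _.
by rewrite mul0r addr0 sinN mulrN mulN1r.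
Qed.

End gauss_fourier.
End gauss.

(** * The Fourier transform of integrable functions *)

Section complex_limits.
Variable R : realType.
Implicit Types (u v : nat -> R[i]) (l c : R[i]).

Definition ccvg u l :=
  Re (u k) @[k --> \oo] --> Re l /\ Im (u k) @[k --> \oo] --> Im l.

Lemma ccvgM u v l m : ccvg u l -> ccvg v m -> ccvg (fun k => u k * v k) (l * m).
Proof.
move=> [ur ui] [vr vi]; split; rewrite ?ReM ?ImM.
  under eq_fun do rewrite ReM.
  by apply: cvgB; apply: cvgM.
under eq_fun do rewrite ImM.
by apply: cvgD; apply: cvgM.
Qed.

Lemma ccvg_cst c : ccvg (fun=> c) c.
Proof. by split; exact: cvg_cst. Qed.

Lemma ccvg_cabs_le u l (M : R) : (forall k, cabs (u k) <= M) -> ccvg u l -> cabs l <= M.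
Proof.
move=> uM [ur ui]; have M0 : 0 <= M := le_trans (cabs_ge0 _) (uM 0).
rewrite -(@ler_pXn2r _ 2) ?nnegrE ?cabs_ge0// sqr_cabs.
have h : Re (u k) * Re (u k) + Im (u k) * Im (u k) @[k --> \oo] --> Re l * Re l + Im l * Im l.
  by apply: cvgD; apply: cvgM.
rewrite !expr2 -(cvg_lim _ h)//; apply: limr_le; first by apply/cvg_ex; eexists; exact: h.
by apply: nearW => k; rewrite -!expr2 -sqr_cabs ler_pXn2r ?nnegrE ?cabs_ge0.
Qed.

Lemma cint_dominated d (T : measurableType d) (mu : {measure set T -> \bar R})
    (h_ : nat -> T -> R[i]) (h : T -> R[i]) (g : T -> R) :
  (forall k, cmeas (h_ k)) -> cmeas h -> (forall x, ccvg (h_ ^~ x) (h x)) ->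
  mu.-integrable setT (fun x => (g x)%:E) -> (forall k x, cabs (h_ k x) <= g x) ->
  ccvg (fun k => cint mu (h_ k)) (cint mu h).
Proof.
move=> mh_ [mhr mhi] hcvg ig hg.
have real (f_ : nat -> T -> R) (f : T -> R) : (forall k, measurable_fun setT (f_ k)) ->
    measurable_fun setT f -> (forall x, f_ k x @[k --> \oo] --> f x) ->
    (forall k x, `|f_ k x| <= g x) ->
    (\int[mu]_x f_ k x)%R @[k --> \oo] --> (\int[mu]_x f x)%R.
  move=> mf_ mf fcvg fg.
  have [If _ H] : [/\ mu.-integrable setT (fun x => (f x)%:E),
      [sequence \int[mu]_x `|(f_ k x)%:E - (f x)%:E|]_k @ \oo --> 0 &
      [sequence \int[mu]_x (f_ k x)%:E]_k @ \oo --> \int[mu]_x (f x)%:E]%E.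
    apply: (@dominated_convergence _ _ _ mu setT measurableT
      (fun k x => (f_ k x)%:E) (fun x => (f x)%:E) (fun x => (g x)%:E)) => //.
    - by move=> k; apply/measurable_EFinP.
    - exact/measurable_EFinP.
    - by apply: aeW => x _; apply: cvg_EFin; [exact: nearW|exact: fcvg].
    - by apply: aeW => x k _; rewrite lee_fin.
  apply: fine_cvg; rewrite fineK//; exact: integrable_fin_num.
split; apply: real => //.
- by move=> k; case: (mh_ k).
- by move=> x; case: (hcvg x).
- by move=> k x; apply: le_trans (hg k x); exact: normr_Re_cabs.
- by move=> k; case: (mh_ k).
- by move=> x; case: (hcvg x).
- by move=> k x; apply: le_trans (hg k x); exact: normr_Im_cabs.
Qed.

End complex_limits.

Section cint_tools.
Context d1 d2 (T1 : measurableType d1) (T2 : measurableType d2) (R : realType).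
Variables (m1 : {sigma_finite_measure set T1 -> \bar R})
          (m2 : {sigma_finite_measure set T2 -> \bar R}).

Lemma cmeas_fst (h : T1 -> R[i]) : cmeas h -> cmeas (fun p : T1 * T2 => h p.1).
Proof. by move=> mh; apply: (cmeas_comp mh); exact: measurable_fst. Qed.

Lemma cmeas_snd (h : T2 -> R[i]) : cmeas h -> cmeas (fun p : T1 * T2 => h p.2).
Proof. by move=> mh; apply: (cmeas_comp mh); exact: measurable_snd. Qed.

Lemma cmeas_slice1 (F : T1 -> T2 -> R[i]) x :
  cmeas (fun p : T1 * T2 => F p.1 p.2) -> cmeas (F x).
Proof.
move=> mF; apply: (cmeas_comp (f := fun y => (x, y)) mF).
exact: measurable_fun_pair.
Qed.

Lemma integral2_lty (F : T1 -> T2 -> R[i]) (a : T1 -> R) :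
  cmeas (fun p : T1 * T2 => F p.1 p.2) ->
  m1.-integrable setT (fun x => (a x)%:E) ->
  (forall x, (\int[m2]_y (cabs (F x y))%:E <= (a x)%:E)%E) ->
  (\int[m1]_x \int[m2]_y (cabs (F x y))%:E < +oo)%E.
Proof.
move=> mF ia Fa; have /integrableP[ma alty] := ia.
have mc : measurable_fun setT (fun p : T1 * T2 => (cabs (F p.1 p.2))%:E).
  by apply/measurable_EFinP; exact: measurable_cabs.
have F0 x : (0 <= \int[m2]_y (cabs (F x y))%:E)%E.
  by apply: integral_ge0 => y _; rewrite lee_fin cabs_ge0.
apply: le_lt_trans alty; apply: ge0_le_integral => //.
- exact: measurable_integral2.
- exact: measurableT_comp.
- by move=> x _; rewrite gee0_abs ?Fa// (le_trans (F0 x)).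
Qed.

Lemma integral2_prod_lty (F : T1 -> T2 -> R[i]) (a : T1 -> R) (b : T2 -> R) :
  cmeas (fun p : T1 * T2 => F p.1 p.2) ->
  m1.-integrable setT (fun x => (a x)%:E) -> m2.-integrable setT (fun y => (b y)%:E) ->
  (forall x y, cabs (F x y) <= a x * b y) ->
  (\int[m1]_x \int[m2]_y (cabs (F x y))%:E < +oo)%E.
Proof.
move=> mF ia ib Fab.
apply: (@integral2_lty _ (fun x => a x * (\int[m2]_y b y)%R)) => //.
  exact: (integrableZr measurableT (\int[m2]_y b y)%R ia).
move=> x.
have ->: (a x * (\int[m2]_y b y)%R)%:E = (\int[m2]_y (a x * b y)%:E)%E.
  rewrite EFinM fineK; last exact: integrable_fin_num.
  by under [RHS]eq_integral do rewrite EFinM; rewrite integralZl.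
apply: ge0_le_integral => //.
- by move=> y _; rewrite lee_fin cabs_ge0.
- by apply/measurable_EFinP/measurable_cabs/cmeas_slice1.
- by have /measurable_int := integrableZl measurableT (a x) ib.
- by move=> y _; rewrite lee_fin.
Qed.

End cint_tools.

Section fourier_transform.
Variables (R : realType) (n : nat).
Implicit Types (h A B : 'rV[R]_n -> R[i]) (x y w : 'rV[R]_n).

(** The transform as an integral against [lebn]; it agrees with [fourier] on integrable
    functions. *)
Definition ft h y : R[i] := cint (lebn R n) (fun x => h x * expi (- (2 * pi * dotv x y))).

Lemma measurable_phase d (T : measurableType d) (f g : T -> 'rV[R]_n) :
  measurable_fun setT f -> measurable_fun setT g ->
  measurable_fun setT (fun t => 2 * pi * dotv (f t) (g t)).
Proof. by move=> mf mg; apply: measurable_funM => //; exact: measurable_dotv. Qed.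

Lemma cmeas_phase d (T : measurableType d) (f g : T -> 'rV[R]_n) :
  measurable_fun setT f -> measurable_fun setT g ->
  cmeas (fun t => expi (2 * pi * dotv (f t) (g t))).
Proof. by move=> mf mg; apply: cmeas_expi; exact: measurable_phase. Qed.

Lemma cmeas_phaseN d (T : measurableType d) (f g : T -> 'rV[R]_n) :
  measurable_fun setT f -> measurable_fun setT g ->
  cmeas (fun t => expi (- (2 * pi * dotv (f t) (g t)))).
Proof. by move=> mf mg; apply: cmeas_expi; apply: measurable_funN; exact: measurable_phase. Qed.

Lemma cintegrable_phase h y : cintegrable (lebn R n) h ->
  cintegrable (lebn R n) (fun x => h x * expi (- (2 * pi * dotv x y))).
Proof.
move=> ih; apply: (cintegrable_dom _ (cintegrable_cabs ih)).
  apply: cmeasM; first exact: cintegrable_meas ih.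
  by apply: cmeas_phaseN => //; exact: measurable_cst.
by move=> x; rewrite mulrC cabs_expiM.
Qed.

Lemma cmeas_ft h : cmeas h -> cmeas (ft h).
Proof.
move=> mh; apply: cmeas_cint2; apply: cmeasM; first exact: cmeas_snd.
by apply: cmeas_phaseN; [exact: measurable_snd|exact: measurable_fst].
Qed.

Lemma cabs_ft_le h y : cmeas h ->
  ((cabs (ft h y))%:E <= \int[lebn R n]_x (cabs (h x))%:E)%E.
Proof.
move=> mh; apply: le_trans (cabs_cint _ _) _.
  by apply: cmeasM => //; apply: cmeas_phaseN => //; exact: measurable_cst.
by rewrite (eq_integral (fun x => (cabs (h x))%:E))// => x _; rewrite mulrC cabs_expiM.
Qed.

Lemma fourierE h y : cintegrable (lebn R n) h -> fourier h y = ft h y.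
Proof. by move=> ih; rewrite /fourier cintRnE//; exact: cintegrable_phase. Qed.

Definition ccont h := continuous (fun x => Re (h x)) /\ continuous (fun x => Im (h x)).

Lemma ccont_cmeas h : ccont h -> cmeas h.
Proof. by move=> [hr hi]; split; exact: continuous_measurable_rV. Qed.

Lemma ft_gauss_scale (e : R) (x : 'rV[R]_n) : 0 < e ->
  ft (fun w => (gauss 1 (e *: w))%:C) x = ((e^-1 ^+ n) * gauss 1 (e^-1 *: x))%:C.
Proof.
move=> e0; rewrite rmorphM/= -gauss_fourier.
rewrite -(cint_lebn_scale e0); last first.
  apply: cintegrable_phase; apply: (cintegrable_dom _ (integrable_gauss n ltr01)).
    by apply: cmeas_real; exact: measurable_gauss.
  by move=> y; rewrite cabs_real ger0_norm ?gauss_ge0.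
apply: eq_cint => w; congr (_ * expi (- (_ * _))).
by rewrite dotvZl dotvZr mulrA divff ?mul1r// gt_eqF.
Qed.

(** * Gaussian regularization and transforms of products *)

Section regularization.
Variables (A : 'rV[R]_n -> R[i]) (C : R).
Hypotheses (cA : ccont A) (iA : cintegrable (lebn R n) A)
  (AC : forall x, cabs (A x) <= C).

(** A mollification at scale [e]. The dilation sits inside [A], so that the limit at scale 0 is
    dominated convergence against a fixed weight. *)
Definition regul (e : R) x := cint (lebn R n) (fun t => A (x + e *: t) * (gauss 1 t)%:C).

Let mA : cmeas A. Proof. exact: ccont_cmeas. Qed.

Let mg (a : R) : cmeas (fun t : 'rV[R]_n => (gauss a t)%:C).
Proof. by apply: cmeas_real; exact: measurable_gauss. Qed.

Let mAe (e : R) x : cmeas (fun t : 'rV[R]_n => A (x + e *: t)).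
Proof.
apply: (cmeas_comp mA); apply: measurable_rVD; first exact: measurable_cst.
by apply: measurable_rVZ => //; exact: measurable_cst.
Qed.

Let ig := integrable_gauss n (@ltr01 R).

Let C0 : 0 <= C. Proof. exact: le_trans (cabs_ge0 _) (AC 0). Qed.

Lemma cabs_regul e x : cabs (regul e x) <= C.
Proof.
rewrite -[leRHS]mulr1 -(Rintegral_gauss1 R n) -RintegralZl//.
apply: cabs_cint_le.
- exact: cmeasM.
- exact: (integrableZl measurableT C ig).
- by move=> t; rewrite cabsMr ger0_norm ?gauss_ge0// ler_wpM2r ?gauss_ge0.
Qed.

Lemma regul_cvg x : ccvg (fun k => regul k.+1%:R^-1 x) (A x).
Proof.
have -> : A x = cint (lebn R n) (fun t => A x * (gauss 1 t)%:C).
  rewrite cintZ; last first.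
    apply: (cintegrable_dom (mg 1) ig) => t.
    by rewrite cabs_real ger0_norm ?gauss_ge0.
  rewrite [X in _ * X](_ : _ = 1) ?mulr1//.
  apply: complex_ext => /=; first exact: Rintegral_gauss1.
  by rewrite Rintegral_cst// mul0r.
apply: (cint_dominated (g := fun t => C * gauss 1 t)).
- by move=> k; exact: cmeasM.
- by apply: cmeasM => //; exact: cmeas_cst.
- move=> t; apply: ccvgM; last exact: ccvg_cst.
  have h : x + k.+1%:R^-1 *: t @[k --> \oo] --> x.
    rewrite -[X in _ --> X]addr0 -(scale0r t); apply: cvgD; first exact: cvg_cst.
    by apply: cvgZr_tmp; exact: cvg_harmonic.
  split.
    exact: (cvg_comp _ _ h (cA.1 x)).
  exact: (cvg_comp _ _ h (cA.2 x)).
- exact: (integrableZl measurableT C ig).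
- by move=> k t; rewrite cabsMr ger0_norm ?gauss_ge0// ler_wpM2r ?gauss_ge0.
Qed.

(** Fourier inversion with a Gaussian summability factor, which holds for integrable [A] whether or
    not its transform is integrable: after Fubini, the integral in [w] is the transform of a dilated
    Gaussian, that is, the mollifier. *)
Lemma regulE e x : 0 < e ->
  regul e x = cint (lebn R n) (fun w =>
    ft A w * ((gauss 1 (e *: w))%:C * expi (2 * pi * dotv w x))).
Proof.
move=> e0; pose c w := (gauss 1 (e *: w))%:C * expi (2 * pi * dotv w x).
pose F w y := c w * (A y * expi (- (2 * pi * dotv y w))).
have mge : cmeas (fun w : 'rV[R]_n => (gauss 1 (e *: w))%:C).
  by apply: (cmeas_comp (mg 1)); apply: measurable_rVZ => //; exact: measurable_cst.
have mc : cmeas c.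
  by apply: cmeasM => //; apply: cmeas_phase => //; exact: measurable_cst.
have ige : (lebn R n).-integrable setT (fun w : 'rV[R]_n => (gauss 1 (e *: w))%:E).
  apply: (@integrable_lebn_subst _ _ (fun w => e *: w) (e^-1 ^+ n) _ _ _ (gauss 1)) => //.
  - by rewrite exprn_ge0// invr_ge0 ltW.
  - by apply: measurable_rVZ => //; exact: measurable_cst.
  - by move=> G mG G0; exact: ge0_integral_lebn_scale.
have mF : cmeas (fun p : 'rV[R]_n * 'rV[R]_n => F p.1 p.2).
  apply: cmeasM; first exact: cmeas_fst.
  apply: cmeasM; first exact: cmeas_snd.
  by apply: cmeas_phaseN; [exact: measurable_snd|exact: measurable_fst].
have FE w y : cabs (F w y) <= gauss 1 (e *: w) * cabs (A y).
  rewrite /F /c !cabsM !cabs_expi !mulr1 cabs_real ger0_norm ?gauss_ge0//.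
transitivity (cint (lebn R n) (fun w => cint (lebn R n) (F w))); last first.
  by apply: eq_cint => w; rewrite /F (cintZ _ (cintegrable_phase w iA)) mulrC.
rewrite cint_Fubini//; last first.
  by apply: (integral2_prod_lty mF ige _ FE); exact: cintegrable_cabs.
pose H z := A (z + x) * (gauss 1 (e^-1 *: z))%:C.
have iH : cintegrable (lebn R n) H.
  apply: (cintegrable_dom (g := fun z : 'rV[R]_n => cabs (A (z + x)))).
  - apply: cmeasM.
      by apply: (cmeas_comp mA); apply: measurable_rVD => //; exact: measurable_cst.
    by apply: (cmeas_comp (mg 1)); apply: measurable_rVZ => //; exact: measurable_cst.
  - exact: (integrable_lebn_shift x (cintegrable_cabs iA)).
  - move=> z; rewrite cabsMr ger0_norm ?gauss_ge0//.
    by rewrite ler_piMr ?cabs_ge0// gauss_le1.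
transitivity ((e^-1 ^+ n)%:C * cint (lebn R n) H).
  rewrite -(cint_lebn_scale e0 iH); apply: eq_cint => t.
  by rewrite /H scalerA mulVf ?gt_eqF// scale1r (addrC x).
rewrite -(cintZ _ iH); set H' := (fun z => _ * H z).
have iH' : cintegrable (lebn R n) H' by exact: cintegrableZ.
rewrite -(cint_lebn_shift (- x) iH'); apply: eq_cint => y.
rewrite /H' /H subrK.
transitivity (A y * ft (fun w => (gauss 1 (e *: w))%:C) (y - x)).
  by rewrite ft_gauss_scale// rmorphM/= mulrCA.
rewrite -cintZ; last first.
  apply: cintegrable_phase; apply: (cintegrable_dom mge ige) => w.
  by rewrite cabs_real ger0_norm ?gauss_ge0.
apply: eq_cint => w; rewrite /F /c.
have -> : - (2 * pi * dotv w (y - x)) = 2 * pi * dotv w x + - (2 * pi * dotv y w).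
  by rewrite dotvBr (dotvC w y); ring.
by rewrite expiD; ring.
Qed.

Section product.
Variable B : 'rV[R]_n -> R[i].
Hypotheses (iB : cintegrable (lebn R n) B)
  (iftA : (lebn R n).-integrable setT (fun w => (cabs (ft A w))%:E)).

Let mB : cmeas B. Proof. exact: cintegrable_meas iB. Qed.

Lemma regul_mul_ft e y : 0 < e ->
  cint (lebn R n) (fun x => regul e x * (B x * expi (- (2 * pi * dotv x y)))) =
  cint (lebn R n) (fun w => ft A w * (gauss 1 (e *: w))%:C * ft B (y - w)).
Proof.
move=> e0; pose By x := B x * expi (- (2 * pi * dotv x y)).
have mBy : cmeas By.
  by apply: cmeasM => //; apply: cmeas_phaseN => //; exact: measurable_cst.
have mftA := cmeas_ft mA.
pose c w x := (gauss 1 (e *: w))%:C * expi (2 * pi * dotv w x).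
pose F x w := By x * (ft A w * c w x).
have mge : cmeas (fun w : 'rV[R]_n => (gauss 1 (e *: w))%:C).
  by apply: (cmeas_comp (mg 1)); apply: measurable_rVZ => //; exact: measurable_cst.
have mF : cmeas (fun p : 'rV[R]_n * 'rV[R]_n => F p.1 p.2).
  apply: cmeasM; first exact: cmeas_fst.
  apply: cmeasM; first exact: cmeas_snd.
  rewrite /c; apply: cmeasM.
    by apply: (cmeas_comp (mg 1)); apply: measurable_rVZ;
      [exact: measurable_cst|exact: measurable_snd].
  by apply: cmeas_phase; [exact: measurable_snd|exact: measurable_fst].
have FE x w : cabs (F x w) <= cabs (B x) * cabs (ft A w).
  rewrite /F /By /c !cabsM !cabs_expi !mulr1 cabs_real ger0_norm ?gauss_ge0//.
  by rewrite ler_wpM2l ?cabs_ge0// ler_piMr ?cabs_ge0// gauss_le1.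
transitivity (cint (lebn R n) (fun x => cint (lebn R n) (F x))).
  apply: eq_cint => x; rewrite regulE// mulrC /F cintZ//.
  apply: (cintegrable_dom _ iftA) => [|w].
    apply: cmeasM => //; apply: cmeasM => //.
    by apply: cmeas_phase => //; exact: measurable_cst.
  rewrite !cabsM cabs_expi mulr1 cabs_real ger0_norm ?gauss_ge0//.
  by rewrite ler_piMr ?cabs_ge0// gauss_le1.
rewrite cint_Fubini//; last first.
  by apply: (integral2_prod_lty mF _ iftA FE); exact: cintegrable_cabs.
apply: eq_cint => w; rewrite -cintZ; last exact: cintegrable_phase.
apply: eq_cint => x; rewrite /F /By /c.
have -> : - (2 * pi * dotv x (y - w)) = - (2 * pi * dotv x y) + 2 * pi * dotv w x.
  by rewrite dotvBr (dotvC w x); ring.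
by rewrite expiD; ring.
Qed.

(** The scale in [regul_mul_ft] tends to 0. On the left this is dominated convergence, by continuity
    of [A]; on the right the Gaussian factor is simply bounded by 1, whence an inequality instead of
    the convolution theorem. *)
Lemma cabs_ft_mul y :
  ((cabs (ft (fun x => A x * B x) y))%:E <=
   \int[lebn R n]_w (cabs (ft A w) * cabs (ft B (y - w)))%:E)%E.
Proof.
have mftA := cmeas_ft mA.
have mftB : cmeas (fun w => ft B (y - w)).
  by apply: (cmeas_comp (cmeas_ft mB)); apply: measurable_rVB => //; exact: measurable_cst.
set M := (\int[lebn R n]_w _)%E.
have M0 : (0 <= M)%E by apply: integral_ge0 => w _; rewrite lee_fin mulr_ge0 ?cabs_ge0.
have [Moo|] := boolP (M < +oo)%E; last by rewrite -leNgt leye_eq => /eqP ->; rewrite leey.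
have Mfin : M \is a fin_num by rewrite ge0_fin_numE.
have mge (e : R) : cmeas (fun w : 'rV[R]_n => (gauss 1 (e *: w))%:C).
  by apply: (cmeas_comp (mg 1)); apply: measurable_rVZ => //; exact: measurable_cst.
rewrite -(fineK Mfin) lee_fin.
apply: (@ccvg_cabs_le _ (fun k => cint (lebn R n) (fun x =>
   regul k.+1%:R^-1 x * (B x * expi (- (2 * pi * dotv x y)))))).
  move=> k; rewrite regul_mul_ft ?invr_gt0 ?ltr0n//.
  rewrite -lee_fin fineK//; apply: le_trans (cabs_cint _ _) _.
    by apply: cmeasM => //; exact: cmeasM.
  apply: ge0_le_integral => //.
  - by move=> w _; rewrite lee_fin cabs_ge0.
  - by apply/measurable_EFinP/measurable_cabs; apply: cmeasM => //; exact: cmeasM.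
  - by apply/measurable_EFinP/measurable_funM; exact: measurable_cabs.
  - move=> w _; rewrite lee_fin !cabsM cabs_real ger0_norm ?gauss_ge0//.
    by rewrite ler_wpM2r ?cabs_ge0// ler_piMr ?cabs_ge0// gauss_le1.
have mBy : cmeas (fun x => B x * expi (- (2 * pi * dotv x y))).
  by apply: cmeasM => //; apply: cmeas_phaseN => //; exact: measurable_cst.
have mregul (e : R) : cmeas (regul e).
  apply: cmeas_cint2; apply: cmeasM; last by apply: (cmeas_comp (mg 1)); exact: measurable_snd.
  apply: (cmeas_comp mA); apply: measurable_rVD; first exact: measurable_fst.
  by apply: measurable_rVZ; [exact: measurable_cst|exact: measurable_snd].
apply: (cint_dominated (g := fun x => C * cabs (B x))).
- by move=> k; exact: cmeasM.
- by apply: cmeasM; [exact: cmeasM|apply: cmeas_phaseN => //; exact: measurable_cst].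
- by move=> x; rewrite -(mulrA (A x)); exact: (ccvgM (regul_cvg x) (ccvg_cst _)).
- exact: (integrableZl measurableT C (cintegrable_cabs iB)).
- move=> k x; rewrite !cabsM cabs_expi mulr1.
  by rewrite ler_wpM2r ?cabs_ge0// cabs_regul.
Qed.

End product.
End regularization.
End fourier_transform.

(** * Integration by parts against a phase *)

Section integration_by_parts.
Variables (R : realType) (n : nat).
Implicit Types (v x y xi : 'rV[R]_n).

(** The derivatives of G cos(th) and G sin(th) have integral zero, so the two integrals differ by
    the factor -i, which the moduli hide. [C] is absent from the conclusion: the bounds are only
    needed for convergence. *)
Lemma cabs_ibp v (th dth G dG : 'rV[R]_n -> R) (s C : R) : n%:R < s ->
  dirder v th dth -> dirder v G dG ->
  measurable_fun setT th -> measurable_fun setT dth ->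
  measurable_fun setT G -> measurable_fun setT dG ->
  (forall x, `|G x| <= C * jw s x) -> (forall x, `|dth x * G x| <= C * jw s x) ->
  (forall x, `|dG x| <= C * jw s x) ->
  cabs (cint (lebn R n) (fun x => expi (th x) * (dth x * G x)%:C)) =
  cabs (cint (lebn R n) (fun x => expi (th x) * (dG x)%:C)).
Proof.
move=> ns dthP dGP mth mdth mG mdG GC thGC dGC.
have mcos : measurable_fun setT (fun x => cos (th x)).
  apply: (measurableT_comp (f := @cos R)) => //.
  by apply: continuous_measurable_fun; exact: continuous_cos.
have msin : measurable_fun setT (fun x => sin (th x)).
  apply: (measurableT_comp (f := @sin R)) => //.
  by apply: continuous_measurable_fun; exact: continuous_sin.
have C0 : 0 <= C.
  by have := le_trans (normr_ge0 _) (GC 0); rewrite pmulr_lge0 ?jw_gt0.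
have CC x : C * jw s x <= 2 * C * jw s x.
  by rewrite ler_wpM2r ?jw_ge0// ler_peMl// ler1n.
have bound (a b c : R) x : `|a| <= 1 -> `|b| <= C * jw s x -> `|a * b| <= C * jw s x.
  move=> a1 bC; rewrite normrM (le_trans _ bC)// -[leRHS]mul1r.
  by rewrite ler_wpM2r.
have integ (c G' : 'rV[R]_n -> R) : measurable_fun setT c -> measurable_fun setT G' ->
    (forall x, `|c x| <= 1) -> (forall x, `|G' x| <= C * jw s x) ->
    (lebn R n).-integrable setT (fun x => (c x * G' x)%:E).
  move=> mc mG' c1 G'C; apply: (integrable_dom_jw ns (C := C)); first exact: measurable_funM.
  by move=> x; apply: bound.
have mdthG : measurable_fun setT (fun x => dth x * G x) by exact: measurable_funM.
have Ecos : (\int[lebn R n]_x (cos (th x) * dG x) = \int[lebn R n]_x (sin (th x) * (dth x * G x)))%R.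
  pose P x := cos (th x) * G x.
  pose dP x := cos (th x) * dG x - sin (th x) * (dth x * G x).
  have dPP : dirder v P dP.
    have := dirderM (dirder_comp (@is_derive_cos R) dthP) dGP.
    by apply: eq_dirder => x; rewrite /dP; ring.
  have i1 := integ _ _ mcos mdG (fun x => cos_max _) dGC.
  have i2 := integ _ _ msin mdthG (fun x => sin_max _) thGC.
  apply/eqP; rewrite -subr_eq0 -RintegralB//; apply/eqP.
  apply: (Rintegral_dirder0 (s := s) (C := 2 * C) ns dPP).
  - exact: measurable_funM.
  - by apply: measurable_funB; exact: measurable_funM.
  - by move=> x; apply: le_trans (CC x); apply: bound => //; exact: cos_max.
  - move=> x; apply: le_trans (ler_normB _ _) _.
    rewrite -mulrA mulr_natl mulr2n lerD//; apply: bound => //; [exact: cos_max|exact: sin_max].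
have Esin : (\int[lebn R n]_x (sin (th x) * dG x) = - \int[lebn R n]_x (cos (th x) * (dth x * G x)))%R.
  pose P x := sin (th x) * G x.
  pose dP x := sin (th x) * dG x + cos (th x) * (dth x * G x).
  have dPP : dirder v P dP.
    have := dirderM (dirder_comp (@is_derive_sin R) dthP) dGP.
    by apply: eq_dirder => x; rewrite /dP; ring.
  have i1 := integ _ _ msin mdG (fun x => sin_max _) dGC.
  have i2 := integ _ _ mcos mdthG (fun x => cos_max _) thGC.
  apply/eqP; rewrite -subr_eq0 opprK -RintegralD//; apply/eqP.
  apply: (Rintegral_dirder0 (s := s) (C := 2 * C) ns dPP).
  - exact: measurable_funM.
  - by apply: measurable_funD; exact: measurable_funM.
  - by move=> x; apply: le_trans (CC x); apply: bound => //; exact: sin_max.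
  - move=> x; apply: le_trans (ler_normD _ _) _.
    rewrite -mulrA mulr_natl mulr2n lerD//; apply: bound => //; [exact: sin_max|exact: cos_max].
have RE (f : 'rV[R]_n -> R) : (\int[lebn R n]_x Re (expi (th x) * (f x)%:C) = \int[lebn R n]_x (cos (th x) * f x))%R.
  by apply: eq_Rintegral => x _; rewrite ReM/= mulr0 subr0.
have IE (f : 'rV[R]_n -> R) : (\int[lebn R n]_x Im (expi (th x) * (f x)%:C) = \int[lebn R n]_x (sin (th x) * f x))%R.
  by apply: eq_Rintegral => x _; rewrite ImM/= mulr0 add0r.
rewrite /cabs /cint /= !RE !IE Ecos Esin sqrrN addrC.
by [].
Qed.

End integration_by_parts.

Section window.
Variables (R : realType) (n : nat).
Implicit Types (x y z w xi : 'rV[R]_n) (h : 'rV[R]_n -> R[i]).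

Lemma cmeas_gauss (a : R) : cmeas (fun x => (gauss a x)%:C).
Proof. by apply: cmeas_real; exact: measurable_gauss. Qed.

Lemma measurable_subv xi : measurable_fun setT (fun x : 'rV[R]_n => x - xi).
Proof. by apply: measurable_rVB => //; exact: measurable_cst. Qed.

Lemma ft_shift h xi y : cintegrable (lebn R n) h ->
  ft (fun x => h (x - xi)) y = expi (- (2 * pi * dotv xi y)) * ft h y.
Proof.
move=> ih; have ih' := cintegrable_phase y ih.
rewrite -(cintZ _ ih') /ft.
rewrite -(cint_lebn_shift (- xi) (cintegrableZ (expi (- (2 * pi * dotv xi y))) ih')).
apply: eq_cint => x; rewrite mulrCA -expiD; congr (_ * expi _).
by rewrite dotvBl; ring.
Qed.

Lemma cabs_ft_shift h xi y : cintegrable (lebn R n) h ->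
  cabs (ft (fun x => h (x - xi)) y) = cabs (ft h y).
Proof. by move=> ih; rewrite ft_shift// cabs_expiM. Qed.

Lemma coord_gauss_le_jw (a s : R) (j : 'I_n) : 0 < a -> exists C : R, 0 < C /\
  forall x, `|x 0 j * gauss a x| <= C * jw s x.
Proof.
move=> a0; have [C [C0 gC]] := gauss_le_jw n (s + 1) a0.
exists C; split => // x; rewrite normrM (ger0_norm (gauss_ge0 _ _)).
apply: (@le_trans _ _ (jbr x * (C * jw (s + 1) x))).
  by rewrite ler_pM ?gauss_ge0// coord_le_jbr.
rewrite mulrCA ler_wpM2l ?(ltW C0)// -jwM mulrC -mulrA.
by rewrite -(powRr1 (jbr_ge0 x)) jw_jbr mulr1.
Qed.

Lemma measurable_coord_gauss a (j : 'I_n) : measurable_fun setT (fun x => x 0 j * gauss a x).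
Proof. by apply: measurable_funM; [exact: measurable_coord|exact: measurable_gauss]. Qed.

Lemma cintegrable_real (f : 'rV[R]_n -> R) :
  (lebn R n).-integrable setT (fun x => (f x)%:E) ->
  cintegrable (lebn R n) (fun x => (f x)%:C).
Proof. by move=> fi; split => //=; exact: integrable0. Qed.

(** Differentiating the phase gives -2 pi y_j and differentiating the Gaussian gives -2 pi x_j; by
    parts the two factors can be exchanged. *)
Lemma cabs_ft_coord_gauss (j : 'I_n) y :
  cabs (ft (fun x => (x 0 j * gauss 1 x)%:C) y) = `|y 0 j| * gauss 1 y.
Proof.
have [C1 [C10 gC1]] := gauss_le_jw n (n%:R + 1) (@ltr01 R).
have [C2 [C20 gC2]] := coord_gauss_le_jw (n%:R + 1) j (@ltr01 R).
have n1 : n%:R < n%:R + 1 :> R by rewrite ltrDl.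
have pi0 : 0 <= pi :> R by exact: pi_ge0.
pose v := ebasis R j.
have i1 : cintegrable (lebn R n) (fun x => (gauss 1 x)%:C).
  by apply: cintegrable_real; exact: integrable_gauss.
have i2 : cintegrable (lebn R n) (fun x => (x 0 j * gauss 1 x)%:C).
  apply: cintegrable_real; apply: integrable_dom_jw n1 _ gC2.
  exact: measurable_coord_gauss.
have dth : dirder v (fun x => - (2 * pi) * dotv x y) (fun=> - (2 * pi) * dotv v y).
  exact/dirderZ/dirder_dotv.
have vy : dotv v y = y 0 j by rewrite dotvC dotv_ebasis.
have p2 : 0 < 2 * pi :> R by rewrite mulr_gt0// pi_gt0.
pose c := 1 + 2 * pi + `|2 * pi * y 0 j|.
pose C := c * (C1 + C2).
have c1 : 1 <= c by rewrite /c -addrA lerDl addr_ge0// ltW.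
have cy : `|2 * pi * y 0 j| <= c by rewrite /c lerDr addr_ge0// ltW.
have c2 : 2 * pi <= c by rewrite /c -addrA addrCA lerDl addr_ge0.
have c0 : 0 <= c by exact: le_trans c1.
have CL (b c' t : R) : 0 <= b -> b <= c -> 0 <= c' -> c' <= C1 + C2 -> 0 <= t ->
    b * (c' * t) <= C * t.
  by move=> b0 bc c'0 c'C t0; rewrite mulrA ler_wpM2r// ler_pM.
have C1C : C1 <= C1 + C2 by rewrite lerDl ltW.
have C2C : C2 <= C1 + C2 by rewrite lerDr ltW.
have E := cabs_ibp (s := n%:R + 1) (C := C) n1 dth (dirder_gauss 1 v).
have {E} := E _ _ _ _ _ _ _.
have H1 x : `|gauss 1 x| <= C * jw (n%:R + 1) x.
  rewrite ger0_norm ?gauss_ge0//; apply: le_trans (gC1 x) _; rewrite -[leLHS]mul1r.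
  by rewrite CL ?jw_ge0// ltW.
have H2 x : `|- (2 * pi) * dotv v y * gauss 1 x| <= C * jw (n%:R + 1) x.
  rewrite vy normrM (ger0_norm (gauss_ge0 _ _)) mulNr normrN.
  apply: (@le_trans _ _ (`|2 * pi * y 0 j| * (C1 * jw (n%:R + 1) x))).
    by rewrite ler_wpM2l.
  by rewrite CL ?jw_ge0// ltW.
have H3 x : `|- (2 * 1 * pi * dotv x v) * gauss 1 x| <= C * jw (n%:R + 1) x.
  rewrite dotv_ebasis (_ : _ * gauss 1 x = - (2 * pi * (x 0 j * gauss 1 x))); last by ring.
  rewrite normrN normrM (ger0_norm (ltW p2)).
  apply: (@le_trans _ _ (2 * pi * (C2 * jw (n%:R + 1) x))).
    by rewrite ler_wpM2l// ltW.
  by rewrite CL ?jw_ge0// ltW.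
have mdot : measurable_fun setT (fun x => dotv x y).
  by apply: measurable_dotv => //; exact: measurable_cst.
have mdot' : measurable_fun setT (fun x => dotv x v).
  by apply: measurable_dotv => //; exact: measurable_cst.
move=> /(_ _ _ _ _ H1 H2 H3) E.
have {E} := E _ _ _ _.
rewrite (@eq_cint _ _ _ _ _ (fun x => (- (2 * pi * y 0 j))%:C * ((gauss 1 x)%:C * expi (- (2 * pi * dotv x y))))); last first.
  move=> x; rewrite vy (_ : - (2 * pi) * dotv x y = - (2 * pi * dotv x y)); last by rewrite mulNr.
  by rewrite rmorphM/= mulNr; ring.
rewrite cintZ; last exact: cintegrable_phase.
rewrite gauss_fourier -rmorphM/= cabs_real.
rewrite (@eq_cint _ _ _ _ _ (fun x => (- (2 * pi))%:C * ((x 0 j * gauss 1 x)%:C * expi (- (2 * pi * dotv x y))))); last first.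
  move=> x; rewrite dotv_ebasis (_ : - (2 * pi) * dotv x y = - (2 * pi * dotv x y)); last by rewrite mulNr.
  rewrite (_ : - (2 * 1 * pi * x 0 j) * gauss 1 x = - (2 * pi) * (x 0 j * gauss 1 x)); last by ring.
  by rewrite rmorphM/=; ring.
rewrite cintZ; last exact: cintegrable_phase.
rewrite cabsM cabs_real normrN (ger0_norm (ltW p2)) normrM normrN.
rewrite (ger0_norm (gauss_ge0 _ _)) normrM (ger0_norm (ltW p2)) => E.
apply/esym; apply: (mulfI (lt0r_neq0 p2)); rewrite mulrA; apply: E.
- exact: measurable_funM.
- exact: measurable_cst.
- exact: measurable_gauss.
- apply: measurable_funM; last exact: measurable_gauss.
  by apply: measurable_funN; exact: measurable_funM.
Qed.

End window.

(** * Decay of the transform of a product *)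

Section ft_decay.
Variables (R : realType) (n : nat).
Implicit Types (x y z w xi : 'rV[R]_n) (h A B : 'rV[R]_n -> R[i]).

Lemma jbr_le_sum y : jbr y <= 1 + \sum_j `|y 0 j|.
Proof.
have S0 : 0 <= \sum_j `|y 0 j| by apply: sumr_ge0.
rewrite -(@ler_pXn2r _ 2) ?nnegrE ?jbr_ge0 ?addr_ge0// sqr_jbr sqrrD expr1n mul1r.
suff : dotv y y <= (\sum_j `|y 0 j|) ^+ 2 by lra.
rewrite expr2 mulr_suml ler_sum// => i _.
rewrite -expr2 -(ger0_norm (sqr_ge0 (y 0 i))) normrX expr2 ler_wpM2l//.
by rewrite (bigD1 i)//= lerDl sumr_ge0.
Qed.

Lemma jw_jbr1 (s : R) y : jw (s + 1) y * jbr y = jw s y.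
Proof. by rewrite -jwM -mulrA -[X in _ * (_ * X)](powRr1 (jbr_ge0 y)) jw_jbr mulr1. Qed.

Lemma growth_gauss_le_jw (a s : R) (N : nat) xi : 0 < a -> 0 <= s -> exists C : R, 0 < C /\
  forall x, jbr x ^+ N * gauss a (x - xi) <= C * jw s x.
Proof.
move=> a0 s0; have [C [C0 gC]] := gauss_le_jw n (s + N%:R) a0.
exists (C * (2 `^ (s + N%:R) * jbr xi `^ (s + N%:R))); split.
  by rewrite mulr_gt0// mulr_gt0 ?powR_gt0 ?jbr_gt0.
move=> x; have sN : 0 <= s + N%:R by rewrite addr_ge0.
have := jw_peetre x (- xi) sN; rewrite jwN => h.
have {}h : jw (s + N%:R) (x - xi) <= 2 `^ (s + N%:R) * jw (s + N%:R) x * jbr xi `^ (s + N%:R).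
  rewrite -(ler_pM2r (jw_gt0 (s + N%:R) xi)); apply: le_trans h _.
  by rewrite -[leRHS]mulrA (mulrC (jbr _ `^ _)) jw_jbr mulr1.
apply: (@le_trans _ _ (jbr x ^+ N * (C * (2 `^ (s + N%:R) * jw (s + N%:R) x * jbr xi `^ (s + N%:R))))).
  rewrite ler_wpM2l ?exprn_ge0 ?jbr_ge0// (le_trans (gC _))//.
  by rewrite ler_wpM2l// ltW.
rewrite (_ : _ * (_ * _) = C * (2 `^ (s + N%:R) * jbr xi `^ (s + N%:R)) *
    (jw (s + N%:R) x * jbr x ^+ N)); last by ring.
suff -> : jw (s + N%:R) x * jbr x ^+ N = jw s x by [].
by rewrite -jwM -mulrA -powR_mulrn ?jbr_ge0// jw_jbr mulr1.
Qed.

Lemma integrable_ae_jw h (K s : R) : n%:R < s -> cmeas h ->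
  {ae lebn R n, forall w, cabs (h w) <= K * jw s w} ->
  (lebn R n).-integrable setT (fun w => (cabs (h w))%:E).
Proof.
move=> ns mh hK; have mc : measurable_fun setT (fun w => (cabs (h w))%:E).
  exact/measurable_EFinP/measurable_cabs.
have iK := integrableZl measurableT K (integrable_jw ns).
apply/integrableP; split => //.
have /integrableP[mK] := iK; apply: le_lt_trans.
apply: ae_ge0_le_integral => //.
- exact: measurableT_comp.
- exact: measurableT_comp.
apply: filterS hK => w hK _ /=; rewrite lee_fin ger0_norm ?cabs_ge0//.
by rewrite (le_trans hK)// ler_norm.
Qed.

(** Convolving decay [s] with decay [al <= s] keeps decay [al]. The roles differ: [A] carries the
    bound known almost everywhere only, [B] the pointwise bound being improved. [CA] is not in the
    conclusion, so it may depend on anything. *)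
Lemma cabs_ft_mul_le_jw A B (K M s al CA : R) y : n%:R < s -> 0 <= al <= s ->
  0 <= K -> 0 <= M ->
  ccont A -> cintegrable (lebn R n) A -> (forall x, cabs (A x) <= CA) ->
  cintegrable (lebn R n) B ->
  {ae lebn R n, forall w, cabs (ft A w) <= K * jw s w} ->
  (forall w, cabs (ft B w) <= M * jw al w) ->
  cabs (ft (fun x => A x * B x) y) <=
    K * M * (2 `^ al * 3 * (\int[lebn R n]_z jw s z)%R) * jw al y.
Proof.
move=> ns als K0 M0 cA iA ACA iB AK BM.
have mftA := cmeas_ft (ccont_cmeas cA).
have iftA := integrable_ae_jw ns mftA AK.
rewrite -lee_fin; apply: le_trans (cabs_ft_mul cA iA ACA iB iftA y) _.
have mjy : measurable_fun setT (fun z => jw al (y - z)).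
  apply: (measurableT_comp (measurable_jw al)).
  by apply: measurable_rVB => //; exact: measurable_cst.
have mj : measurable_fun setT (fun z => jw s z * jw al (y - z)).
  by apply: measurable_funM => //; exact: measurable_jw.
apply: (@le_trans _ _ (\int[lebn R n]_w ((K * M)%:E * (jw s w * jw al (y - w))%:E))%E).
  apply: ae_ge0_le_integral => //.
  - by move=> w _; rewrite lee_fin mulr_ge0 ?cabs_ge0.
  - apply/measurable_EFinP/measurable_funM; first exact: measurable_cabs.
    apply: measurable_cabs; apply: (cmeas_comp (cmeas_ft (cintegrable_meas iB))).
    by apply: measurable_rVB => //; exact: measurable_cst.
  - by move=> w _; rewrite -EFinM lee_fin !mulr_ge0 ?jw_ge0.
  - by apply: measurable_funeM; exact/measurable_EFinP.
  apply: filterS AK => w AK _; rewrite -EFinM lee_fin.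
  by rewrite mulrACA ler_pM ?cabs_ge0.
rewrite ge0_integralZl//; last 3 first.
- exact/measurable_EFinP.
- by move=> w _; rewrite lee_fin mulr_ge0 ?jw_ge0.
- by rewrite lee_fin mulr_ge0.
rewrite -[leRHS](_ : ((K * M)%:E * (2 `^ al * 3 * (\int[lebn R n]_z jw s z)%R * jw al y)%:E)%E = _); last first.
  by rewrite -EFinM; congr EFin; ring.
by rewrite lee_wpmul2l ?lee_fin ?mulr_ge0// jw_convolution.
Qed.

End ft_decay.

(** * Decay of the short-time Fourier transform of the multiplier *)

Section bootstrap.
Variables (R : realType) (n : nat) (mu : 'rV[R]_n -> R) (dmu : 'I_n -> 'rV[R]_n -> R).
Implicit Types (x y z w xi : 'rV[R]_n).
Hypotheses (cmu : continuous mu) (cdmu : forall j, continuous (dmu j)).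
Hypothesis dmuE : forall j, dirder (ebasis R j) mu (dmu j).
Hypothesis growth : forall j, exists (C : R) (N : nat), forall x, `|dmu j x| <= C * jbr x ^+ N.

(** The short-time Fourier transform with the [a]-th power of the Gaussian as window; the power is
    variable because each step of the bootstrap uses up one factor. *)
Definition vst (a : R) (h : 'rV[R]_n -> R[i]) xi y := ft (fun x => h x * (gauss a (x - xi))%:C) y.

Let m x := expi (mu x).

Let mm : cmeas m. Proof. by apply: cmeas_expi; exact: continuous_measurable_rV. Qed.
Let mdmu j : measurable_fun setT (dmu j). Proof. exact: continuous_measurable_rV. Qed.

Lemma measurable_gauss_sub (a : R) xi : measurable_fun setT (fun x : 'rV[R]_n => gauss a (x - xi)).
Proof. exact: (measurableT_comp (@measurable_gauss R n a) (measurable_subv xi)). Qed.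

Lemma integrable_gauss_sub (a : R) xi : 0 < a ->
  (lebn R n).-integrable setT (fun x => (gauss a (x - xi))%:E).
Proof. by move=> a0; exact: (integrable_lebn_shift (- xi) (integrable_gauss n a0)). Qed.

Lemma cintegrable_window (h : 'rV[R]_n -> R[i]) (a : R) xi : 0 < a -> cmeas h ->
  (forall x, cabs (h x) <= 1) ->
  cintegrable (lebn R n) (fun x => h x * (gauss a (x - xi))%:C).
Proof.
move=> a0 mh h1; apply: (cintegrable_dom _ (integrable_gauss_sub xi a0)).
  by apply: cmeasM => //; apply: cmeas_real; exact: measurable_gauss_sub.
move=> x; rewrite cabsMr (ger0_norm (gauss_ge0 _ _)).
by rewrite ler_piMl ?gauss_ge0.
Qed.

Lemma continuous_sub_comp (f : 'rV[R]_n -> R) xi : continuous f ->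
  continuous (fun x => f (x - xi)).
Proof.
move=> cf x; apply: (@continuous_comp _ _ _ (fun x => x - xi) f); last exact: cf.
exact: (cvgB (@cvg_id _ (nbhs x)) (cvg_cst xi)).
Qed.

Lemma ccont_real (f : 'rV[R]_n -> R) : continuous f -> ccont (fun x => (f x)%:C).
Proof. by move=> cf; split => //=; exact: cst_continuous. Qed.

Let A1 j xi x : R[i] := (dmu j x)%:C * (gauss 1 (x - xi))%:C.
Let A2 j xi x : R[i] := ((x - xi) 0 j * gauss 1 (x - xi))%:C.
Let A3 xi x : R[i] := (gauss 1 (x - xi))%:C.

Let n1 : n%:R < n%:R + 1 :> R. Proof. by rewrite ltrDl. Qed.
Let n10 : 0 <= n%:R + 1 :> R. Proof. by rewrite addr_ge0. Qed.

Lemma ccont_dmu_window j xi : ccont (A1 j xi).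
Proof.
rewrite (_ : A1 j xi = fun x => (dmu j x * gauss 1 (x - xi))%:C); last first.
  by apply/funext => x; rewrite /A1 rmorphM.
apply: ccont_real => x.
have cg : continuous (fun x : 'rV[R]_n => gauss 1 (x - xi)).
  exact: (continuous_sub_comp (@gauss_continuous R n 1)).
exact: (cvgM (@cdmu j x) (@cg x)).
Qed.

(** Here the polynomial growth of the derivatives enters. The constant depends on [xi], which is
    harmless: such bounds only ensure integrability and never reach the estimates. *)
Lemma dmu_gauss_le (a s : R) j xi : 0 < a -> 0 <= s -> exists C : R, 0 < C /\
  forall x, `|dmu j x * gauss a (x - xi)| <= C * jw s x.
Proof.
move=> a0 s0; have [C [N dC]] := growth j.
have [D [D0 gD]] := growth_gauss_le_jw N xi a0 s0.
exists ((1 + `|C|) * D); split; first by rewrite mulr_gt0// ltr_pwDl.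
move=> x; rewrite normrM (ger0_norm (gauss_ge0 _ _)).
apply: (@le_trans _ _ ((1 + `|C|) * (jbr x ^+ N * gauss a (x - xi)))).
  rewrite mulrA ler_wpM2r ?gauss_ge0// (le_trans (dC x))//.
  rewrite ler_wpM2r ?exprn_ge0 ?jbr_ge0// (le_trans (ler_norm C))//.
  by rewrite lerDr.
by rewrite -mulrA ler_wpM2l// addr_ge0.
Qed.

Lemma cintegrable_dmu_window j xi : cintegrable (lebn R n) (A1 j xi).
Proof.
have [C [C0 dC]] := dmu_gauss_le j xi (@ltr01 R) n10.
apply: (cintegrable_dom_jw (C := C) n1); first exact: ccont_cmeas (ccont_dmu_window j xi).
by move=> x; rewrite /A1 -rmorphM/= cabs_real.
Qed.

(* The factor [2 pi i y j] is moved onto [m g^(a+1)] by parts, and both resulting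
   terms, as well as [m g^(a+1)] itself, are products of [m g^a] with a function
   whose Fourier transform decays like [jw s]. *)
Lemma bootstrap_step (s M : R) (al a Ma : R) : n%:R < s -> 0 <= M -> 0 <= al <= s ->
  0 < a -> 0 <= Ma -> exists M', 0 <= M' /\ forall xi,
  (forall j, {ae lebn R n, forall w, cabs (vst 1 (fun x => (dmu j x)%:C) xi w) <= M * jw s w}) ->
  (forall y, cabs (vst a m xi y) <= Ma * jw al y) ->
  forall y, cabs (vst (a + 1) m xi y) <= M' * jw (al + 1) y.
Proof.
move=> ns M0 als a0 Ma0.
have s0 : 0 <= s by apply: ltW; apply: le_lt_trans ns.
(* The constant of [jw_convolution]. *)
pose c0 := 2 `^ al * 3 * (\int[lebn R n]_z jw s z)%R.
have c00 : 0 <= c0.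
  by rewrite !mulr_ge0 ?powR_ge0// Rintegral_ge0// => x _; exact: jw_ge0.
have [K3 [K30 g3]] := gauss_le_jw n s (@ltr01 R).
have [K2 [K20 g2]] : exists K : R, 0 <= K /\ forall (j : 'I_n) w, `|w 0 j| * gauss 1 w <= K * jw s w.
  have [K [K0 gK]] := gauss_le_jw n (s + 1) (@ltr01 R).
  exists K; split; first exact: ltW.
  move=> j w; rewrite -jw_jbr1.
  apply: (@le_trans _ _ (jbr w * (K * jw (s + 1) w))).
    by rewrite ler_pM ?gauss_ge0// coord_le_jbr.
  by rewrite le_eqVlt; apply/orP; left; apply/eqP; ring.
have p2 : 0 < 2 * pi :> R by rewrite mulr_gt0// pi_gt0.
have a10 : 0 < a + 1 by rewrite addr_gt0.
(* Bounds 2 pi |y_j| |V|, up to the weight: the first term comes from the derivative of mu, the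
   second from the derivative of the window g^(a+1). *)
pose E := M * Ma * c0 + 2 * (a + 1) * pi * (K2 * Ma * c0).
have E0 : 0 <= E.
  have a1p := ltW a10; have pip := @pi_ge0 R.
  by apply: addr_ge0; do ?[apply: mulr_ge0 => //].
have K3c : 0 <= K3 by exact: ltW.
have p2c : 0 <= (2 * pi)^-1 :> R by rewrite invr_ge0 ltW.
exists (K3 * Ma * c0 + n%:R * ((2 * pi)^-1 * E)); split.
  by apply: addr_ge0; do ?[apply: mulr_ge0 => //].
move=> xi Hxi Hm y.
pose G x := gauss (a + 1) (x - xi).
pose B x := m x * (gauss a (x - xi))%:C.
have m1 x : cabs (m x) <= 1 by rewrite cabs_expi.
have iB : cintegrable (lebn R n) B by exact: cintegrable_window.
have igauss : cintegrable (lebn R n) (fun x : 'rV[R]_n => (gauss 1 x)%:C).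
  by apply: cintegrable_real; exact: integrable_gauss.
have GE x : (G x)%:C = (gauss 1 (x - xi))%:C * (gauss a (x - xi))%:C.
  by rewrite -rmorphM/= gaussM addrC.
set V := vst (a + 1) m xi y.
have ftA3 w : cabs (ft (A3 xi) w) = gauss 1 w.
  rewrite (cabs_ft_shift xi w igauss) /ft gauss_fourier cabs_real.
  by rewrite ger0_norm ?gauss_ge0.
have V0 : cabs V <= K3 * Ma * c0 * jw al y.
  have -> : V = ft (fun x => A3 xi x * B x) y.
    by apply: eq_cint => x; rewrite -/(G x) GE /A3 /B; ring.
  apply: (cabs_ft_mul_le_jw (s := s) (CA := 1)) => //.
  - by apply: ccont_real; apply: continuous_sub_comp; exact: gauss_continuous.
  - by apply: cintegrable_real; exact: integrable_gauss_sub.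
  - by move=> x; rewrite cabs_real ger0_norm ?gauss_ge0// gauss_le1.
  - by apply: aeW => w; rewrite ftA3.
have T1 j : cabs (ft (fun x => A1 j xi x * B x) y) <= M * Ma * c0 * jw al y.
  have [C [C0 dC]] := dmu_gauss_le j xi (@ltr01 R) (lexx 0).
  apply: (cabs_ft_mul_le_jw (s := s) (CA := C)) => //.
  - exact: ccont_dmu_window.
  - exact: cintegrable_dmu_window.
  - move=> x; rewrite /A1 -rmorphM/= cabs_real (le_trans (dC x))//.
    by rewrite ler_piMr ?(ltW C0)// jw_le1.
  - exact: Hxi.
have T2 j : cabs (ft (fun x => A2 j xi x * B x) y) <= K2 * Ma * c0 * jw al y.
  have [C [C0 dC]] := coord_gauss_le_jw (n%:R + 1) j (@ltr01 R).
  have ic : cintegrable (lebn R n) (fun x : 'rV[R]_n => (x 0 j * gauss 1 x)%:C).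
    apply: cintegrable_real; apply: (integrable_dom_jw n1 _ dC).
    exact: measurable_coord_gauss.
  apply: (cabs_ft_mul_le_jw (s := s) (CA := C)) => //.
  - apply: ccont_real; apply: (continuous_sub_comp (f := fun x => x 0 j * gauss 1 x)) => x.
    exact: (cvgM (@coord_continuous _ _ _ 0 j x) (@gauss_continuous R n 1 x)).
  - rewrite /A2; case: ic => ic _; split => /=; last exact: integrable0.
    exact: (integrable_lebn_shift (- xi) ic).
  - move=> x; rewrite cabs_real (le_trans (dC _))//.
    by rewrite ler_piMr ?(ltW C0)// jw_le1.
  - apply: aeW => w.
    by rewrite (cabs_ft_shift xi w ic) cabs_ft_coord_gauss.
have Vj j : 2 * pi * `|y 0 j| * cabs V <= E * jw al y.
  pose v := ebasis R j.
  (* The phase of m times the Fourier character; the term -2 pi y_j of its derivative carries the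
     factor to be gained. *)
  pose th x := mu x + (- (2 * pi)) * dotv x y.
  pose dth x := dmu j x + (- (2 * pi)) * dotv v y.
  pose dG x := - (2 * (a + 1) * pi * dotv (x - xi) v) * G x.
  have dthP : dirder v th dth.
    exact: (dirderD (dmuE j) (dirderZ (- (2 * pi)) (dirder_dotv v y))).
  have dGP : dirder v G dG.
    exact: (dirder_shift xi (dirder_gauss (a + 1) v)).
  have mG : measurable_fun setT G by exact: measurable_gauss_sub.
  have mdot : measurable_fun setT (fun x => dotv x y).
    by apply: measurable_dotv => //; exact: measurable_cst.
  have mth : measurable_fun setT th.
    apply: measurable_funD; first exact: continuous_measurable_rV.
    exact: measurable_funM.
  have mdth : measurable_fun setT dth by apply: measurable_funD.
  have mdG : measurable_fun setT dG.
    apply: measurable_funM => //; apply: measurable_funN; apply: measurable_funM => //.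
    by apply: measurable_dotv; [exact: measurable_subv|exact: measurable_cst].
  have [C1 [C10 g1]] := growth_gauss_le_jw 0 xi a10 n10.
  have [C2 [C20 d2]] := dmu_gauss_le j xi a10 n10.
  have [C3 [C30 d3]] := growth_gauss_le_jw 1 xi a10 n10.
  (* These constants depend on [xi] and [y], but [cabs_ibp] is an equality in which they
     disappear. *)
  pose c1 := 1 + `|2 * pi * y 0 j| + 2 * (a + 1) * pi * (2 * jbr xi).
  have c2 : 0 <= 2 * (a + 1) * pi * (2 * jbr xi).
    by rewrite !mulr_ge0 ?pi_ge0 ?jbr_ge0// ltW.
  pose C := c1 * (C1 + C2 + C3).
  have vy : dotv v y = y 0 j by rewrite dotvC dotv_ebasis.
  have C1p := ltW C10; have C2p := ltW C20; have C3p := ltW C30.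
  have yp := normr_ge0 (2 * pi * y 0 j).
  have GC1 x : G x <= C1 * jw (n%:R + 1) x by have := g1 x; rewrite expr0 mul1r.
  have GC x : `|G x| <= C * jw (n%:R + 1) x.
    rewrite (ger0_norm (gauss_ge0 (a + 1) (x - xi))); apply: le_trans (GC1 x) _.
    by rewrite ler_wpM2r ?jw_ge0// /C /c1; nra.
  have thGC x : `|dth x * G x| <= C * jw (n%:R + 1) x.
    rewrite /dth vy mulrDl; apply: le_trans (ler_normD _ _) _.
    apply: (@le_trans _ _ (C2 * jw (n%:R + 1) x + `|2 * pi * y 0 j| * (C1 * jw (n%:R + 1) x))).
      apply: lerD; first exact: d2.
      rewrite mulNr mulNr normrN normrM (ger0_norm (gauss_ge0 (a + 1) (x - xi))).
      by apply: ler_wpM2l; [exact: normr_ge0|exact: GC1].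
    rewrite mulrA -mulrDl ler_wpM2r ?jw_ge0// /C /c1.
    by nra.
  have dGC x : `|dG x| <= C * jw (n%:R + 1) x.
    rewrite /dG dotv_ebasis normrM normrN (ger0_norm (gauss_ge0 _ _)).
    rewrite normrM (ger0_norm (_ : 0 <= 2 * (a + 1) * pi)) ?mulr_ge0 ?pi_ge0 ?(ltW a10)//.
    have h : `|(x - xi) 0 j| <= 2 * jbr xi * jbr x.
      apply: le_trans (coord_le_jbr _ _) _; rewrite -mulrA (mulrC (jbr xi)).
      by rewrite -(jbrN xi) jbrD_mul.
    apply: (@le_trans _ _ (2 * (a + 1) * pi * (2 * jbr xi) * (C3 * jw (n%:R + 1) x))).
      apply: (@le_trans _ _ (2 * (a + 1) * pi * (2 * jbr xi) * (jbr x ^+ 1 * G x))).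
        rewrite expr1 -!mulrA ler_wpM2l// ler_wpM2l ?(ltW a10)// ler_wpM2l ?pi_ge0//.
        by rewrite !mulrA ler_wpM2r ?gauss_ge0.
      by rewrite ler_wpM2l// d3.
    rewrite mulrA ler_wpM2r ?jw_ge0// /C /c1.
    by nra.
  have ibp := cabs_ibp n1 dthP dGP mth mdth mG mdG GC thGC dGC.
  have iAB1 : cintegrable (lebn R n) (fun x => A1 j xi x * B x).
    have [D [D0 dD]] := dmu_gauss_le j xi (@ltr01 R) (lexx 0).
    apply: (cintegrable_dom (g := fun x => D * cabs (B x))).
    - by apply: cmeasM; [exact: ccont_cmeas (ccont_dmu_window j xi)|exact: cintegrable_meas iB].
    - exact: (integrableZl measurableT D (cintegrable_cabs iB)).
    - move=> x; rewrite cabsM ler_wpM2r ?cabs_ge0// /A1 -rmorphM/= cabs_real.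
      by rewrite (le_trans (dD x))// ler_piMr ?(ltW D0)// jw_le1.
  have iG : cintegrable (lebn R n) (fun x => m x * (G x)%:C) by exact: cintegrable_window.
  have iAB2 : cintegrable (lebn R n) (fun x => A2 j xi x * B x).
    have [D [D0 dD]] := coord_gauss_le_jw 0 j (@ltr01 R).
    apply: (cintegrable_dom (g := fun x => D * cabs (B x))).
    - apply: cmeasM; last exact: cintegrable_meas iB.
      apply: cmeas_real; apply: (measurableT_comp (measurable_coord_gauss 1 j)).
      exact: measurable_subv.
    - exact: (integrableZl measurableT D (cintegrable_cabs iB)).
    - move=> x; rewrite cabsM ler_wpM2r ?cabs_ge0// cabs_real.
      by rewrite (le_trans (dD _))// ler_piMr ?(ltW D0)// jw_le1.
  have phE x : expi (th x) = m x * expi (- (2 * pi * dotv x y)).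
    by rewrite -expiD /th mulNr.
  have EU : cint (lebn R n) (fun x => expi (th x) * (dth x * G x)%:C) =
      ft (fun x => A1 j xi x * B x) y + (- (2 * pi * y 0 j))%:C * V.
    rewrite /V /vst /ft -(cintZ _ (cintegrable_phase y iG)).
    rewrite -cintD; last 2 first.
    - exact: cintegrable_phase.
    - by apply: cintegrableZ; exact: cintegrable_phase.
    apply: eq_cint => x; rewrite phE /dth vy.
    rewrite (_ : (_ * G x)%:C = (dmu j x)%:C * (G x)%:C + (- (2 * pi * y 0 j))%:C * (G x)%:C); last first.
      by rewrite -!rmorphM -rmorphD; congr (_%:C); ring.
    by rewrite GE /A1 /B; ring.
  have EW : cint (lebn R n) (fun x => expi (th x) * (dG x)%:C) =
      (- (2 * (a + 1) * pi))%:C * ft (fun x => A2 j xi x * B x) y.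
    rewrite /ft -(cintZ _ (cintegrable_phase y iAB2)).
    apply: eq_cint => x; rewrite phE /dG dotv_ebasis.
    rewrite (_ : (_ * G x)%:C = (- (2 * (a + 1) * pi))%:C * ((x - xi) 0 j)%:C * (G x)%:C); last first.
      by rewrite -!rmorphM; congr (_%:C); ring.
    by rewrite GE /A2 /B rmorphM/=; ring.
  rewrite [leLHS](_ : _ = cabs ((2 * pi * y 0 j)%:C * V)); last first.
    by rewrite cabsM cabs_real normrM (gtr0_norm p2).
  have -> : (2 * pi * y 0 j)%:C * V = ft (fun x => A1 j xi x * B x) y +
      - 1 * cint (lebn R n) (fun x => expi (th x) * (dth x * G x)%:C).
    by rewrite EU rmorphN/=; ring.
  apply: le_trans (cabsD _ _) _; rewrite /E mulrDl lerD//.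
  rewrite cabsM (_ : cabs (- 1) = 1) ?mul1r; last first.
    by rewrite -[-1](rmorphN1 (real_complex R)) cabs_real normrN1.
  rewrite ibp EW cabsM cabs_real normrN ger0_norm; last first.
    by rewrite !mulr_ge0 ?pi_ge0// ltW.
  by rewrite -[leRHS]mulrA ler_wpM2l// !mulr_ge0 ?pi_ge0// ltW.
(* The bounds on V and on all y_j V combine through <y> <= 1 + sum |y_j|. *)
rewrite -(ler_pM2r (jbr_gt0 y)) -[leRHS]mulrA jw_jbr1.
apply: (@le_trans _ _ (cabs V + \sum_j `|y 0 j| * cabs V)).
  rewrite -mulr_suml mulrC -[X in X + _]mul1r -mulrDl.
  by rewrite ler_wpM2r ?cabs_ge0// jbr_le_sum.
rewrite mulrDl lerD//.
apply: (@le_trans _ _ (\sum_(j < n) (2 * pi)^-1 * E * jw al y)).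
  apply: ler_sum => j _.
  by rewrite -mulrA ler_pdivlMl// mulrA.
by rewrite sumr_const card_ord -[leLHS]mulr_natl mulrA.
Qed.

End bootstrap.

Section bootstrap_iteration.
Variables (R : realType) (n : nat) (mu : 'rV[R]_n -> R) (dmu : 'I_n -> 'rV[R]_n -> R).
Implicit Types (x y z w xi : 'rV[R]_n).
Hypotheses (cmu : continuous mu) (cdmu : forall j, continuous (dmu j)).
Hypothesis dmuE : forall j, dirder (ebasis R j) mu (dmu j).
Hypothesis growth : forall j, exists (C : R) (N : nat), forall x, `|dmu j x| <= C * jbr x ^+ N.

Let m x := expi (mu x).

Lemma cabs_vst1_le1 xi y : cabs (vst 1 m xi y) <= 1.
Proof.
have mm : cmeas m by apply: cmeas_expi; exact: continuous_measurable_rV.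
apply: le_trans (cabs_cint_le _ (integrable_gauss_sub xi (@ltr01 R)) _) _.
- apply: cmeasM; last by apply: cmeas_phaseN => //; exact: measurable_cst.
  by apply: cmeasM => //; apply: cmeas_real; exact: measurable_gauss_sub.
- move=> x; rewrite mulrC cabs_expiM cabs_expiM cabs_real.
  by rewrite ger0_norm ?gauss_ge0.
- by rewrite (Rintegral_lebn_shift (- xi) (integrable_gauss n ltr01)) Rintegral_gauss1.
Qed.

(** The decay hypothesis at one [xi]. The bootstrap runs at fixed [xi], so the exceptional null set
    is discarded once and not at every step. *)
Let good (s M : R) xi := forall j,
  {ae lebn R n, forall w, cabs (vst 1 (fun x => (dmu j x)%:C) xi w) <= M * jw s w}.

(** The start is the trivial bound by the mass of the window, without decay. The exponent is capped
    at [s], since a product cannot decay faster than the transform of the derivatives of mu. *)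
Lemma bootstrap_iter (s M : R) : n%:R < s -> 0 <= M -> forall k, exists Mk, 0 <= Mk /\
  forall xi, good s M xi -> forall y, cabs (vst k.+1%:R m xi y) <= Mk * jw (Num.min k%:R s) y.
Proof.
move=> ns M0; have s0 : 0 <= s by apply: ltW; apply: le_lt_trans ns.
elim=> [|k [Mk [Mk0 IH]]].
  exists 1; split => // xi _ y; rewrite mul1r (min_l s0) /jw oppr0 powRr0.
  exact: cabs_vst1_le1.
have als : 0 <= Num.min k%:R s <= s by rewrite le_min ler0n s0 ge_min lexx orbT.
have k0 : 0 < k.+1%:R :> R by rewrite ltr0n.
have [M' [M'0 step]] := bootstrap_step cmu cdmu dmuE growth ns M0 als k0 Mk0.
exists M'; split => // xi gxi y; rewrite -natr1.
apply: le_trans (step xi gxi (IH xi gxi) y) _; rewrite ler_wpM2l//.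
apply: ler_jw; rewrite -natr1 ge_min /Num.min.
by case: ifPn => _; rewrite ?lexx// lerDl ler01 orbT.
Qed.

Lemma bootstrap (s M : R) : n%:R < s -> 0 <= M -> exists b M', 0 < b /\ 0 <= M' /\
  forall xi, good s M xi -> forall y, cabs (vst b m xi y) <= M' * jw s y.
Proof.
move=> ns M0; have s0 : 0 <= s by apply: ltW; apply: le_lt_trans ns.
have [M' [M'0 H]] := bootstrap_iter ns M0 (Num.bound s).
(* After [Num.bound s] steps the minimum equals [s]; the window power is one more than the number of
   steps. *)
exists (Num.bound s).+1%:R, M'; split; first by rewrite ltr0n.
split => // xi gxi y; have := H xi gxi y.
by rewrite (min_r (ltW (archi_boundP s0))).
Qed.

End bootstrap_iteration.

Lemma cint_lebn_opp (R : realType) n (h : 'rV[R]_n -> R[i]) :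
  cintegrable (lebn R n) h -> cint (lebn R n) (fun x => h (- x)) = cint (lebn R n) h.
Proof.
move=> [hr hi]; apply: complex_ext => /=.
  exact: (Rintegral_lebn_opp hr).
exact: (Rintegral_lebn_opp hi).
Qed.

Lemma tonelli_swap d1 d2 (T1 : measurableType d1) (T2 : measurableType d2) (R : realType)
    (m1 : {sigma_finite_measure set T1 -> \bar R})
    (m2 : {sigma_finite_measure set T2 -> \bar R}) (F : T1 -> T2 -> \bar R) :
  measurable_fun setT (fun p : T1 * T2 => F p.1 p.2) ->
  (forall x y, (0 <= F x y)%E) ->
  (\int[m1]_x \int[m2]_y F x y = \int[m2]_y \int[m1]_x F x y)%E.
Proof. by move=> mF F0; exact: (fubini_tonelli (fun p => F p.1 p.2) mF (fun p => F0 p.1 p.2)). Qed.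

(** * Identities for the short-time Fourier transform *)

Section short_time_identities.
Variables (R : realType) (n : nat).
Implicit Types (f h m : 'rV[R]_n -> R[i]) (x y z w t xi eta : 'rV[R]_n).

Lemma cint_swap (F : 'rV[R]_n -> 'rV[R]_n -> R[i]) (a b : 'rV[R]_n -> R) :
  cmeas (fun p : 'rV[R]_n * 'rV[R]_n => F p.1 p.2) ->
  (lebn R n).-integrable setT (fun x => (a x)%:E) ->
  (lebn R n).-integrable setT (fun y => (b y)%:E) ->
  (forall x y, cabs (F x y) <= a x * b y) ->
  cint (lebn R n) (fun x => cint (lebn R n) (F x)) =
  cint (lebn R n) (fun y => cint (lebn R n) (F ^~ y)).
Proof. by move=> mF ia ib Fab; apply: cint_Fubini => //; exact: integral2_prod_lty ia ib Fab. Qed.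

Lemma cintegrable_gauss_sub (a : R) xi : 0 < a ->
  cintegrable (lebn R n) (fun x => (gauss a (x - xi))%:C).
Proof. by move=> a0; apply: cintegrable_real; exact: integrable_gauss_sub. Qed.

Lemma ft_gauss_sub x eta :
  ft (fun w => (gauss 1 (w - x))%:C) eta = expi (- (2 * pi * dotv x eta)) * (gauss 1 eta)%:C.
Proof.
rewrite (ft_shift x eta (h := fun w => (gauss 1 w)%:C)) /ft ?gauss_fourier//.
by apply: cintegrable_real; exact: integrable_gauss.
Qed.

Lemma cintegrable_mul_gauss f (a : R) xi : cintegrable (lebn R n) f -> 0 <= a ->
  cintegrable (lebn R n) (fun x => f x * (gauss a (x - xi))%:C).
Proof.
move=> fi a0; apply: (cintegrable_dom _ (cintegrable_cabs fi)).
  apply: cmeasM; first exact: cintegrable_meas fi.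
  by apply: cmeas_real; exact: measurable_gauss_sub.
move=> x; rewrite cabsMr ler_piMr ?cabs_ge0// ger0_norm ?gauss_ge0//.
exact: gauss_le1.
Qed.

Lemma cintegrable_bounded_gauss h (B a : R) xi : cmeas h -> (forall x, cabs (h x) <= B) ->
  0 < a -> cintegrable (lebn R n) (fun x => h x * (gauss a (x - xi))%:C).
Proof.
move=> mh hB a0.
apply: (cintegrable_dom _ (integrableZl measurableT B (integrable_gauss_sub xi a0))).
  by apply: cmeasM => //; apply: cmeas_real; exact: measurable_gauss_sub.
by move=> x; rewrite cabsMr (ger0_norm (gauss_ge0 _ _)) ler_wpM2r ?gauss_ge0.
Qed.

Lemma cmeas_vst d (T : measurableType d) h (a : R) (u v : T -> 'rV[R]_n) : cmeas h ->
  measurable_fun setT u -> measurable_fun setT v ->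
  cmeas (fun p => vst a h (u p) (v p)).
Proof.
move=> mh mu mv.
pose F p x := h x * (gauss a (x - u p))%:C * expi (- (2 * pi * dotv x (v p))).
suff mF : cmeas (fun q : T * 'rV[R]_n => F q.1 q.2) by exact: (cmeas_cint2 _ mF).
have mu1 : measurable_fun setT (fun q : T * 'rV[R]_n => u q.1).
  exact: measurableT_comp mu measurable_fst.
have mv1 : measurable_fun setT (fun q : T * 'rV[R]_n => v q.1).
  exact: measurableT_comp mv measurable_fst.
apply: cmeasM; last by apply: cmeas_phaseN => //; exact: measurable_snd.
apply: cmeasM; first exact: cmeas_snd.
apply: cmeas_real; apply: (measurableT_comp (@measurable_gauss R n a)).
by apply: measurable_rVB => //; exact: measurable_snd.
Qed.

Lemma cmeas_gauss_sub2 d (T : measurableType d) (a : R) (u v : T -> 'rV[R]_n) :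
  measurable_fun setT u -> measurable_fun setT v ->
  cmeas (fun p => (gauss a (u p - v p))%:C).
Proof.
move=> mu mv; apply: cmeas_real; apply: (measurableT_comp (@measurable_gauss R n a)).
exact: measurable_rVB.
Qed.

Lemma stft_vst h (B : R) x xi : cmeas h -> (forall y, cabs (h y) <= B) ->
  stft h x xi = vst 1 h x xi.
Proof.
move=> mh hB; have -> : stft h x xi =
    cintRn (fun y => h y * (gauss 1 (y - x))%:C * expi (- (2 * pi * dotv y xi))).
  by rewrite /stft; under [in LHS]eq_fun do rewrite gwin_gauss.
exact: (cintRnE (cintegrable_phase xi (cintegrable_bounded_gauss x mh hB ltr01))).
Qed.

(** The Fourier transform rotates the time-frequency plane by a right angle. The window is unchanged
    because the Gaussian is its own transform. *)
Lemma vst1_ft f xi y : cintegrable (lebn R n) f ->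
  vst 1 (ft f) xi y = expi (- (2 * pi * dotv xi y)) * vst 1 f (- y) xi.
Proof.
move=> fi; have mf := cintegrable_meas fi.
pose F eta z := (gauss 1 (eta - xi))%:C * expi (- (2 * pi * dotv eta y)) *
  (f z * expi (- (2 * pi * dotv z eta))).
transitivity (cint (lebn R n) (fun eta => cint (lebn R n) (F eta))).
  by apply: eq_cint => eta; rewrite (cintZ _ (cintegrable_phase eta fi)) -/(ft f eta); ring.
rewrite (cint_swap (a := fun eta => gauss 1 (eta - xi)) (b := fun z => cabs (f z))); last 4 first.
- apply: cmeasM; apply: cmeasM.
  + by apply: cmeas_gauss_sub2; [exact: measurable_fst|exact: measurable_cst].
  + by apply: cmeas_phaseN; [exact: measurable_fst|exact: measurable_cst].
  + exact: cmeas_snd.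
  + by apply: cmeas_phaseN; [exact: measurable_snd|exact: measurable_fst].
- by apply: integrable_gauss_sub; exact: ltr01.
- exact: cintegrable_cabs.
- by move=> eta z; rewrite !cabsM !cabs_expi !mulr1 cabs_real ger0_norm ?gauss_ge0.
rewrite {1}/vst /ft -(cintZ _ (cintegrable_phase xi (cintegrable_mul_gauss (- y) fi ler01))).
apply: eq_cint => z.
transitivity (f z * ft (fun w => (gauss 1 (w - xi))%:C) (y + z)).
  rewrite /ft -(cintZ _ (cintegrable_phase (y + z) (cintegrable_gauss_sub xi ltr01))).
  apply: eq_cint => eta; rewrite /F.
  rewrite (_ : - (2 * pi * dotv eta (y + z)) =
    - (2 * pi * dotv eta y) + - (2 * pi * dotv z eta)); last by rewrite dotvDr (dotvC z); ring.
  by rewrite expiD; ring.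
rewrite ft_gauss_sub opprK (addrC z).
rewrite (_ : - (2 * pi * dotv xi (y + z)) =
    - (2 * pi * dotv xi y) + - (2 * pi * dotv z xi)); last by rewrite dotvDr (dotvC z); ring.
by rewrite expiD; ring.
Qed.

Lemma cabs_ft_bound f : cintegrable (lebn R n) f -> exists B : R, 0 <= B /\
  forall y, cabs (ft f y) <= B.
Proof.
move=> fi; exists (\int[lebn R n]_x cabs (f x))%R; split.
  by apply: Rintegral_ge0 => x _; exact: cabs_ge0.
move=> y; rewrite -lee_fin fineK; last exact: integrable_fin_num (cintegrable_cabs fi).
by apply: cabs_ft_le; exact: cintegrable_meas fi.
Qed.

Lemma cabs_vst1_ift h x xi : cintegrable (lebn R n) h ->
  cabs (vst 1 (fun y => ft h (- y)) x xi) = cabs (vst 1 h xi (- x)).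
Proof.
move=> hi; have [B [B0 hB]] := cabs_ft_bound hi.
have mft : cmeas (ft h) by apply: cmeas_ft; exact: cintegrable_meas hi.
have -> : vst 1 (fun y => ft h (- y)) x xi = vst 1 (ft h) (- x) (- xi).
  have ii := cintegrable_phase (- xi) (cintegrable_bounded_gauss (- x) mft hB ltr01).
  rewrite /vst /ft -(cint_lebn_opp ii); apply: eq_cint => y.
  by rewrite -opprD gaussN dotvNl dotvNr opprK.
by rewrite vst1_ft// cabs_expiM opprK.
Qed.

(** The Gaussian has mass one, so the double integral is the L^1 norm of [f]; this licenses the
    exchanges of integrals below. *)
Lemma integral_cabs_shift_gauss f xi : cintegrable (lebn R n) f ->
  (\int[lebn R n]_z \int[lebn R n]_w (cabs (f z * expi (- (2 * pi * dotv z xi)) *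
     (gauss 1 (w - z))%:C))%:E < +oo)%E.
Proof.
move=> fi; have mf := cintegrable_meas fi.
apply: (integral2_lty (a := fun z => cabs (f z))).
- apply: cmeasM.
    apply: cmeasM; first exact: cmeas_fst.
    by apply: cmeas_phaseN; [exact: measurable_fst|exact: measurable_cst].
  by apply: cmeas_gauss_sub2; [exact: measurable_snd|exact: measurable_fst].
- exact: cintegrable_cabs.
move=> z; under eq_integral => w _.
  rewrite !cabsM cabs_expi mulr1 cabs_real (ger0_norm (gauss_ge0 _ _)) EFinM.
  over.
have ig := integrable_gauss_sub z (@ltr01 R).
rewrite integralZl// -[X in (_ * X)%E]fineK; last exact: integrable_fin_num.
rewrite -EFinM lee_fin -/(Rintegral _ _ _).
by rewrite (Rintegral_lebn_shift (- z) (integrable_gauss n ltr01)) Rintegral_gauss1 mulr1.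
Qed.

(** The convolution of [f] with the Gaussian modulated to frequency [xi]. *)
Let beta f xi w := expi (2 * pi * dotv w xi) * vst 1 f w xi.

Lemma cintegrable_vst1 f xi : cintegrable (lebn R n) f ->
  cintegrable (lebn R n) (beta f xi).
Proof.
move=> fi; have mf := cintegrable_meas fi.
have mv : cmeas (fun w => vst 1 f w xi) by apply: cmeas_vst => //; exact: measurable_cst.
suff iv : cintegrable (lebn R n) (fun w => vst 1 f w xi).
  apply: (cintegrable_dom _ (cintegrable_cabs iv)).
    by apply: cmeasM => //; apply: cmeas_phase => //; exact: measurable_cst.
  by move=> w; rewrite cabs_expiM.
pose F w z := f z * (gauss 1 (z - w))%:C * expi (- (2 * pi * dotv z xi)).
have mF : cmeas (fun p : 'rV[R]_n * 'rV[R]_n => F p.1 p.2).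
  apply: cmeasM; last by apply: cmeas_phaseN; [exact: measurable_snd|exact: measurable_cst].
  apply: cmeasM; first exact: cmeas_snd.
  by apply: cmeas_gauss_sub2; [exact: measurable_snd|exact: measurable_fst].
apply: (cintegrable_cint2 mF).
rewrite (tonelli_swap _ _ (F := fun w z => (cabs (F w z))%:E)); last 2 first.
- by apply/measurable_EFinP; exact: measurable_cabs.
- by move=> w z; rewrite lee_fin cabs_ge0.
apply: le_lt_trans (integral_cabs_shift_gauss xi fi).
rewrite le_eqVlt; apply/orP; left; apply/eqP.
apply: eq_integral => z _; apply: eq_integral => w _ /=.
by rewrite /F !cabsM -(opprB w z) gaussN; congr EFin; ring.
Qed.

(* Fourier inversion for the convolution of [f] with a modulated Gaussian,
   whose transform is the left-hand side. *)
Lemma ft_window_inversion f xi eta : cintegrable (lebn R n) f ->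
  ft f eta * (gauss 1 (eta - xi))%:C = ft (beta f xi) eta.
Proof.
move=> fi; have mf := cintegrable_meas fi.
pose F z w := f z * expi (- (2 * pi * dotv z xi)) *
  ((gauss 1 (w - z))%:C * expi (- (2 * pi * dotv w (eta - xi)))).
transitivity (cint (lebn R n) (fun z => cint (lebn R n) (F z))).
  rewrite mulrC {1}/ft -(cintZ _ (cintegrable_phase eta fi)); apply: eq_cint => z.
  rewrite (cintZ _ (cintegrable_phase (eta - xi) (cintegrable_gauss_sub z ltr01))).
  rewrite -/(ft (fun w => (gauss 1 (w - z))%:C) (eta - xi)) ft_gauss_sub.
  rewrite (_ : - (2 * pi * dotv z eta) =
    - (2 * pi * dotv z xi) + - (2 * pi * dotv z (eta - xi))); last by rewrite dotvBr; ring.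
  by rewrite expiD; ring.
rewrite cint_Fubini; last 2 first.
- apply: cmeasM; apply: cmeasM.
  + exact: cmeas_fst.
  + by apply: cmeas_phaseN; [exact: measurable_fst|exact: measurable_cst].
  + by apply: cmeas_gauss_sub2; [exact: measurable_snd|exact: measurable_fst].
  + by apply: cmeas_phaseN; [exact: measurable_snd|exact: measurable_cst].
- apply: le_lt_trans (integral_cabs_shift_gauss xi fi).
  rewrite le_eqVlt; apply/orP; left; apply/eqP.
  apply: eq_integral => z _; apply: eq_integral => w _.
  by rewrite /F !cabsM !cabs_expi !mulr1.
apply: eq_cint => w; rewrite /beta /vst.
rewrite {1}/ft mulrAC -(cintZ _ (cintegrable_phase xi (cintegrable_mul_gauss w fi ler01))).
apply: eq_cint => z; rewrite /F.
rewrite (_ : - (2 * pi * dotv w (eta - xi)) =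
    2 * pi * dotv w xi + - (2 * pi * dotv w eta)); last by rewrite dotvBr; ring.
by rewrite expiD -(opprB w z) gaussN; ring.
Qed.

(** One Gaussian factor of the window is spent on the transform of [f], which becomes the transform
    of [beta]; the other [b] factors stay with [m]. *)
Lemma vst_mul_ft m f (b : R) xi y : cmeas m -> (forall x, cabs (m x) <= 1) -> 0 < b ->
  cintegrable (lebn R n) f ->
  vst (b + 1) (fun x => m x * ft f x) xi y =
  cint (lebn R n) (fun w => beta f xi w * vst b m xi (y + w)).
Proof.
move=> mm m1 b0 fi; have mf := cintegrable_meas fi.
have ib := cintegrable_vst1 xi fi.
pose F eta w := m eta * (gauss b (eta - xi))%:C * expi (- (2 * pi * dotv eta y)) *
   (beta f xi w * expi (- (2 * pi * dotv w eta))).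
transitivity (cint (lebn R n) (fun eta => cint (lebn R n) (F eta))).
  apply: eq_cint => eta.
  rewrite (cintZ _ (cintegrable_phase eta ib)) -/(ft (beta f xi) eta).
  by rewrite -ft_window_inversion// -gaussM rmorphM/=; ring.
rewrite (cint_swap (a := fun eta => gauss b (eta - xi)) (b := fun w => cabs (beta f xi w))); last 4 first.
- apply: cmeasM; apply: cmeasM.
  + apply: cmeasM; first exact: cmeas_fst.
    by apply: cmeas_gauss_sub2; [exact: measurable_fst|exact: measurable_cst].
  + by apply: cmeas_phaseN; [exact: measurable_fst|exact: measurable_cst].
  + by apply: cmeas_snd; exact: cintegrable_meas ib.
  + by apply: cmeas_phaseN; [exact: measurable_snd|exact: measurable_fst].
- exact: integrable_gauss_sub.
- exact: cintegrable_cabs.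
- move=> eta w; rewrite !cabsM !cabs_expi !mulr1 cabs_real (ger0_norm (gauss_ge0 _ _)).
  by rewrite ler_wpM2r ?mulr_ge0 ?cabs_ge0// ler_piMl ?gauss_ge0.
apply: eq_cint => w; rewrite /vst /ft.
rewrite -(cintZ _ (cintegrable_phase (y + w) (cintegrable_bounded_gauss xi mm m1 b0))).
apply: eq_cint => eta; rewrite /F.
rewrite (_ : - (2 * pi * dotv eta (y + w)) =
    - (2 * pi * dotv eta y) + - (2 * pi * dotv w eta)); last by rewrite dotvDr (dotvC w); ring.
by rewrite expiD; ring.
Qed.

End short_time_identities.

Lemma ae_lebn_shift (R : realType) n (P : 'rV[R]_n -> Prop) (a : 'rV[R]_n) :
  {ae lebn R n, forall x, P x} -> {ae lebn R n, forall x, P (x + a)}.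
Proof.
move=> [A [mA A0 PA]].
have ma : measurable_fun setT (fun x : 'rV[R]_n => x + a).
  by apply: measurable_rVD => //; exact: measurable_cst.
exists ((fun x => x + a) @^-1` A); split.
- by rewrite -[X in measurable X]setTI; exact: ma.
- rewrite -[X in lebn R n X]setIT -integral_indic//; last first.
    by rewrite -[X in measurable X]setTI; exact: ma.
  rewrite -[RHS]A0 -[X in _ = lebn R n X]setIT -[RHS]integral_indic//.
  rewrite -(ge0_integral_lebn_shift a (F := fun x => (\1_A x)%:E))//.
  by apply/measurable_EFinP; exact: measurable_indic.
- by move=> x Px; apply: PA.
Qed.

Lemma cint_real d (T : measurableType d) (R : realType) (mu : {measure set T -> \bar R})
  (f : T -> R) : cint mu (fun x => (f x)%:C) = (\int[mu]_x f x)%R%:C.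
Proof.
apply: complex_ext => //=.
by rewrite /Rintegral integral0.
Qed.

(** * Change of window *)

Section change_of_window.
Variables (R : realType) (n : nat).
Implicit Types (f h m : 'rV[R]_n -> R[i]) (x y z w t u xi eta : 'rV[R]_n).

Lemma Rintegral_gauss_gt0 (a : R) : 0 < a -> 0 < (\int[lebn R n]_t gauss a t)%R.
Proof.
move=> a0; pose e := Num.sqrt a.
have e0 : 0 < e by rewrite sqrtr_gt0.
have -> : (\int[lebn R n]_t gauss a t = \int[lebn R n]_t gauss 1 (e *: t))%R.
  apply: eq_Rintegral => t _; rewrite /gauss dotvZl dotvZr; congr expR.
  by rewrite -[in LHS](sqr_sqrtr (ltW a0)) -/e; ring.
have kE (F : 'rV[R]_n -> \bar R) : measurable_fun setT F -> (forall x, (0 <= F x)%E) ->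
    (\int[lebn R n]_x F (e *: x) = (e^-1 ^+ n)%:E * \int[lebn R n]_x F x)%E.
  by move=> mF F0; rewrite ge0_integral_lebn_scale.
rewrite (Rintegral_lebn_subst kE (integrable_gauss n ltr01)).
by rewrite Rintegral_gauss1 mulr1 exprn_gt0// invr_gt0.
Qed.

(* Completing the square: the harmonic combination of [r] and [b + 1] is [1]. *)
Lemma gauss_split (b : R) u t : 0 < b ->
  gauss ((b + 1) / b) t * gauss (b + 1) (u - t) =
  gauss 1 u * gauss ((b + 1) / b + (b + 1)) (t - (b / (b + 1)) *: u).
Proof.
move=> b0; have b1 : b + 1 != 0 by rewrite gt_eqF// addr_gt0.
rewrite /gauss -!expRD; congr expR.
rewrite !(dotvBl, dotvBr, dotvZl, dotvZr) (dotvC t u).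
by field; rewrite b1 gt_eqF.
Qed.

Lemma Rintegral_gauss_split (b : R) u : 0 < b ->
  (\int[lebn R n]_t (gauss ((b + 1) / b) t * gauss (b + 1) (u - t)))%R =
  gauss 1 u * (\int[lebn R n]_t gauss ((b + 1) / b + (b + 1)) t)%R.
Proof.
move=> b0; have r0 : 0 < (b + 1) / b + (b + 1) by rewrite addr_gt0 ?divr_gt0 ?addr_gt0.
have ig := integrable_gauss n r0.
under eq_Rintegral => t _ do rewrite gauss_split//.
rewrite (RintegralZl (gauss 1 u) measurableT (integrable_gauss_sub ((b / (b + 1)) *: u) r0)).
by rewrite (Rintegral_lebn_shift (- ((b / (b + 1)) *: u)) ig).
Qed.

(** A positive multiple of [gauss 1] is the convolution of two narrower Gaussians, by
    [Rintegral_gauss_split]; translating the window only shifts the first argument of [vst]. *)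
Lemma vst_change_window h (b : R) xi y : cintegrable (lebn R n) h -> 0 < b ->
  ((\int[lebn R n]_t gauss ((b + 1) / b + (b + 1)) t)%R)%:C * vst 1 h xi y =
  cint (lebn R n) (fun t => (gauss ((b + 1) / b) t)%:C * vst (b + 1) h (xi + t) y).
Proof.
move=> hi b0; have mh := cintegrable_meas hi.
have b1 : 0 < b + 1 by rewrite addr_gt0.
have r0 : 0 < (b + 1) / b by rewrite divr_gt0.
pose F t eta := (gauss ((b + 1) / b) t)%:C *
  (h eta * (gauss (b + 1) (eta - (xi + t)))%:C * expi (- (2 * pi * dotv eta y))).
have hg t := cintegrable_phase y (cintegrable_mul_gauss (xi + t) hi (ltW b1)).
transitivity (cint (lebn R n) (fun t => cint (lebn R n) (F t))); last first.
  by apply: eq_cint => t; rewrite (cintZ _ (hg t)).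
rewrite (cint_swap (a := gauss ((b + 1) / b)) (b := fun eta => cabs (h eta))); last 4 first.
- apply: cmeasM; first by apply: (cmeas_comp (@cmeas_gauss R n ((b + 1) / b))); exact: measurable_fst.
  apply: cmeasM; last by apply: cmeas_phaseN; [exact: measurable_snd|exact: measurable_cst].
  apply: cmeasM; first exact: cmeas_snd.
  apply: cmeas_gauss_sub2; first exact: measurable_snd.
  by apply: measurable_rVD; [exact: measurable_cst|exact: measurable_fst].
- exact: integrable_gauss.
- exact: cintegrable_cabs.
- move=> t eta; rewrite !cabsM cabs_expi mulr1 !cabs_real !ger0_norm ?gauss_ge0//.
  by rewrite ler_wpM2l ?gauss_ge0// ler_piMr ?cabs_ge0// gauss_le1// ltW.
rewrite -(cintZ _ (cintegrable_phase y (cintegrable_mul_gauss xi hi ler01))).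
apply: eq_cint => eta.
have ig : cintegrable (lebn R n)
    (fun t => (gauss ((b + 1) / b) t * gauss (b + 1) ((eta - xi) - t))%:C).
  apply: cintegrable_real; apply: le_integrable (integrable_gauss n r0) => //.
    apply/measurable_EFinP/measurable_funM; first exact: measurable_gauss.
    apply: (measurableT_comp (@measurable_gauss R n (b + 1))).
    by apply: measurable_rVB => //; exact: measurable_cst.
  move=> t _ /=; rewrite lee_fin normrM ler_piMr// ger0_norm ?gauss_ge0//.
  by rewrite gauss_le1// ltW.
transitivity (h eta * expi (- (2 * pi * dotv eta y)) *
  cint (lebn R n) (fun t => (gauss ((b + 1) / b) t * gauss (b + 1) ((eta - xi) - t))%:C)).
  by rewrite cint_real Rintegral_gauss_split// rmorphM/=; ring.
rewrite -(cintZ _ ig); apply: eq_cint => t.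
by rewrite /F rmorphM/= opprD addrA; ring.
Qed.

(* The window of [m] supplies the decay in [w - x], the change of window the
   decay in [t]; no constant depends on [f]. *)
Lemma modulus_multiplier_le m (b M s : R) : cmeas m -> (forall x, cabs (m x) <= 1) ->
  0 < b -> 0 <= M -> n%:R < s ->
  {ae lebn R n, forall xi, forall y, cabs (vst b m xi y) <= M * jw s y} ->
  exists C : R, 0 < C /\ forall f, cintegrable (lebn R n) f ->
    cintegrable (lebn R n) (ft f) -> forall x xi,
    ((cabs (vst 1 (fun e => m e * ft f e) xi (- x)))%:E <=
     C%:E * \int[lebn R n]_t \int[lebn R n]_w
       (jw s t * (jw s (w - x) * cabs (vst 1 f w (xi + t))))%:E)%E.
Proof.
move=> mm m1 b0 M0 ns good.
have r0 : 0 < (b + 1) / b by rewrite divr_gt0// addr_gt0.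
have c0 : 0 < (\int[lebn R n]_t gauss ((b + 1) / b + (b + 1)) t)%R.
  by apply: Rintegral_gauss_gt0; rewrite !addr_gt0.
set c := Rintegral _ _ _ in c0.
have [K [K0 gK]] := gauss_le_jw n s r0.
(* [c] normalizes the convolution of Gaussians, [K] bounds the averaging Gaussian by the weight, and
   [M + 1] keeps the constant positive when [M] is zero. *)
exists (c^-1 * (K * (M + 1))); split.
  by rewrite mulr_gt0 ?invr_gt0 ?mulr_gt0// ltr_wpDl.
move=> f fi ffi x xi.
have mf := cintegrable_meas fi; have mff := cintegrable_meas ffi.
set h := fun e => m e * ft f e.
have hi : cintegrable (lebn R n) h.
  apply: (cintegrable_dom _ (cintegrable_cabs ffi)); first exact: cmeasM.
  by move=> e; rewrite cabsM ler_piMl ?cabs_ge0.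
have mh := cintegrable_meas hi.
have mxt : measurable_fun setT (fun t : 'rV[R]_n => xi + t).
  by apply: measurable_rVD => //; exact: measurable_cst.
pose G t w := (jw s t * (jw s (w - x) * cabs (vst 1 f w (xi + t))))%:E.
have mjw : measurable_fun setT (fun w : 'rV[R]_n => jw s (w - x)).
  exact: (measurableT_comp (measurable_jw s) (measurable_subv x)).
have mG : measurable_fun setT (fun p : 'rV[R]_n * 'rV[R]_n => G p.1 p.2).
  apply/measurable_EFinP; apply: measurable_funM.
    by apply: (measurableT_comp (measurable_jw s)); exact: measurable_fst.
  apply: measurable_funM.
    exact: (measurableT_comp mjw measurable_snd).
  apply: measurable_cabs; apply: cmeas_vst => //.
  exact: (measurableT_comp mxt measurable_fst).
have G0 t w : (0 <= G t w)%E by rewrite lee_fin !mulr_ge0 ?jw_ge0 ?cabs_ge0.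
have mint : measurable_fun setT (fun t => \int[lebn R n]_w G t w)%E.
  exact: measurable_integral2.
have key : ((c * cabs (vst 1 h xi (- x)))%:E <=
    (K * (M + 1))%:E * \int[lebn R n]_t \int[lebn R n]_w G t w)%E.
  rewrite -[X in X * _](ger0_norm (ltW c0)) -cabs_real -cabsM vst_change_window//.
  have mI : cmeas (fun t => (gauss ((b + 1) / b) t)%:C * vst (b + 1) h (xi + t) (- x)).
    apply: cmeasM; first exact: cmeas_gauss.
    by apply: cmeas_vst => //; exact: measurable_cst.
  apply: le_trans (cabs_cint _ mI) _.
  have KM0 : 0 <= K * (M + 1) by rewrite mulr_ge0 ?(ltW K0)// addr_ge0.
  rewrite -ge0_integralZl//; last by move=> t _; exact: integral_ge0.
  apply: ae_ge0_le_integral => //.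
  - by move=> t _; rewrite lee_fin cabs_ge0.
  - by apply/measurable_EFinP; exact: measurable_cabs.
  - by move=> t _; rewrite mule_ge0 ?lee_fin// integral_ge0.
  - exact: measurable_funeM.
  (* Decay at almost every frequency suffices, since the frequency [xi + t] is averaged over [t];
     the resulting bound holds at every [xi]. *)
  have := ae_lebn_shift xi good; apply: filterS => t gt _.
  rewrite cabsM cabs_real (ger0_norm (gauss_ge0 _ _)).
  have mI2 : cmeas (fun w => expi (2 * pi * dotv w (xi + t)) * vst 1 f w (xi + t) *
      vst b m (xi + t) (- x + w)).
    apply: cmeasM; first exact: cintegrable_meas (cintegrable_vst1 _ fi).
    apply: cmeas_vst => //.
    by apply: measurable_rVD => //; exact: measurable_cst.
  apply: (@le_trans _ _ ((K * jw s t)%:E * (cabs (vst (b + 1) h (xi + t) (- x)))%:E)%E).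
    by rewrite -EFinM lee_fin ler_wpM2r ?cabs_ge0.
  have mG' : measurable_fun setT (fun w => (jw s (w - x) * cabs (vst 1 f w (xi + t)))%:E).
    apply/measurable_EFinP; apply: measurable_funM => //.
    by apply: measurable_cabs; apply: cmeas_vst => //; exact: measurable_cst.
  have E1 : (\int[lebn R n]_w G t w = (jw s t)%:E *
      \int[lebn R n]_w (jw s (w - x) * cabs (vst 1 f w (xi + t)))%:E)%E.
    rewrite -ge0_integralZl ?lee_fin ?jw_ge0//.
    by move=> w _; rewrite lee_fin mulr_ge0 ?jw_ge0 ?cabs_ge0.
  have E2 : ((cabs (vst (b + 1) h (xi + t) (- x)))%:E <= (M + 1)%:E *
      \int[lebn R n]_w (jw s (w - x) * cabs (vst 1 f w (xi + t)))%:E)%E.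
    rewrite vst_mul_ft//; apply: le_trans (cabs_cint _ mI2) _.
    rewrite -ge0_integralZl ?lee_fin ?addr_ge0//; last first.
      by move=> w _; rewrite lee_fin mulr_ge0 ?jw_ge0 ?cabs_ge0.
    apply: ge0_le_integral => //.
    - by move=> w _; rewrite lee_fin cabs_ge0.
    - by apply/measurable_EFinP; exact: measurable_cabs.
    - exact: measurable_funeM.
    move=> w _; rewrite -EFinM lee_fin -mulrA cabs_expiM cabsM.
    rewrite (addrC xi) (addrC (- x)) [leRHS]mulrA [leRHS]mulrC.
    rewrite ler_wpM2l ?cabs_ge0//; apply: le_trans (gt _) _.
    by rewrite ler_wpM2r ?jw_ge0// lerDl.
  rewrite E1 [leRHS](_ : _ = ((K * jw s t)%:E * ((M + 1)%:E *
      \int[lebn R n]_w (jw s (w - x) * cabs (vst 1 f w (xi + t)))%:E))%E); last first.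
    by rewrite !muleA -!EFinM; congr (_%:E * _)%E; ring.
  apply: lee_wpmul2l => //.
  by rewrite lee_fin mulr_ge0 ?jw_ge0// ltW.
rewrite EFinM -muleA -lee_pdivrMl// ?invr_gt0// invrK -EFinM.
exact: key.
Qed.

End change_of_window.

(** * Schwartz functions *)

Section schwartz_decay.
Variables (R : realType) (n : nat).
Implicit Types (g : 'rV[R]_n -> R) (f : 'rV[R]_n -> R[i]) (x y : 'rV[R]_n).

Lemma dirder_partialj g (j : 'I_n) : (forall x, differentiable g x) ->
  dirder (ebasis R j) g (partialj j g).
Proof.
move=> dg; apply: is_derive_dirder => x.
exact/derivableP/diff_derivable.
Qed.

Lemma differentiable_cont g : (forall x, differentiable g x) -> continuous g.
Proof. by move=> dg x; apply: differentiable_continuous. Qed.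

Lemma schwartzR_diff g : schwartzR g -> forall x, differentiable g x.
Proof. by move=> [dg _] x; exact: (dg [::]). Qed.

Lemma schwartzR_partialj g (j : 'I_n) : schwartzR g -> schwartzR (partialj j g).
Proof.
have E js : iter_partial js (partialj j g) = iter_partial (rcons js j) g.
  by rewrite /iter_partial foldr_rcons.
move=> [dg bg]; split=> js; first by move=> x; rewrite E; exact: dg.
by move=> N; rewrite E; exact: bg.
Qed.

Lemma schwartzR_le_jw g (N : nat) : schwartzR g -> exists C : R, 0 <= C /\
  forall x, `|g x| <= C * jw N%:R x.
Proof.
move=> [_ bg]; have [C gC] := bg [::] N; exists C; split.
  by apply: le_trans (gC 0); rewrite mulr_ge0// exprn_ge0// jbr_ge0.
move=> x; have := gC x; rewrite /= -powR_mulrn ?jbr_ge0// => h.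
have := ler_wpM2l (jw_ge0 N%:R x) h.
by rewrite mulrA jw_jbr mul1r mulrC.
Qed.

Let n1 : n%:R < n.+1%:R :> R. Proof. by rewrite ltr_nat. Qed.

Lemma schwartzR_measurable g : schwartzR g -> measurable_fun setT g.
Proof.
move=> sg; apply: continuous_measurable_rV; apply: differentiable_cont.
exact: schwartzR_diff.
Qed.

Lemma schwartzR_integrable g : schwartzR g -> (lebn R n).-integrable setT (fun x => (g x)%:E).
Proof.
move=> sg; have [C [C0 gC]] := schwartzR_le_jw n.+1 sg.
apply: (integrable_dom_jw n1 _ gC).
exact: schwartzR_measurable.
Qed.

(** The phase is linear in [x], so its derivative is a constant that leaves the integral. *)
Lemma cabs_ft_partialj g (j : 'I_n) y : schwartzR g ->
  2 * pi * `|y 0 j| * cabs (ft (fun x => (g x)%:C) y) =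
  cabs (ft (fun x => (partialj j g x)%:C) y).
Proof.
move=> sg; have sdg := schwartzR_partialj j sg.
have [C [C0 gC]] := schwartzR_le_jw n.+1 sg.
have [D [D0 dgD]] := schwartzR_le_jw n.+1 sdg.
pose c := - (2 * pi) * y 0 j.
pose th x := - (2 * pi) * dotv x y.
have dth : dirder (ebasis R j) th (fun=> c).
  rewrite /c -(dotv_ebasis y) dotvC.
  exact: (dirderZ (- (2 * pi)) (dirder_dotv (ebasis R j) y)).
have dgP := dirder_partialj j (schwartzR_diff sg).
have mth : measurable_fun setT th.
  apply: measurable_funM => //; apply: measurable_dotv => //; exact: measurable_cst.
pose E := (1 + `|c|) * C + D.
have EC : (1 + `|c|) * C <= E by rewrite lerDl.
have b1 x : `|g x| <= E * jw n.+1%:R x.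
  apply: le_trans (gC x) _; rewrite ler_wpM2r ?jw_ge0//.
  by apply: le_trans EC; rewrite ler_peMl// lerDl.
have b2 x : `|c * g x| <= E * jw n.+1%:R x.
  rewrite normrM; apply: (@le_trans _ _ (`|c| * (C * jw n.+1%:R x))).
    by rewrite ler_wpM2l.
  rewrite mulrA ler_wpM2r ?jw_ge0//; apply: le_trans EC.
  by rewrite ler_wpM2r// lerDr.
have b3 x : `|partialj j g x| <= E * jw n.+1%:R x.
  apply: le_trans (dgD x) _; rewrite ler_wpM2r ?jw_ge0// lerDr.
  by rewrite mulr_ge0// addr_ge0.
have mc : measurable_fun setT (fun _ : 'rV[R]_n => c) by exact: measurable_cst.
have := cabs_ibp n1 dth dgP mth mc (schwartzR_measurable sg) (schwartzR_measurable sdg) b1 b2 b3.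
have ig := cintegrable_real (schwartzR_integrable sg).
have -> : cint (lebn R n) (fun x => expi (th x) * (c * g x)%:C) =
    c%:C * ft (fun x => (g x)%:C) y.
  rewrite /ft -(cintZ _ (cintegrable_phase y ig)); apply: eq_cint => x.
  by rewrite rmorphM/= /th mulNr; ring.
have -> : cint (lebn R n) (fun x => expi (th x) * (partialj j g x)%:C) =
    ft (fun x => (partialj j g x)%:C) y.
  by apply: eq_cint => x; rewrite /th mulNr mulrC.
have p2 : 0 <= 2 * pi :> R by rewrite mulr_ge0// pi_ge0.
by move=> <-; rewrite cabsM cabs_real /c normrM normrN (ger0_norm p2).
Qed.

(** One derivative buys one power of decay. The induction runs over all Schwartz functions at once
    because its step is applied to the derivatives of [g]. *)
Lemma cabs_ft_schwartzR_le (N : nat) g : schwartzR g -> exists C : R, 0 <= C /\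
  forall y, cabs (ft (fun x => (g x)%:C) y) <= C * jw N%:R y.
Proof.
elim: N g => [|N IH] g sg.
  have [B [B0 gB]] := cabs_ft_bound (cintegrable_real (schwartzR_integrable sg)).
  by exists B; split => // y; rewrite /jw oppr0 powRr0 mulr1.
have [C [C0 gC]] := IH g sg.
have [D DP] := choice (fun j => IH _ (schwartzR_partialj j sg)).
have p2 : 0 < 2 * pi :> R by rewrite mulr_gt0// pi_gt0.
exists (C + \sum_j (2 * pi)^-1 * D j); split.
  rewrite addr_ge0// sumr_ge0// => j _; rewrite mulr_ge0 ?invr_ge0 ?(ltW p2)//.
  by case: (DP j).
move=> y; have jE := jw_jbr1 N%:R y; rewrite natr1 in jE.
rewrite -(ler_pM2r (jbr_gt0 y)) -[leRHS]mulrA jE.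
set V := cabs _.
apply: (@le_trans _ _ (V + \sum_j `|y 0 j| * V)).
  rewrite -mulr_suml mulrC -[X in X + _]mul1r -mulrDl.
  by rewrite ler_wpM2r ?cabs_ge0// jbr_le_sum.
rewrite mulrDl lerD//; first exact: gC.
rewrite mulr_suml ler_sum// => j _; rewrite -mulrA ler_pdivlMl// mulrA.
by rewrite cabs_ft_partialj//; case: (DP j).
Qed.

Lemma complex_ReIm f x : f x = (Re (f x))%:C + Complex 0 1 * (Im (f x))%:C.
Proof. by apply: complex_ext; rewrite ?ReD ?ImD ?ReM ?ImM /=; ring. Qed.

Lemma schwartz_integrable f : schwartz f -> cintegrable (lebn R n) f.
Proof. by move=> [sr si]; split; exact: schwartzR_integrable. Qed.

Lemma schwartz_bounded f : schwartz f -> exists B : R, forall x, cabs (f x) <= B.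
Proof.
move=> [sr si]; have [C [C0 rC]] := schwartzR_le_jw 0 sr.
have [D [D0 iD]] := schwartzR_le_jw 0 si.
exists (C + D) => x; apply: le_trans (cabs_le_ReIm _) _.
by apply: lerD; [have := rC x|have := iD x]; rewrite /jw oppr0 powRr0 mulr1.
Qed.

Lemma schwartz_ft_integrable f : schwartz f -> cintegrable (lebn R n) (ft f).
Proof.
move=> sf; have [sr si] := sf.
have [C [C0 rC]] := cabs_ft_schwartzR_le n.+1 sr.
have [D [D0 iD]] := cabs_ft_schwartzR_le n.+1 si.
apply: (cintegrable_dom_jw (C := C + D) n1).
  by apply: cmeas_ft; exact: cintegrable_meas (schwartz_integrable sf).
have ir := cintegrable_real (schwartzR_integrable sr).
have ii := cintegrable_real (schwartzR_integrable si).
move=> y; have -> : ft f y = ft (fun x => (Re (f x))%:C) y +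
    Complex 0 1 * ft (fun x => (Im (f x))%:C) y.
  have pr := cintegrable_phase y ir; have pim := cintegrable_phase y ii.
  rewrite /ft -(cintZ _ pim) -(cintD pr (cintegrableZ _ pim)).
  by apply: eq_cint => x; rewrite {1}(complex_ReIm f x); ring.
apply: le_trans (cabsD _ _) _; rewrite mulrDl lerD// cabsM.
have -> : cabs (Complex 0 1) = 1 :> R by rewrite /cabs /= expr0n expr1n add0r sqrtr1.
by rewrite mul1r.
Qed.

Lemma stft_schwartz f x xi : schwartz f -> stft f x xi = vst 1 f x xi.
Proof.
move=> sf; have [B fB] := schwartz_bounded sf.
exact: stft_vst (cintegrable_meas (schwartz_integrable sf)) fB.
Qed.

(** [emuD mu f] is the reflected Fourier transform of an integrable function, to which the rotation
    identity applies; the unimodular factor disappears in the modulus. *)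
Lemma cabs_stft_emuD mu f x xi : continuous mu -> schwartz f ->
  cabs (stft (emuD mu f) x xi) = cabs (vst 1 (fun e => expi (mu e) * ft f e) xi (- x)).
Proof.
move=> cmu sf; have ffi := schwartz_ft_integrable sf.
have hi : cintegrable (lebn R n) (fun e => expi (mu e) * ft f e).
  apply: (cintegrable_dom _ (cintegrable_cabs ffi)).
    apply: cmeasM; last exact: cintegrable_meas ffi.
    by apply: cmeas_expi; exact: continuous_measurable_rV.
  by move=> e; rewrite cabs_expiM.
set h := fun e => _ in hi *.
have -> : emuD mu f = fun y => ft h (- y).
  apply/funext => y; rewrite /emuD /ifourier.
  rewrite [RHS]/ft -(cintRnE (cintegrable_phase (- y) hi)); congr cintRn.
  apply/funext => e; rewrite (fourierE _ (schwartz_integrable sf)).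
  by rewrite dotvNr mulrN opprK dotvC.
have [B [B0 hB]] := cabs_ft_bound hi.
have mh : cmeas (fun y => ft h (- y)).
  apply: (cmeas_comp (cmeas_ft (cintegrable_meas hi))).
  by apply: measurable_rVN.
have -> : stft (fun y => ft h (- y)) x xi = vst 1 (fun y => ft h (- y)) x xi.
  exact: (stft_vst x xi mh (fun y => hB (- y))).
exact: cabs_vst1_ift.
Qed.

End schwartz_decay.

(** * Peetre's maximal function trick *)

Section double_integral.
Context d1 d2 (T1 : measurableType d1) (T2 : measurableType d2) (R : realType).
Variables (m1 : {sigma_finite_measure set T1 -> \bar R})
          (m2 : {sigma_finite_measure set T2 -> \bar R}).
Implicit Types F G : T1 -> T2 -> \bar R.

Lemma ge0_le_integral2 F G :
  measurable_fun setT (fun p : T1 * T2 => F p.1 p.2) ->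
  measurable_fun setT (fun p : T1 * T2 => G p.1 p.2) ->
  (forall x y, (0 <= F x y)%E) -> (forall x y, (F x y <= G x y)%E) ->
  (\int[m1]_x \int[m2]_y F x y <= \int[m1]_x \int[m2]_y G x y)%E.
Proof.
move=> mF mG F0 FG; apply: ge0_le_integral => //.
- by move=> x _; exact: integral_ge0.
- exact: measurable_integral2.
- exact: measurable_integral2.
- move=> x _; apply: ge0_le_integral => //.
  + exact: measurable_slice1.
  + exact: measurable_slice1.
Qed.

Lemma ge0_integral2Zl F (k : R) : 0 <= k ->
  measurable_fun setT (fun p : T1 * T2 => F p.1 p.2) ->
  (forall x y, (0 <= F x y)%E) ->
  (\int[m1]_x \int[m2]_y (k%:E * F x y) = k%:E * \int[m1]_x \int[m2]_y F x y)%E.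
Proof.
move=> k0 mF F0; rewrite -ge0_integralZl//; last 2 first.
- exact: measurable_integral2.
- by move=> x _; exact: integral_ge0.
apply: eq_integral => x _; rewrite ge0_integralZl//.
exact: measurable_slice1.
Qed.

End double_integral.

Section peetre.
Variables (R : realType) (n : nat) (s : R).
Hypothesis s0 : 0 <= s.
Implicit Types (F : 'rV[R]_n -> 'rV[R]_n -> R) (x y z w t v xi : 'rV[R]_n).

(** [x] and [xi] are the base point, [t] the displacement in frequency, while [w] is the absolute
    position. *)
Definition jw_kernel F x xi t w : R := jw s t * (jw s (w - x) * F w (xi + t)).

Lemma measurable_jw_kernel F x xi :
  measurable_fun setT (fun p : 'rV[R]_n * 'rV[R]_n => F p.1 p.2) ->
  measurable_fun setT (fun p : 'rV[R]_n * 'rV[R]_n => jw_kernel F x xi p.1 p.2).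
Proof.
move=> mF; apply: measurable_funM.
  by apply: (measurableT_comp (measurable_jw s)); exact: measurable_fst.
apply: measurable_funM.
  exact: (measurableT_comp (measurableT_comp (measurable_jw s) (measurable_subv x)) measurable_snd).
have mxt : measurable_fun setT (fun t : 'rV[R]_n => xi + t).
  by apply: measurable_rVD => //; exact: measurable_cst.
apply: (measurableT_comp mF (g := fun p : 'rV[R]_n * 'rV[R]_n => (p.2, xi + p.1))).
apply: measurable_fun_pair; first exact: measurable_snd.
exact: (measurableT_comp mxt measurable_fst).
Qed.

Lemma jw_kernel_ge0 F x xi t w : (forall w v, 0 <= F w v) -> 0 <= jw_kernel F x xi t w.
Proof. by move=> F0; rewrite !mulr_ge0 ?jw_ge0. Qed.

Lemma jw_kernel_le F (B : R) x xi t w : (forall w v, 0 <= F w v <= B) ->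
  jw_kernel F x xi t w <= B.
Proof.
move=> FB; have /andP[F0 F1] := FB w (xi + t).
rewrite /jw_kernel mulrA; apply: le_trans F1.
by rewrite -[leRHS]mul1r ler_wpM2r// mulr_ile1 ?jw_ge0 ?jw_le1.
Qed.

Let I1 F x xi : \bar R := (\int[lebn R n]_t \int[lebn R n]_w (jw_kernel F x xi t w)%:E)%E.

(** After translating [t] by [t'], both sides evaluate [F] at the same points, and Peetre's
    inequality is applied once in frequency and once in position. *)
Lemma jw_kernel_trans F x xi t' w' : (forall w v, 0 <= F w v) ->
  measurable_fun setT (fun p : 'rV[R]_n * 'rV[R]_n => F p.1 p.2) ->
  ((jw s t' * jw s (w' - x))%:E * I1 F w' (xi + t') <= (2 `^ s * 2 `^ s)%:E * I1 F x xi)%E.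
Proof.
move=> F0 mF; rewrite /I1.
have k0 : 0 <= jw s t' * jw s (w' - x) by rewrite mulr_ge0 ?jw_ge0.
have mK y eta := measurable_jw_kernel y eta mF.
have mKE y eta : measurable_fun setT (fun p : 'rV[R]_n * 'rV[R]_n => (jw_kernel F y eta p.1 p.2)%:E).
  exact/measurable_EFinP.
have K0 y eta t w : (0 <= (jw_kernel F y eta t w)%:E)%E by rewrite lee_fin jw_kernel_ge0.
have K1 y eta t : (0 <= \int[lebn R n]_w (jw_kernel F y eta t w)%:E)%E by exact: integral_ge0.
have mI : measurable_fun setT (fun t => \int[lebn R n]_w (jw_kernel F w' (xi + t') t w)%:E)%E.
  by apply: measurable_integral2; exact: mKE.
rewrite -(ge0_integral_lebn_shift (- t') mI (K1 w' (xi + t'))).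
have mS : measurable_fun setT (fun p : 'rV[R]_n * 'rV[R]_n =>
    (jw_kernel F w' (xi + t') (p.1 + - t') p.2)%:E).
  apply: (measurableT_comp (mKE w' (xi + t')) (g := fun p : 'rV[R]_n * 'rV[R]_n => (p.1 - t', p.2))).
  apply: measurable_fun_pair; last exact: measurable_snd.
  exact: (measurableT_comp (measurable_subv t') measurable_fst).
have c0 : 0 <= 2 `^ s * 2 `^ s :> R by rewrite mulr_ge0 ?powR_ge0.
rewrite -(ge0_integral2Zl _ _ (F := fun t w => (jw_kernel F w' (xi + t') (t + - t') w)%:E) k0 mS (fun t w => K0 w' (xi + t') (t + - t') w)).
rewrite -(ge0_integral2Zl _ _ (F := fun t w => (jw_kernel F x xi t w)%:E) c0 (mKE x xi) (K0 x xi)).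
apply: ge0_le_integral2.
- exact: measurable_funeM.
- exact: measurable_funeM.
- by move=> t w; rewrite mule_ge0.
move=> t w; rewrite -!EFinM lee_fin /jw_kernel -addrA (addrCA t') subrr addr0.
have p1 : jw s t' * jw s (t - t') <= 2 `^ s * jw s t.
  by have := jw_peetre t (t' - t) s0; rewrite addrCA subrr addr0 -opprB jwN.
have p2 : jw s (w' - x) * jw s (w - w') <= 2 `^ s * jw s (w - x).
  have := jw_peetre (w - x) (w' - w) s0.
  have -> : w - x + (w' - w) = w' - x by rewrite addrC addrA subrK.
  by rewrite -(opprB w w') jwN.
have aux (k a b c d e f g : R) : 0 <= a * b -> a * b <= k * c -> 0 <= d * e ->
    d * e <= k * g -> 0 <= f -> a * d * (b * (e * f)) <= k * k * (c * (g * f)).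
  move=> ab0 abc de0 deg f0.
  rewrite (_ : a * d * _ = (a * b) * (d * e) * f); last by ring.
  rewrite (_ : k * k * _ = (k * c) * (k * g) * f); last by ring.
  by rewrite ler_wpM2r// ler_pM.
have ab0 : 0 <= jw s t' * jw s (t - t') by rewrite mulr_ge0 ?jw_ge0.
have de0 : 0 <= jw s (w' - x) * jw s (w - w') by rewrite mulr_ge0 ?jw_ge0.
exact: (aux _ _ _ _ _ _ _ _ ab0 p1 de0 p2 (F0 w (xi + t))).
Qed.

(* Peetre's maximal function trick: since the kernel is submultiplicative, its
   supremum [S] against [F] satisfies [S <= C S^(1-r) I], where [I] is the
   integral with all exponents lowered to [r]. *)
Lemma peetre_trick (r C : R) : 0 < r <= 1 -> 0 < C -> exists C' : R, 0 < C' /\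
  forall F G (B : R),
  (forall w v, 0 <= F w v <= B) -> (forall x xi, 0 <= G x xi) ->
  measurable_fun setT (fun p : 'rV[R]_n * 'rV[R]_n => F p.1 p.2) ->
  (forall x xi, ((F x xi)%:E <= C%:E * I1 F x xi)%E) ->
  (forall x xi, ((G x xi)%:E <= C%:E * I1 F x xi)%E) ->
  forall x xi, ((G x xi `^ r)%:E <= C'%:E *
    \int[lebn R n]_t \int[lebn R n]_w (jw_kernel F x xi t w `^ r)%:E)%E.
Proof.
move=> /andP[r0 r1] C0; pose C2 : R := 2 `^ s * 2 `^ s.
have C20 : 0 < C2 by rewrite mulr_gt0 ?powR_gt0.
(* With i the value of the integral, G <= C S^(1-r) i and S^r <= C C2 i give G^r <= C^r (S^r)^(1-r)
   i^r <= C^r (C C2)^(1-r) i. *)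
exists (C `^ r * (C * C2) `^ (1 - r)); split.
  by rewrite mulr_gt0 ?powR_gt0 ?mulr_gt0.
move=> F G B FB G0 mF FC GC x xi.
have F0 w v : 0 <= F w v by case/andP: (FB w v).
pose phi := jw_kernel F x xi.
have phi0 t w : 0 <= phi t w by exact: jw_kernel_ge0.
have mphi := measurable_jw_kernel x xi mF.
have mphir : measurable_fun setT (fun p : 'rV[R]_n * 'rV[R]_n => (phi p.1 p.2 `^ r)%:E).
  apply/measurable_EFinP.
  exact: (measurableT_comp (measurable_powR r) mphi).
have phir0 t w : (0 <= (phi t w `^ r)%:E)%E by rewrite lee_fin powR_ge0.
set I := (\int[lebn R n]_t _)%E.
have I0 : (0 <= I)%E.
  by apply: integral_ge0 => t _; apply: integral_ge0.
have C'0 : 0 < C `^ r * (C * C2) `^ (1 - r) by rewrite mulr_gt0 ?powR_gt0 ?mulr_gt0.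
case EI : I I0 => [i| |] // I0; last by rewrite mulry gtr0_sg// mul1e leey.
rewrite lee_fin in I0.
pose E := [set u | exists t w, u = phi t w].
pose S := sup E.
have supE : has_sup E.
  split; first by exists (phi 0 0), 0, 0.
  by exists B => u [t [w ->]]; exact: jw_kernel_le.
have phiS t w : phi t w <= S by apply: ub_le_sup; [case: supE|exists t, w].
have S0 : 0 <= S by exact: le_trans (phiS 0 0).
have I1le : (I1 F x xi <= (S `^ (1 - r) * i)%:E)%E.
  rewrite EFinM -EI -ge0_integral2Zl ?powR_ge0//.
  apply: ge0_le_integral2.
  - exact/measurable_EFinP.
  - exact: measurable_funeM.
  - by move=> t w; rewrite lee_fin.
  move=> t w; rewrite -EFinM lee_fin -/(phi t w).
  rewrite [leLHS](_ : _ = phi t w `^ (1 - r) * phi t w `^ r); last first.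
    by rewrite -powRD ?subrK ?powRr1// oner_eq0.
  rewrite ler_wpM2r ?powR_ge0//.
  by rewrite ge0_ler_powR ?nnegrE ?subr_ge0//.
(* The hypothesis on [F] is used at every point [(w, xi + t)]; the kernel in front is absorbed by
   [jw_kernel_trans]. *)
have Sle : S <= C * C2 * (S `^ (1 - r) * i).
  apply: ge_sup; first by case: supE.
  move=> _ [t [w ->]].
  rewrite -lee_fin /phi /jw_kernel mulrA EFinM.
  apply: (@le_trans _ _ ((jw s t * jw s (w - x))%:E * (C%:E * I1 F w (xi + t)))%E).
    by rewrite lee_wpmul2l// lee_fin mulr_ge0 ?jw_ge0.
  rewrite muleCA (_ : (C * C2 * (S `^ (1 - r) * i))%:E =
    C%:E * (C2 * (S `^ (1 - r) * i))%:E)%E; last by rewrite -EFinM !mulrA.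
  rewrite lee_wpmul2l ?lee_fin ?(ltW C0)//.
  apply: le_trans (jw_kernel_trans _ _ _ _ F0 mF) _.
  rewrite -/C2 [leRHS]EFinM; apply: lee_wpmul2l => //.
  by rewrite lee_fin ltW.
have CC : 0 <= C * C2 := ltW (mulr_gt0 C0 C20).
(* Division by S^(1-r), legitimate because S is finite; the case S = 0 is separate. *)
have Sr : S `^ r <= C * C2 * i.
  have [S00|S1] := eqVneq S 0.
    by rewrite S00 powR0 ?gt_eqF// mulr_ge0.
  have Sp : 0 < S `^ (1 - r) by rewrite powR_gt0// lt_neqAle eq_sym S1.
  rewrite -(ler_pM2l Sp) -powRD ?subrK ?powRr1// ?S1 ?implybT//.
  by apply: le_trans Sle _; rewrite le_eqVlt; apply/orP; left; apply/eqP; ring.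
have G1 : G x xi <= C * (S `^ (1 - r) * i).
  by rewrite -lee_fin; apply: le_trans (GC x xi) _; rewrite EFinM lee_wpmul2l// lee_fin ltW.
rewrite -EFinM lee_fin.
apply: (@le_trans _ _ ((C * (S `^ (1 - r) * i)) `^ r)).
  by rewrite ge0_ler_powR ?nnegrE ?(ltW r0)// (le_trans _ G1).
have Si0 : 0 <= S `^ (1 - r) * i by rewrite mulr_ge0 ?powR_ge0.
rewrite (powRM _ (ltW C0) Si0) (powRM _ (powR_ge0 _ _) I0) -mulrA ler_wpM2l ?powR_ge0//.
rewrite -powRrM mulrC (mulrC (1 - r)) powRrM.
apply: (@le_trans _ _ (i `^ r * (C * C2 * i) `^ (1 - r))).
  rewrite ler_wpM2l ?powR_ge0// ge0_ler_powR ?nnegrE ?subr_ge0 ?powR_ge0//.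
  by rewrite mulr_ge0.
rewrite (powRM _ CC I0) mulrCA ler_wpM2l ?powR_ge0//.
rewrite (mulrC (i `^ r)).
by rewrite -powRD ?subrK ?powRr1// oner_eq0.
Qed.

End peetre.

(** * Minkowski's integral inequality and mixed norms *)

Section minkowski.
Context d1 d2 (T1 : measurableType d1) (T2 : measurableType d2) (R : realType).
Variables (m1 : {sigma_finite_measure set T1 -> \bar R})
          (m2 : {sigma_finite_measure set T2 -> \bar R}).

Lemma powR_young (Q x : R) : 1 <= Q -> 0 <= x -> x <= Q^-1 * x `^ Q + (1 - Q^-1).
Proof.
rewrite le_eqVlt => /orP[/eqP <-|Q1] x0; first by rewrite invr1 subrr addr0 mul1r powRr1.
have Q0 : 0 < Q by exact: lt_trans Q1.
have iQ : 0 < 1 - Q^-1 by rewrite subr_gt0 invf_lt1.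
have := conjugate_powR x0 (@ler01 R) Q0 (_ : 0 < (1 - Q^-1)^-1).
rewrite invr_gt0 mulr1 powR1 mul1r invrK [X in _ <= X + _]mulrC; apply => //.
by rewrite addrC subrK.
Qed.

(** Young's inequality for [x / c], multiplied by [c]. A parameter chosen afterwards replaces the
    duality argument in Minkowski's inequality. *)
Lemma powR_young_scaled (Q x c : R) : 1 <= Q -> 0 <= x -> 0 < c ->
  x <= Q^-1 * (c `^ (1 - Q) * x `^ Q) + (1 - Q^-1) * c.
Proof.
move=> Q1 x0 c0; have := powR_young Q1 (divr_ge0 x0 (ltW c0)).
rewrite -(ler_pM2r c0) divfK ?gt_eqF// => /le_trans; apply.
rewrite powRM ?invr_ge0 ?(ltW c0)// mulrDl lerD2r -mulrA.
have -> : c `^ (1 - Q) = c * c^-1 `^ Q.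
  rewrite powRD; last by rewrite (gt_eqF c0) implybT.
  by rewrite powRr1 ?(ltW c0)// -(powR_inv1 (ltW c0)) -powRrM mulN1r.
by rewrite le_eqVlt; apply/orP; left; apply/eqP; ring.
Qed.

Variables (Q : R) (Phi : T2 -> T1 -> R) (b : T2 -> R) (B : R).
Hypotheses (Q1 : 1 <= Q) (mPhi : measurable_fun setT (fun p : T2 * T1 => Phi p.1 p.2)).
Hypotheses (Phi0 : forall z y, 0 <= Phi z y) (mb : measurable_fun setT b).
Hypotheses (b0 : forall z, 0 < b z) (B0 : 0 < B).
Hypothesis bB : (\int[m2]_z (b z)%:E <= B%:E)%E.

Let Q0 : 0 < Q. Proof. exact: lt_le_trans Q1. Qed.

Let mP : measurable_fun setT (fun p : T2 * T1 => (b p.1 `^ (1 - Q) * Phi p.1 p.2 `^ Q)%:E).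
Proof.
apply/measurable_EFinP; apply: measurable_funM.
  apply: (measurableT_comp (measurable_powR _)).
  exact: (measurableT_comp mb measurable_fst).
exact: (measurableT_comp (measurable_powR _) mPhi).
Qed.

Let mPhiE : measurable_fun setT (fun p : T2 * T1 => (Phi p.1 p.2)%:E).
Proof. exact/measurable_EFinP. Qed.

Let mswap (F : T2 -> T1 -> \bar R) : measurable_fun setT (fun p : T2 * T1 => F p.1 p.2) ->
  measurable_fun setT (fun p : T1 * T2 => F p.2 p.1).
Proof.
move=> mF; apply: (measurableT_comp mF (g := fun p : T1 * T2 => (p.2, p.1))).
by apply: measurable_fun_pair; [exact: measurable_snd|exact: measurable_fst].
Qed.

(* Young's inequality with the parameter [c b z], where [c] is the ratio of the
   left-hand side to [B]. *)
Let pointwise y : (poweR (\int[m2]_z (Phi z y)%:E) Q <=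
  (B `^ (Q - 1))%:E * \int[m2]_z (b z `^ (1 - Q) * Phi z y `^ Q)%:E)%E.
Proof.
set N := (\int[m2]_z (Phi z y)%:E)%E.
have N0 : (0 <= N)%E by apply: integral_ge0 => z _; rewrite lee_fin.
set P := (\int[m2]_z _)%E.
have P0 : (0 <= P)%E.
  by apply: integral_ge0 => z _; rewrite lee_fin mulr_ge0 ?powR_ge0.
case EP : P P0 => [p| |] // P0; last first.
  by rewrite mulry gtr0_sg ?powR_gt0// mul1e leey.
rewrite lee_fin in P0.
have mp : measurable_fun setT (fun z => (b z `^ (1 - Q) * Phi z y `^ Q)%:E).
  exact: (measurable_slice2 (f := fun z y => (b z `^ (1 - Q) * Phi z y `^ Q)%:E) _ mP).
have iQ1 : 0 <= 1 - Q^-1 by rewrite subr_ge0 invf_le1.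
have young (c : R) : 0 < c ->
    (N <= (Q^-1 * c `^ (1 - Q) * p + (1 - Q^-1) * c * B)%:E)%E.
  move=> c0.
  apply: (@le_trans _ _ (\int[m2]_z ((Q^-1 * c `^ (1 - Q))%:E *
     (b z `^ (1 - Q) * Phi z y `^ Q)%:E + ((1 - Q^-1) * c)%:E * (b z)%:E))%E).
    apply: ge0_le_integral => //.
    - by move=> z _; rewrite lee_fin.
    - exact: (measurable_slice2 (f := fun z y => (Phi z y)%:E) _ mPhiE).
    - apply: emeasurable_funD; first exact: measurable_funeM.
      by apply: measurable_funeM; exact/measurable_EFinP.
    move=> z _; rewrite -!EFinM -EFinD lee_fin.
    apply: le_trans (powR_young_scaled Q1 (Phi0 z y) (mulr_gt0 c0 (b0 z))) _.
    rewrite powRM ?(ltW c0) ?(ltW (b0 z))//.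
    by rewrite le_eqVlt; apply/orP; left; apply/eqP; ring.
  have k0 : 0 <= Q^-1 * c `^ (1 - Q) by rewrite mulr_ge0 ?powR_ge0 ?invr_ge0 ?(ltW Q0).
  have l0 : 0 <= (1 - Q^-1) * c by rewrite mulr_ge0 ?(ltW c0).
  rewrite ge0_integralD//; last 4 first.
  - by move=> z _; rewrite -EFinM lee_fin !mulr_ge0 ?powR_ge0 ?invr_ge0 ?(ltW Q0).
  - exact: measurable_funeM.
  - by move=> z _; rewrite -EFinM lee_fin mulr_ge0 ?(ltW (b0 z)).
  - by apply: measurable_funeM; exact/measurable_EFinP.
  rewrite EFinD; apply: leeD.
    rewrite ge0_integralZl//; last by move=> z _; rewrite lee_fin mulr_ge0 ?powR_ge0.
    by rewrite -/P EP -EFinM.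
  rewrite ge0_integralZl//; last 2 first.
  - exact/measurable_EFinP.
  - by move=> z _; rewrite lee_fin (ltW (b0 z)).
  by rewrite [leRHS]EFinM; apply: lee_wpmul2l.
case EN : N N0 young => [v| |] // N0 young; last by have := young 1 ltr01.
rewrite lee_fin in N0.
rewrite poweR_EFin -EFinM lee_fin.
have [->|v0] := eqVneq v 0; first by rewrite powR0 ?gt_eqF// mulr_ge0 ?powR_ge0.
have vp : 0 < v by rewrite lt_neqAle eq_sym v0.
have := young (v / B) (divr_gt0 vp B0); rewrite lee_fin.
have -> : (1 - Q^-1) * (v / B) * B = v - Q^-1 * v by field; rewrite !gt_eqF.
have -> : Q^-1 * (v / B) `^ (1 - Q) * p + (v - Q^-1 * v) =
    v + Q^-1 * ((v / B) `^ (1 - Q) * p - v) by ring.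
rewrite lerDl pmulr_rge0 ?invr_gt0// subr_ge0 => h.
have u0 : 0 < v / B by exact: divr_gt0.
have E1 : (v / B) `^ (Q - 1) * (v / B) `^ (1 - Q) = 1.
  rewrite -powRD; last by rewrite (gt_eqF u0) implybT.
  by rewrite addrA subrK subrr powRr0.
have E2 : v `^ Q = B `^ (Q - 1) * ((v / B) `^ (Q - 1) * v).
  rewrite mulrA -powRM ?(ltW B0) ?(ltW u0)// (mulrC B) divfK ?gt_eqF//.
  rewrite -{3}[v](powRr1 (ltW vp)) -powRD; last by rewrite (gt_eqF vp) implybT.
  by rewrite subrK.
rewrite E2 ler_wpM2l ?powR_ge0//.
have := ler_wpM2l (powR_ge0 (v / B) (Q - 1)) h.
by rewrite mulrA E1 mul1r.
Qed.

(* The majorant [b] of the inner norms is kept positive, so that its negative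
   powers are meaningful where the inner norm vanishes. *)
Lemma minkowski_le :
  {ae m2, forall z, (\int[m1]_y (Phi z y `^ Q)%:E <= (b z `^ Q)%:E)%E} ->
  (\int[m1]_y poweR (\int[m2]_z (Phi z y)%:E) Q <= (B `^ Q)%:E)%E.
Proof.
move=> Phib.
have BQ : 0 <= B `^ (Q - 1) by exact: powR_ge0.
have mP1 := mswap (F := fun z y => (b z `^ (1 - Q) * Phi z y `^ Q)%:E) mP.
have mPhi1 := mswap (F := fun z y => (Phi z y)%:E) mPhiE.
have P0 z y : (0 <= (b z `^ (1 - Q) * Phi z y `^ Q)%:E)%E.
  by rewrite lee_fin mulr_ge0 ?powR_ge0.
have mI : measurable_fun setT (fun y => \int[m2]_z (Phi z y)%:E)%E.
  exact: (measurable_integral2 m2 (f := fun y z => (Phi z y)%:E) mPhi1).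
have mI2 : measurable_fun setT (fun y => \int[m2]_z (b z `^ (1 - Q) * Phi z y `^ Q)%:E)%E.
  exact: (measurable_integral2 m2 (f := fun y z => (b z `^ (1 - Q) * Phi z y `^ Q)%:E) mP1).
have mI3 : measurable_fun setT (fun z => \int[m1]_y (b z `^ (1 - Q) * Phi z y `^ Q)%:E)%E.
  exact: (measurable_integral2 m1 (f := fun z y => (b z `^ (1 - Q) * Phi z y `^ Q)%:E) mP).
apply: (@le_trans _ _ (\int[m1]_y ((B `^ (Q - 1))%:E *
    \int[m2]_z (b z `^ (1 - Q) * Phi z y `^ Q)%:E))%E).
  apply: ge0_le_integral => //.
  - by move=> y _; exact: poweR_ge0.
  - exact: (measurableT_comp (measurable_poweR Q) mI).
  - exact: measurable_funeM.
rewrite ge0_integralZl//; last by move=> y _; exact: integral_ge0.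
rewrite (tonelli_swap m1 m2 (F := fun y z => (b z `^ (1 - Q) * Phi z y `^ Q)%:E) mP1)//.
apply: (@le_trans _ _ ((B `^ (Q - 1))%:E * \int[m2]_z (b z)%:E)%E).
  apply: lee_wpmul2l => //.
  apply: ae_ge0_le_integral => //.
  - by move=> z _; exact: integral_ge0.
  - by move=> z _; rewrite lee_fin ltW.
  - exact/measurable_EFinP.
  move: Phib; apply: filterS => z zb _.
  have mz : measurable_fun setT (fun y => (Phi z y `^ Q)%:E).
    apply/measurable_EFinP; apply: (measurableT_comp (measurable_powR Q)).
    exact: (measurable_slice1 (f := Phi) _ mPhi).
  rewrite (_ : (b z)%:E = (b z `^ (1 - Q))%:E * (b z `^ Q)%:E)%E; last first.
    rewrite -EFinM -powRD ?subrK ?powRr1 ?(ltW (b0 z))//.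
    by rewrite (gt_eqF (b0 z)) implybT.
  apply: (@le_trans _ _ ((b z `^ (1 - Q))%:E * \int[m1]_y (Phi z y `^ Q)%:E)%E).
    rewrite -ge0_integralZl ?lee_fin ?powR_ge0//.
    by move=> y _; rewrite lee_fin powR_ge0.
  by apply: lee_wpmul2l => //; rewrite lee_fin powR_ge0.
apply: (@le_trans _ _ ((B `^ (Q - 1))%:E * B%:E)%E).
  by apply: lee_wpmul2l => //; rewrite lee_fin.
rewrite -EFinM lee_fin -{2}[B](powRr1 (ltW B0)) -powRD ?subrK//.
by rewrite (gt_eqF B0) implybT.
Qed.

End minkowski.

Section ereal_tools.
Variable R : realType.

Lemma le_poweR (a b : \bar R) (e : R) : 0 <= e -> (0 <= a)%E -> (a <= b)%E ->
  (poweR a e <= poweR b e)%E.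
Proof.
move=> e0 a0 ab; apply: gt0_ler_poweR => //; rewrite in_itv /= leey andbT//.
exact: le_trans ab.
Qed.

(** Removes the margin [e * k] that is added to keep the majorants of [minkowski_le] strictly
    positive. *)
Lemma lee_mulDgt0 (X : \bar R) (a c k : R) : 0 <= a -> 0 < k ->
  (forall e : R, 0 < e -> (X <= (a * (c + e * k))%:E)%E) -> (X <= (a * c)%:E)%E.
Proof.
move=> a0 k0 H; apply/lee_addgt0Pr => e e0.
have a1 : 0 < a + 1 by rewrite ltr_wpDl.
have d0 : 0 < e / ((a + 1) * k) by rewrite divr_gt0 ?mulr_gt0.
apply: le_trans (H _ d0) _; rewrite -EFinD lee_fin mulrDr lerD2l.
rewrite (_ : _ * _ = a / (a + 1) * e); last by field; rewrite !gt_eqF.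
by rewrite ler_piMl ?(ltW e0)// ler_pdivrMr// mul1r lerDl.
Qed.

Lemma poweRK (X : \bar R) (a b : R) : (0 <= X)%E -> a * b = 1 -> poweR (poweR X a) b = X.
Proof. by move=> X0 ab; rewrite -poweRrM ab poweRe1. Qed.

End ereal_tools.

(** * Mixed norms with a finite inner exponent *)

Section mixed_norms.
Variables (R : realType) (n : nat) (sg : R).
Hypothesis nsg : n%:R < sg.
Implicit Types (x y z w t u v xi : 'rV[R]_n).

Let J : R := (\int[lebn R n]_t jw sg t)%R.

Let J0 : 0 <= J. Proof. by apply: Rintegral_ge0 => t _; exact: jw_ge0. Qed.
Let J1 : 0 < J + 1. Proof. by rewrite ltr_wpDl. Qed.

Let mjw : measurable_fun setT (fun t : 'rV[R]_n => (jw sg t)%:E).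
Proof. by apply/measurable_EFinP; exact: measurable_jw. Qed.

Lemma integral_jw : (\int[lebn R n]_t (jw sg t)%:E = J%:E)%E.
Proof. by rewrite /J /Rintegral fineK//; exact: integrable_fin_num (integrable_jw nsg). Qed.

Lemma integral_jw_sub x : (\int[lebn R n]_t (jw sg (t - x))%:E = J%:E)%E.
Proof.
rewrite (ge0_integral_lebn_shift (- x) mjw) ?integral_jw// => t.
by rewrite lee_fin jw_ge0.
Qed.

Lemma measurable_jw_sub x : measurable_fun setT (fun w : 'rV[R]_n => jw sg (w - x)).
Proof. exact: (measurableT_comp (measurable_jw sg) (measurable_subv x)). Qed.

Lemma measurable_add_pair d (T : measurableType d) (p q : T -> 'rV[R]_n) (f : 'rV[R]_n -> R) :
  measurable_fun setT f -> measurable_fun setT p -> measurable_fun setT q ->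
  measurable_fun setT (fun s => f (p s + q s)).
Proof. by move=> mf mp mq; apply: (measurableT_comp mf); exact: measurable_rVD. Qed.

(** Young's inequality for L^1 and L^Q, by Minkowski's inequality in [t]: every translate of [Psi]
    has the norm of [Psi]. A positive majorant [be] stands for that norm. *)
Lemma convolution_Lp (Q be : R) (Psi : 'rV[R]_n -> R) : 1 <= Q -> measurable_fun setT Psi ->
  (forall v, 0 <= Psi v) -> 0 < be ->
  (\int[lebn R n]_v (Psi v `^ Q)%:E <= (be `^ Q)%:E)%E ->
  (\int[lebn R n]_xi poweR (\int[lebn R n]_t (jw sg t * Psi (xi + t))%:E) Q <=
   (((J + 1) * be) `^ Q)%:E)%E.
Proof.
move=> Q1 mPsi Psi0 be0 Psible.
have mPhi : measurable_fun setT (fun p : 'rV[R]_n * 'rV[R]_n => jw sg p.1 * Psi (p.2 + p.1)).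
  apply: measurable_funM; first exact: (measurableT_comp (measurable_jw sg) measurable_fst).
  by apply: measurable_add_pair.
apply: (minkowski_le (m1 := lebn R n) (m2 := lebn R n) (Phi := fun t xi => jw sg t * Psi (xi + t))
  (b := fun t => jw sg t * be) Q1 mPhi).
- by move=> t xi; rewrite mulr_ge0 ?jw_ge0.
- by apply: measurable_funM; [exact: measurable_jw|exact: measurable_cst].
- by move=> t; rewrite mulr_gt0 ?jw_gt0.
- by rewrite mulr_gt0.
- under eq_integral do rewrite mulrC EFinM.
  rewrite ge0_integralZl ?lee_fin ?(ltW be0)//; last by move=> t _; rewrite lee_fin jw_ge0.
  by rewrite integral_jw -EFinM lee_fin mulrC ler_wpM2r ?(ltW be0)// lerDl.
apply: aeW => t.
have mPQ : measurable_fun setT (fun v => (Psi v `^ Q)%:E).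
  by apply/measurable_EFinP; exact: (measurableT_comp (measurable_powR Q)).
under eq_integral do rewrite powRM ?jw_ge0// EFinM.
have PQ0 v : (0 <= (Psi v `^ Q)%:E)%E by rewrite lee_fin powR_ge0.
rewrite ge0_integralZl ?lee_fin ?powR_ge0//; last first.
  by apply: (measurableT_comp mPQ); apply: measurable_rVD => //; exact: measurable_cst.
rewrite (ge0_integral_lebn_shift t mPQ PQ0).
rewrite powRM ?jw_ge0 ?(ltW be0)// EFinM; apply: lee_wpmul2l => //.
by rewrite lee_fin powR_ge0.
Qed.

Section finite_exponent.
Variables (q r Bd C : R) (F : 'rV[R]_n -> 'rV[R]_n -> R) (g : 'rV[R]_n -> R) (x : 'rV[R]_n).
Hypotheses (r0 : 0 < r) (rq : r <= q) (C0 : 0 < C).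
Hypotheses (mF : measurable_fun setT (fun p : 'rV[R]_n * 'rV[R]_n => F p.1 p.2)).
Hypotheses (FB : forall w v, 0 <= F w v <= Bd) (mg : measurable_fun setT g).
Hypothesis gF : forall xi, ((g xi `^ r)%:E <= C%:E *
  \int[lebn R n]_t \int[lebn R n]_w (jw sg t * (jw sg (w - x) * F w (xi + t) `^ r))%:E)%E.

(** The [r]-th power of the L^q norm of [F w], which is also the L^Q norm of (F w)^r for
    [Q = q / r]. *)
Let N w : \bar R := poweR (\int[lebn R n]_v (F w v `^ q)%:E) (r / q).
Let Q := q / r.
Let q0 : 0 < q. Proof. exact: lt_le_trans rq. Qed.
Let Q1 : 1 <= Q. Proof. by rewrite ler_pdivlMr// mul1r. Qed.
Let Q0 : 0 < Q. Proof. exact: lt_le_trans Q1. Qed.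
Let F0 w v : 0 <= F w v. Proof. by case/andP: (FB w v). Qed.
Let QV : Q^-1 = r / q. Proof. by rewrite invf_div. Qed.

Let Psi v : R := (\int[lebn R n]_w (jw sg (w - x) * F w v `^ r))%R.

Let mFr (a : R) : measurable_fun setT (fun p : 'rV[R]_n * 'rV[R]_n => F p.1 p.2 `^ a).
Proof. exact: (measurableT_comp (measurable_powR a) mF). Qed.

Let mjF : measurable_fun setT (fun p : 'rV[R]_n * 'rV[R]_n => jw sg (p.1 - x) * F p.1 p.2 `^ r).
Proof.
apply: measurable_funM => //.
exact: (measurableT_comp (measurable_jw_sub x) measurable_fst).
Qed.

Let mjF' : measurable_fun setT (fun p : 'rV[R]_n * 'rV[R]_n => jw sg (p.2 - x) * F p.2 p.1 `^ r).
Proof.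
apply: (measurableT_comp mjF (g := fun p : 'rV[R]_n * 'rV[R]_n => (p.2, p.1))).
by apply: measurable_fun_pair; [exact: measurable_snd|exact: measurable_fst].
Qed.

Let jF0 v w : 0 <= jw sg (w - x) * F w v `^ r.
Proof. by rewrite mulr_ge0 ?jw_ge0 ?powR_ge0. Qed.

(** Boundedness of [F] makes the integral in [w] finite, so that [Psi] may be treated as a real
    function. *)
Let PsiE v : ((Psi v)%:E = \int[lebn R n]_w (jw sg (w - x) * F w v `^ r)%:E)%E.
Proof.
rewrite /Psi /Rintegral fineK// ge0_fin_numE; last first.
  by apply: integral_ge0 => w _; rewrite lee_fin.
have Bd0 : 0 <= Bd by case/andP: (FB 0 0) => a b; exact: le_trans b.
apply: (@le_lt_trans _ _ ((Bd `^ r)%:E * \int[lebn R n]_w (jw sg (w - x))%:E)%E).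
  rewrite -ge0_integralZl; last 4 first.
  - exact: measurableT.
  - by apply/measurable_EFinP; exact: measurable_jw_sub.
  - by move=> w _; rewrite lee_fin jw_ge0.
  - by rewrite lee_fin powR_ge0.
  apply: ge0_le_integral => //.
  - by move=> w _; rewrite lee_fin.
  - apply/measurable_EFinP.
    exact: (measurable_slice2 (f := fun w v => jw sg (w - x) * F w v `^ r) _ mjF).
  - by apply: measurable_funeM; apply/measurable_EFinP; exact: measurable_jw_sub.
  move=> w _; rewrite -EFinM lee_fin mulrC ler_wpM2r ?jw_ge0//.
  by apply: ge0_ler_powR; rewrite ?nnegrE ?(ltW r0)//; case/andP: (FB w v).
by rewrite integral_jw_sub -EFinM ltry.
Qed.

Let mPsi : measurable_fun setT Psi.
Proof. exact: (measurable_Rintegral2 (lebn R n) (f := fun v w => jw sg (w - x) * F w v `^ r) mjF'). Qed.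

Let Psi0 v : 0 <= Psi v. Proof. by apply: Rintegral_ge0 => w _. Qed.

Let I0 w : (0 <= \int[lebn R n]_v (F w v `^ q)%:E)%E.
Proof. by apply: integral_ge0 => v _; rewrite lee_fin powR_ge0. Qed.

Let mN : measurable_fun setT N.
Proof.
apply: (measurableT_comp (measurable_poweR (r / q))).
apply: (measurable_integral2 (lebn R n) (f := fun w v => (F w v `^ q)%:E)).
exact/measurable_EFinP.
Qed.

Let N0 w : (0 <= N w)%E. Proof. exact: poweR_ge0. Qed.

Let D : \bar R := (\int[lebn R n]_w ((jw sg (w - x))%:E * N w))%E.

Let mjN : measurable_fun setT (fun w => ((jw sg (w - x))%:E * N w)%E).
Proof.
by apply: emeasurable_funM => //; apply/measurable_EFinP; exact: measurable_jw_sub.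
Qed.

Let jN0 w : (0 <= (jw sg (w - x))%:E * N w)%E.
Proof. by rewrite mule_ge0 ?lee_fin ?jw_ge0. Qed.

(** Minkowski's inequality in [w], with [N w] as inner norm and [D] as their weighted integral. The
    margin [e] keeps the majorant positive where [N] vanishes. *)
Let Psi_Lp (d e : R) : D = d%:E -> 0 < e ->
  (\int[lebn R n]_v (Psi v `^ Q)%:E <= ((d + e * (J + 1)) `^ Q)%:E)%E.
Proof.
move=> Dd e0.
have d0 : 0 <= d by rewrite -lee_fin -Dd; apply: integral_ge0.
have mfN : measurable_fun setT (fun w => fine (N w)).
  by apply: (measurableT_comp (f := fine)) => //; exact: fine_measurable.
have fN0 w : 0 <= fine (N w) by exact: fine_ge0.
suff H : (\int[lebn R n]_v poweR (\int[lebn R n]_w (jw sg (w - x) * F w v `^ r)%:E) Q <=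
    ((d + e * (J + 1)) `^ Q)%:E)%E.
  apply: le_trans H; rewrite le_eqVlt; apply/orP; left; apply/eqP.
  by apply: eq_integral => v _; rewrite -PsiE poweR_EFin.
apply: (minkowski_le (m1 := lebn R n) (m2 := lebn R n)
  (Phi := fun w v => jw sg (w - x) * F w v `^ r)
  (b := fun w => jw sg (w - x) * (fine (N w) + e)) (B := d + e * (J + 1)) Q1 mjF).
- by move=> w v; exact: jF0.
- apply: measurable_funM; first exact: measurable_jw_sub.
  by apply: measurable_funD => //; exact: measurable_cst.
- by move=> w; rewrite mulr_gt0 ?jw_gt0// ltr_wpDl.
- by rewrite ltr_wpDl// mulr_gt0.
- apply: (@le_trans _ _ (\int[lebn R n]_w ((jw sg (w - x))%:E * N w +
      e%:E * (jw sg (w - x))%:E))%E).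
    apply: ge0_le_integral => //.
    + by move=> w _; rewrite lee_fin mulr_ge0 ?jw_ge0// addr_ge0// ltW.
    + apply/measurable_EFinP; apply: measurable_funM; first exact: measurable_jw_sub.
      by apply: measurable_funD => //; exact: measurable_cst.
    + apply: emeasurable_funD => //; apply: measurable_funeM.
      by apply/measurable_EFinP; exact: measurable_jw_sub.
    move=> w _; rewrite mulrDr EFinD (mulrC _ e) !EFinM leeD2r//.
    apply: lee_wpmul2l; first by rewrite lee_fin jw_ge0.
    by have := N0 w; case: (N w) => //= _; rewrite leey.
  rewrite ge0_integralD//; last 2 first.
  + by move=> w _; rewrite mule_ge0 ?lee_fin ?jw_ge0 ?(ltW e0).
  + by apply: measurable_funeM; apply/measurable_EFinP; exact: measurable_jw_sub.
  rewrite -/D Dd ge0_integralZl ?lee_fin ?(ltW e0)//; last 2 first.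
  + by apply/measurable_EFinP; exact: measurable_jw_sub.
  + by move=> w _; rewrite lee_fin jw_ge0.
  rewrite integral_jw_sub -EFinM -EFinD lee_fin lerD2l ler_wpM2l ?(ltW e0)//.
  by rewrite lerDl.
(* Finiteness of [D] makes [N] finite almost everywhere, and there [fine (N w)] is the true inner
   norm. *)
have iN : (lebn R n).-integrable setT (fun w => ((jw sg (w - x))%:E * N w)%E).
  apply/integrableP; split => //.
  under eq_integral => w _ do rewrite gee0_abs//.
  by rewrite -/D Dd ltry.
have := integrable_ae measurableT iN; apply: filterS => w /(_ I) /= jNf.
have Nf : N w \is a fin_num.
  move: jNf; have := N0 w; case: (N w) => //= _.
  by rewrite mulry gtr0_sg ?jw_gt0// mul1e.
have mFq : measurable_fun setT (fun v => (F w v `^ q)%:E).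
  apply/measurable_EFinP.
  exact: (measurable_slice1 (f := fun w v => F w v `^ q) _ (mFr q)).
apply: (@le_trans _ _ ((jw sg (w - x) `^ Q)%:E * \int[lebn R n]_v (F w v `^ q)%:E)%E).
  rewrite -ge0_integralZl ?lee_fin ?powR_ge0//; last by move=> v _; rewrite lee_fin powR_ge0.
  rewrite le_eqVlt; apply/orP; left; apply/eqP.
  apply: eq_integral => v _.
  rewrite powRM ?jw_ge0 ?powR_ge0// -EFinM -powRrM /Q (mulrC r) divfK//.
  by rewrite gt_eqF.
rewrite -(@poweRK _ (\int[lebn R n]_v (F w v `^ q)%:E)%E (r / q) Q) ?I0//; last first.
  by rewrite -QV mulVf// gt_eqF.
rewrite -/(N w) -(fineK Nf) poweR_EFin -EFinM lee_fin -powRM ?jw_ge0//.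
rewrite fineK//; apply: ge0_ler_powR; rewrite ?nnegrE ?(ltW Q0) ?mulr_ge0 ?jw_ge0 ?addr_ge0 ?(ltW e0)//.
by rewrite ler_wpM2l ?jw_ge0// lerDl ltW.
Qed.

(* Minkowski's inequality is used for the integral in [w] and for that in [t]. *)
Lemma mixed_norm_fin : (poweR (\int[lebn R n]_xi (g xi `^ q)%:E) (r / q) <=
  (C * (J + 1))%:E * D)%E.
Proof.
have CJ : 0 < C * (J + 1) by rewrite mulr_gt0.
have D0 : (0 <= D)%E by apply: integral_ge0.
case ED : D D0 => [d| |] // D0; last by rewrite mulry gtr0_sg// mul1e leey.
rewrite -EFinM; apply: (lee_mulDgt0 (k := J + 1)) => //; first exact: ltW.
move=> e e0; rewrite lee_fin in D0.
set be := d + e * (J + 1).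
have be0 : 0 < be by rewrite ltr_wpDl// mulr_gt0.
have conv := convolution_Lp Q1 mPsi Psi0 be0 (Psi_Lp ED e0).
have mconv : measurable_fun setT (fun xi => \int[lebn R n]_t (jw sg t * Psi (xi + t))%:E)%E.
  apply: (measurable_integral2 (lebn R n) (f := fun xi t => (jw sg t * Psi (xi + t))%:E)).
  apply/measurable_EFinP; apply: measurable_funM.
    exact: (measurableT_comp (measurable_jw sg) measurable_snd).
  by apply: measurable_add_pair.
have conv0 xi : (0 <= \int[lebn R n]_t (jw sg t * Psi (xi + t))%:E)%E.
  by apply: integral_ge0 => t _; rewrite lee_fin mulr_ge0 ?jw_ge0.
have gc xi : ((g xi `^ r)%:E <= C%:E * \int[lebn R n]_t (jw sg t * Psi (xi + t))%:E)%E.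
  apply: le_trans (gF xi) _; apply: lee_wpmul2l; first by rewrite lee_fin ltW.
  rewrite le_eqVlt; apply/orP; left; apply/eqP.
  apply: eq_integral => t _; rewrite EFinM PsiE -ge0_integralZl //.
  - apply/measurable_EFinP.
    exact: (measurable_slice2 (f := fun w v => jw sg (w - x) * F w v `^ r) _ mjF).
  - by move=> w _; rewrite lee_fin.
  - by rewrite lee_fin jw_ge0.
have gq : (\int[lebn R n]_xi (g xi `^ q)%:E <= ((C * (J + 1) * be) `^ Q)%:E)%E.
  rewrite -mulrA powRM ?(ltW C0) ?mulr_ge0 ?(ltW be0) ?(ltW J1)// EFinM.
  apply: (@le_trans _ _ ((C `^ Q)%:E *
    \int[lebn R n]_xi poweR (\int[lebn R n]_t (jw sg t * Psi (xi + t))%:E) Q)%E); last first.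
    by apply: lee_wpmul2l => //; rewrite lee_fin powR_ge0.
  rewrite -ge0_integralZl; last 4 first.
  - exact: measurableT.
  - exact: (measurableT_comp (measurable_poweR Q) mconv).
  - by move=> xi _; exact: poweR_ge0.
  - by rewrite lee_fin powR_ge0.
  apply: ge0_le_integral => //.
  - by move=> xi _; rewrite lee_fin powR_ge0.
  - by apply/measurable_EFinP; exact: (measurableT_comp (measurable_powR q)).
  - by apply: measurable_funeM; exact: (measurableT_comp (measurable_poweR Q) mconv).
  have CE : (0 <= C%:E)%E by rewrite lee_fin ltW.
  move=> xi _; rewrite -(poweR_EFin C Q) -(poweRM Q CE (conv0 xi)).
  rewrite (_ : (g xi `^ q)%:E = poweR (g xi `^ r)%:E Q); last first.
    by rewrite poweR_EFin -powRrM /Q (mulrC r) divfK// gt_eqF.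
  by apply: le_poweR => //; [exact: ltW|rewrite lee_fin powR_ge0].
apply: (@le_trans _ _ (poweR ((C * (J + 1) * be) `^ Q)%:E (r / q))).
  apply: le_poweR => //; first by rewrite divr_ge0 ?(ltW r0) ?(ltW q0).
  by apply: integral_ge0 => xi _; rewrite lee_fin powR_ge0.
rewrite poweR_EFin -powRrM -QV mulfV ?gt_eqF// powRr1//.
by rewrite mulr_ge0 ?(ltW CJ) ?(ltW be0).
Qed.

End finite_exponent.
End mixed_norms.

(** * Essential suprema and the norms of the statement *)

Section essential_supremum.
Variables (R : realType) (n : nat).
Implicit Types (x v xi : 'rV[R]_n).

(** On a null space every essential supremum would be [-oo]; positivity of the measure makes those
    of nonnegative functions nonnegative. *)
Lemma lebn_setT_gt0 : (0 < lebn R n setT)%E.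
Proof.
rewrite lt0e measure_ge0 andbT; apply/negP => /eqP l0.
have := Rintegral_gauss1 R n; rewrite /Rintegral null_set_integral//.
- by move=> /eqP; rewrite eq_sym oner_eq0.
- by apply/measurable_EFinP; exact: measurable_gauss.
Qed.

(** The essential supremum of [F w] exceeds [c] exactly when the set where [F w] exceeds [c] has
    positive measure, and that measure is measurable in [w] by Tonelli. *)
Lemma measurable_ess_sup d (T : measurableType d) (m : {sigma_finite_measure set 'rV[R]_n -> \bar R})
    (F : T -> 'rV[R]_n -> R) :
  measurable_fun setT (fun p : T * 'rV[R]_n => F p.1 p.2) ->
  measurable_fun setT (fun w => ess_sup m (fun v => (F w v)%:E)).
Proof.
move=> mF; apply: (measurability _ (ErealGenOInfty.measurableE R)).
move=> /= _ [_ [c ->]] <-; apply: measurableI => //; rewrite preimage_itvoy.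
pose A := [set p : T * 'rV[R]_n | c < F p.1 p.2].
have mA : measurable A.
  have -> : A = setT `&` (fun p => F p.1 p.2) @^-1` `]c, +oo[%classic.
    by rewrite setTI; apply/seteqP; split => p /=; rewrite in_itv /= andbT.
  by apply: mF => //; exact: measurable_itv.
pose I w := (\int[m]_v (\1_A (w, v))%:E)%E.
have mI : measurable_fun setT I.
  apply: (measurable_integral2 m (f := fun w v => (\1_A (w, v))%:E)).
  apply/measurable_EFinP.
  rewrite (_ : (fun p => _) = \1_A); first exact: measurable_indic.
  by apply/funext => -[].
have mc w : measurable [set v | c < F w v].
  have -> : [set v | c < F w v] = setT `&` F w @^-1` `]c, +oo[%classic.
    by rewrite setTI; apply/seteqP; split => p /=; rewrite in_itv /= andbT.
  by apply: (measurable_slice1 w mF) => //; exact: measurable_itv.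
have IE w : I w = m [set v | c < F w v].
  transitivity (\int[m]_v (\1_[set v | c < F w v] v)%:E)%E.
    by apply: eq_integral => v _; rewrite !indicE; congr (_%:R%:E); apply/idP/idP; rewrite !inE.
  by rewrite integral_indic ?setIT//; exact: mc.
rewrite [X in measurable X](_ : _ = ~` [set w | (I w <= 0)%E]); last first.
  apply/seteqP; split => w /= h.
    move=> I0; move: h; rewrite ltNge => /negP; apply; apply/ess_supP.
    exists [set v | c < F w v]; split => //.
    - by apply/eqP; rewrite eq_le measure_ge0 andbT; move: I0; rewrite IE.
    - by move=> v /= /negP; rewrite lee_fin -ltNge.
  rewrite ltNge; apply/negP => /ess_supP [B [mB B0 cB]]; apply: h; rewrite IE -B0.
  apply: le_measure; rewrite ?inE//.
  by move=> v /= cv; apply: cB; rewrite /= lee_fin => /(lt_le_trans cv); rewrite ltxx.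
apply: measurableC.
by rewrite -[X in measurable X]setTI; exact: emeasurable_fun_infty_c.
Qed.

Lemma lebRnE (A : set 'rV[R]_n) : measurable A -> lebRn A = lebn R n A.
Proof.
move=> mA; rewrite /lebRn intRnE//; first by rewrite integral_indic ?setIT.
by apply/measurable_EFinP; exact: measurable_indic.
Qed.

Lemma LqRn_ess_sup (H : 'rV[R]_n -> \bar R) : measurable_fun setT H ->
  LqRn +oo%E H = ess_sup (lebn R n) H.
Proof.
move=> mH; rewrite ess_supEmu0//= /esssupRn; congr ereal_inf.
apply/seteqP; split => c /=; rewrite lebRnE ?preimage_itvoy//;
  by rewrite -[X in measurable X]setTI; exact: emeasurable_fun_o_infty.
Qed.

Lemma LqRn_fin (H : 'rV[R]_n -> \bar R) (q : R) : measurable_fun setT H ->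
  LqRn q%:E H = poweR (\int[lebn R n]_x poweR (H x) q) q^-1.
Proof.
move=> mH; rewrite /= intRnE//.
  exact: (measurableT_comp (measurable_poweR q) mH).
by move=> x; exact: poweR_ge0.
Qed.

Lemma LqRn_ge0 (H : 'rV[R]_n -> \bar R) (q : \bar R) : measurable_fun setT H ->
  (forall x, (0 <= H x)%E) -> (0 <= LqRn q H)%E.
Proof.
move=> mH H0; case: q => [q| |]; first by rewrite LqRn_fin// poweR_ge0.
  by rewrite LqRn_ess_sup//; apply: ess_sup_gee; [exact: lebn_setT_gt0|exact: aeW].
by [].
Qed.

Lemma measurable_LqRn d (T : measurableType d) (F : T -> 'rV[R]_n -> R) (q : \bar R) :
  measurable_fun setT (fun p : T * 'rV[R]_n => F p.1 p.2) ->
  measurable_fun setT (fun w => LqRn q (fun v => (F w v)%:E)).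
Proof.
move=> mF; have mw w : measurable_fun setT (fun v => (F w v)%:E).
  by apply/measurable_EFinP; exact: measurable_slice1.
case: q => [q| |].
- under eq_fun do rewrite LqRn_fin//.
  apply: (measurableT_comp (measurable_poweR _)).
  apply: (measurable_integral2 (lebn R n) (f := fun w v => poweR (F w v)%:E q)).
  by apply: (measurableT_comp (measurable_poweR q)); exact/measurable_EFinP.
- by under eq_fun do rewrite LqRn_ess_sup//; exact: measurable_ess_sup.
- exact: measurable_cst.
Qed.

End essential_supremum.

(** * Mixed norms for all exponents *)

Section mixed_norm.
Variables (R : realType) (n : nat) (sg : R).
Hypothesis nsg : n%:R < sg.
Implicit Types (x y z w t u v xi : 'rV[R]_n).

Let J : R := (\int[lebn R n]_t jw sg t)%R.
Let J0 : 0 <= J. Proof. by apply: Rintegral_ge0 => t _; exact: jw_ge0. Qed.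
Let J1 : 0 < J + 1. Proof. by rewrite ltr_wpDl. Qed.

Let mjw : measurable_fun setT (fun t : 'rV[R]_n => (jw sg t)%:E).
Proof. by apply/measurable_EFinP; exact: measurable_jw. Qed.

Let mjwx x : measurable_fun setT (fun w : 'rV[R]_n => (jw sg (w - x))%:E).
Proof. by apply/measurable_EFinP; exact: measurable_jw_sub. Qed.

Let jwx0 x w : (0 <= (jw sg (w - x))%:E)%E.
Proof. by rewrite lee_fin jw_ge0. Qed.

(** For infinite [q] Minkowski's inequality is replaced by bounding the translates of [F w] almost
    everywhere by the essential supremum, which is translation invariant. *)
Lemma mixed_norm_le (q : \bar R) (r Bd C : R) (F : 'rV[R]_n -> 'rV[R]_n -> R)
    (g : 'rV[R]_n -> R) x : 0 < r -> (r%:E <= q)%E -> 0 < C ->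
  measurable_fun setT (fun p : 'rV[R]_n * 'rV[R]_n => F p.1 p.2) ->
  (forall w v, 0 <= F w v <= Bd) -> measurable_fun setT g -> (forall xi, 0 <= g xi) ->
  (forall xi, ((g xi `^ r)%:E <= C%:E *
    \int[lebn R n]_t \int[lebn R n]_w (jw sg t * (jw sg (w - x) * F w (xi + t) `^ r))%:E)%E) ->
  (poweR (LqRn q (fun xi => (g xi)%:E)) r <= (C * (J + 1))%:E *
    \int[lebn R n]_w ((jw sg (w - x))%:E * poweR (LqRn q (fun v => (F w v)%:E)) r))%E.
Proof.
move=> r0 rq C0 mF FB mg g0 gF.
have F0 w v : 0 <= F w v by case/andP: (FB w v).
have mgE : measurable_fun setT (fun xi => (g xi)%:E) by exact/measurable_EFinP.
have mFw w : measurable_fun setT (fun v => (F w v)%:E).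
  by apply/measurable_EFinP; exact: (measurable_slice1 (f := F) w mF).
have CJ : 0 < C * (J + 1) by rewrite mulr_gt0.
case: q rq => [q rq| _|//].
  rewrite lee_fin in rq; have q0 : 0 < q by exact: lt_le_trans rq.
  have E (h : 'rV[R]_n -> R) : measurable_fun setT (fun v => (h v)%:E) ->
      poweR (LqRn q%:E (fun v => (h v)%:E)) r =
      poweR (\int[lebn R n]_v (h v `^ q)%:E)%E (r / q).
    move=> mh; rewrite LqRn_fin// -poweRrM mulrC; congr poweR.
  rewrite E//; apply: le_trans (mixed_norm_fin nsg r0 rq C0 mF FB mg gF) _.
  rewrite le_eqVlt; apply/orP; left; apply/eqP; congr (_ * _)%E.
  by apply: eq_integral => w _; rewrite E.
pose N w := ess_sup (lebn R n) (fun v => (F w v)%:E).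
have NE w : LqRn +oo%E (fun v => (F w v)%:E) = N w by exact: LqRn_ess_sup.
under eq_integral => w _ do rewrite NE.
rewrite LqRn_ess_sup//.
have mN : measurable_fun setT N by exact: measurable_ess_sup.
have N0 w : (0 <= poweR (N w) r)%E by exact: poweR_ge0.
have mNr : measurable_fun setT (fun w => poweR (N w) r).
  exact: (measurableT_comp (measurable_poweR r) mN).
set D := (\int[lebn R n]_w _)%E.
have D0 : (0 <= D)%E by apply: integral_ge0 => w _; exact: mule_ge0.
case ED : D D0 => [d| |] // D0; last by rewrite mulry gtr0_sg// mul1e leey.
rewrite lee_fin in D0.
have mjN : measurable_fun setT (fun w => (jw sg (w - x))%:E * poweR (N w) r)%E.
  exact: emeasurable_funM.
have bound xi : (\int[lebn R n]_t \int[lebn R n]_w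
    (jw sg t * (jw sg (w - x) * F w (xi + t) `^ r))%:E <= (J * d)%:E)%E.
  have mFr : measurable_fun setT (fun p : 'rV[R]_n * 'rV[R]_n =>
      (jw sg p.1 * (jw sg (p.2 - x) * F p.2 (xi + p.1) `^ r))%:E).
    apply/measurable_EFinP; apply: measurable_funM.
      exact: (measurableT_comp (measurable_jw sg) measurable_fst).
    apply: measurable_funM.
      exact: (measurableT_comp (measurable_jw_sub sg x) measurable_snd).
    apply: (measurableT_comp (measurable_powR r)).
    apply: (measurableT_comp mF (g := fun p : 'rV[R]_n * 'rV[R]_n => (p.2, xi + p.1))).
    apply: measurable_fun_pair; first exact: measurable_snd.
    have mxt : measurable_fun setT (fun t : 'rV[R]_n => xi + t).
      by apply: measurable_rVD => //; exact: measurable_cst.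
    exact: (measurableT_comp mxt measurable_fst).
  (* The null set of [t] where [F w (xi + t)] exceeds its essential supremum depends on [w], so the
     integral in [t] has to be the inner one. *)
  rewrite (tonelli_swap (lebn R n) (lebn R n)
    (F := fun t w => (jw sg t * (jw sg (w - x) * F w (xi + t) `^ r))%:E) mFr); last first.
    by move=> t w; rewrite lee_fin !mulr_ge0 ?jw_ge0 ?powR_ge0.
  have -> : ((J * d)%:E = \int[lebn R n]_w (J%:E * ((jw sg (w - x))%:E * poweR (N w) r)))%E.
    by rewrite ge0_integralZl//; [rewrite -/D ED|move=> w _; exact: mule_ge0].
  apply: ge0_le_integral => //.
  - move=> w _; apply: integral_ge0 => t _.
    by rewrite lee_fin !mulr_ge0 ?jw_ge0 ?powR_ge0.
  - apply: (measurable_integral2 (lebn R n)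
      (f := fun w t => (jw sg t * (jw sg (w - x) * F w (xi + t) `^ r))%:E)).
    apply: (measurableT_comp mFr (g := fun p : 'rV[R]_n * 'rV[R]_n => (p.2, p.1))).
    by apply: measurable_fun_pair; [exact: measurable_snd|exact: measurable_fst].
  - exact: measurable_funeM.
  move=> w _; rewrite -(integral_jw nsg) muleC.
  have k0 : (0 <= (jw sg (w - x))%:E * poweR (N w) r)%E by exact: mule_ge0.
  rewrite -ge0_integralZl//; last by move=> t _; rewrite lee_fin jw_ge0.
  apply: ae_ge0_le_integral => //.
  - by move=> t _; rewrite lee_fin !mulr_ge0 ?jw_ge0 ?powR_ge0.
  - exact: (measurable_slice2 (f := fun t w => (jw sg t * (jw sg (w - x) * F w (xi + t) `^ r))%:E) w mFr).
  - by move=> t _; apply: mule_ge0 => //; rewrite lee_fin jw_ge0.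
  - exact: measurable_funeM.
  have := ae_lebn_shift xi (ess_sup_ge (lebn R n) (fun v => (F w v)%:E)).
  apply: filterS => t Ft _; rewrite (addrC xi) EFinM muleC; apply: lee_wpmul2r.
    by rewrite lee_fin jw_ge0.
  rewrite EFinM; apply: lee_wpmul2l => //; rewrite -poweR_EFin.
  by apply: le_poweR; [exact: ltW|rewrite lee_fin|exact: Ft].
pose X := (C * (J * d)) `^ r^-1.
have Jd : 0 <= C * (J * d) by rewrite !mulr_ge0 ?(ltW C0).
have gX xi : ((g xi)%:E <= X%:E)%E.
  have := gF xi => /le_trans/(_ (lee_wpmul2l _ (bound xi))).
  rewrite lee_fin => /(_ (ltW C0)); rewrite -EFinM !lee_fin => h.
  rewrite -[leLHS](powRr1 (g0 xi)) -(mulfV (lt0r_neq0 r0)) powRrM.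
  by apply: ge0_ler_powR; rewrite ?nnegrE ?invr_ge0 ?powR_ge0 ?(ltW r0).
apply: (@le_trans _ _ (poweR X%:E r)).
  apply: le_poweR; first exact: ltW.
    by apply: ess_sup_gee; [exact: lebn_setT_gt0|apply: aeW => xi; rewrite lee_fin].
  exact: ess_sup_ler.
rewrite poweR_EFin -EFinM lee_fin /X -powRrM mulVf ?gt_eqF// powRr1//.
by rewrite mulrA ler_wpM2r// ler_wpM2l ?(ltW C0)// lerDl.
Qed.

(** The outer norm: the hypothesis dominates M^r by the convolution of N^r with an integrable
    weight, Young's inequality applies in L^(p/r), and an [r]-th root is taken at the end. *)
Lemma convolution_LqRn (p : \bar R) (r C : R) (M N : 'rV[R]_n -> \bar R) :
  0 < r -> (r%:E <= p)%E -> 0 < C ->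
  measurable_fun setT M -> measurable_fun setT N ->
  (forall x, (0 <= M x)%E) -> (forall x, (0 <= N x)%E) ->
  (forall x, (poweR (M x) r <= C%:E *
    \int[lebn R n]_w ((jw sg (w - x))%:E * poweR (N w) r))%E) ->
  (LqRn p M <= ((C * (J + 1)) `^ r^-1)%:E * LqRn p N)%E.
Proof.
move=> r0 rp C0 mM mN M0 N0 MN.
have CJ : 0 < C * (J + 1) by rewrite mulr_gt0.
have C2 : 0 < (C * (J + 1)) `^ r^-1 by rewrite powR_gt0.
have rr : r * r^-1 = 1 by rewrite mulfV// gt_eqF.
have ri0 : 0 <= r^-1 by rewrite invr_ge0 ltW.
have mNr : measurable_fun setT (fun w => poweR (N w) r).
  exact: (measurableT_comp (measurable_poweR r) mN).
case: p rp => [p rp| _|//].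
  rewrite lee_fin in rp; have p0 : 0 < p by exact: lt_le_trans rp.
  pose Q := p / r.
  have Q1 : 1 <= Q by rewrite ler_pdivlMr// mul1r.
  have Q0 : 0 < Q by exact: lt_le_trans Q1.
  have rQ : r * Q = p by rewrite /Q mulrC divfK// gt_eqF.
  have QV : Q^-1 = r / p by rewrite invf_div.
  rewrite !LqRn_fin//.
  have mNp : measurable_fun setT (fun x => poweR (N x) p).
    exact: (measurableT_comp (measurable_poweR p) mN).
  have X0 : (0 <= \int[lebn R n]_x poweR (N x) p)%E.
    by apply: integral_ge0 => x _; exact: poweR_ge0.
  case EX : (\int[lebn R n]_x poweR (N x) p)%E X0 => [X| |] // X0; last first.
    by rewrite poweRyr ?gt_eqF ?invr_gt0// mulry gtr0_sg// mul1e leey.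
  rewrite lee_fin in X0.
  (* [N] takes extended values, but is finite almost everywhere once its norm is; the convolution
     inequality is applied to its real version. *)
  pose nu x := fine (N x).
  have nu0 x : 0 <= nu x by exact: fine_ge0.
  have mnu : measurable_fun setT nu.
    by apply: (measurableT_comp (f := fine)) => //; exact: fine_measurable.
  pose Psi x := nu x `^ r.
  have mPsi : measurable_fun setT Psi by exact: (measurableT_comp (measurable_powR r) mnu).
  have Nfin : {ae lebn R n, forall x, N x \is a fin_num}.
    have iN : (lebn R n).-integrable setT (fun x => poweR (N x) p).
      apply/integrableP; split => //.
      under eq_integral => x _ do rewrite gee0_abs ?poweR_ge0//.
      by rewrite EX ltry.
    have := integrable_ae measurableT iN; apply: filterS => x /(_ I).
    have := N0 x; case: (N x) => // _.
    by rewrite poweRyr// gt_eqF.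
  have PsiX : (\int[lebn R n]_x (Psi x `^ Q)%:E <= X%:E)%E.
    rewrite -EX; apply: ge0_le_integral => //.
    - by move=> x _; rewrite lee_fin powR_ge0.
    - by apply/measurable_EFinP; exact: (measurableT_comp (measurable_powR Q) mPsi).
    move=> x _; rewrite /Psi -powRrM rQ /nu.
    have := N0 x; case: (N x) => // _.
    by rewrite poweRyr ?gt_eqF// leey.
  pose K x := (\int[lebn R n]_u (jw sg u * Psi (x + u))%:E)%E.
  have mK : measurable_fun setT K.
    apply: (measurable_integral2 (lebn R n) (f := fun x u => (jw sg u * Psi (x + u))%:E)).
    apply/measurable_EFinP; apply: measurable_funM.
      exact: (measurableT_comp (measurable_jw sg) measurable_snd).
    by apply: measurable_add_pair.
  have K0 x : (0 <= K x)%E.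
    by apply: integral_ge0 => u _; rewrite lee_fin mulr_ge0 ?jw_ge0 ?powR_ge0.
  have KE x : (\int[lebn R n]_w ((jw sg (w - x))%:E * poweR (N w) r) = K x)%E.
    rewrite -(ge0_integral_lebn_shift x (F := fun w => ((jw sg (w - x))%:E * poweR (N w) r)%E)).
    - apply: ge0_ae_eq_integral => //.
      + apply: emeasurable_funM; first by under eq_fun do rewrite addrK.
        apply: (measurableT_comp mNr); apply: measurable_rVD => //; exact: measurable_cst.
      + apply/measurable_EFinP; apply: measurable_funM; first exact: measurable_jw.
        apply: (measurableT_comp mPsi); apply: measurable_rVD => //; exact: measurable_cst.
      + by move=> u _; rewrite mule_ge0 ?poweR_ge0.
      + by move=> u _; rewrite lee_fin mulr_ge0 ?jw_ge0 ?powR_ge0.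
      have := ae_lebn_shift x Nfin; apply: filterS => u Nu _.
      by rewrite addrK EFinM (addrC x) /Psi /nu -(poweR_EFin (fine (N (u + x))) r) fineK.
    - exact: emeasurable_funM.
    - by move=> w; rewrite mule_ge0 ?poweR_ge0.
  have step : (poweR (\int[lebn R n]_x poweR (M x) p) (r / p) <=
      (C * (J + 1) * X `^ Q^-1)%:E)%E.
    apply: (lee_mulDgt0 (k := 1)) => //; first exact: ltW.
    move=> e e0; rewrite mulr1; set be := X `^ Q^-1 + e.
    have be0 : 0 < be by rewrite ltr_wpDl ?powR_ge0.
    have Xbe : X <= be `^ Q.
      rewrite -[leLHS](powRr1 X0) -(mulVf (lt0r_neq0 Q0)) powRrM.
      apply: ge0_ler_powR; rewrite ?nnegrE ?powR_ge0 ?(ltW Q0) ?(ltW be0)//.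
      by rewrite lerDl ltW.
    have Pb : (\int[lebn R n]_x (Psi x `^ Q)%:E <= (be `^ Q)%:E)%E.
      by apply: le_trans PsiX _; rewrite lee_fin.
    have Psi0 x : 0 <= Psi x by exact: powR_ge0.
    have conv := convolution_Lp nsg Q1 mPsi Psi0 be0 Pb.
    have CE : (0 <= C%:E)%E by rewrite lee_fin ltW.
    have mp : (\int[lebn R n]_x poweR (M x) p <= ((C * (J + 1) * be) `^ Q)%:E)%E.
      rewrite -mulrA powRM ?(ltW C0) ?mulr_ge0 ?(ltW be0) ?(ltW J1)// EFinM.
      apply: (@le_trans _ _ ((C `^ Q)%:E * \int[lebn R n]_x poweR (K x) Q)%E); last first.
        by apply: lee_wpmul2l => //; rewrite lee_fin powR_ge0.
      rewrite -ge0_integralZl; last 4 first.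
      - exact: measurableT.
      - exact: (measurableT_comp (measurable_poweR Q) mK).
      - by move=> x _; exact: poweR_ge0.
      - by rewrite lee_fin powR_ge0.
      apply: ge0_le_integral => //.
      - by move=> x _; exact: poweR_ge0.
      - exact: (measurableT_comp (measurable_poweR p) mM).
      - by apply: measurable_funeM; exact: (measurableT_comp (measurable_poweR Q) mK).
      move=> x _; rewrite -(poweR_EFin C Q) -(poweRM Q CE (K0 x)) -rQ poweRrM.
      apply: le_poweR; [exact: ltW|exact: poweR_ge0|].
      by rewrite -KE; exact: MN.
    apply: (@le_trans _ _ (poweR ((C * (J + 1) * be) `^ Q)%:E (r / p))).
      apply: le_poweR => //; first by rewrite divr_ge0 ?(ltW r0) ?(ltW p0).
      by apply: integral_ge0 => x _; exact: poweR_ge0.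
    rewrite poweR_EFin -powRrM -QV mulfV ?gt_eqF// powRr1//.
    by rewrite mulr_ge0 ?(ltW CJ) ?(ltW be0).
  have pE : r / p * r^-1 = p^-1 by rewrite mulrAC mulfV ?mul1r// gt_eqF.
  have := le_poweR ri0 (poweR_ge0 _ _) step.
  rewrite -poweRrM pE => /le_trans; apply.
  rewrite poweR_EFin powRM ?(ltW CJ) ?powR_ge0// -powRrM QV pE.
  by rewrite EFinM poweR_EFin.
rewrite !LqRn_ess_sup//.
have P0 : (0 <= ess_sup (lebn R n) N)%E.
  by apply: ess_sup_gee; [exact: lebn_setT_gt0|exact: aeW].
set P := ess_sup _ N in P0 *.
case EP : P P0 => [c| |] // P0; last by rewrite mulry gtr0_sg// mul1e leey.
rewrite lee_fin in P0.
apply/ess_supP; apply: aeW => x.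
have Mx : (poweR (M x) r <= (C * (J + 1) * c `^ r)%:E)%E.
  apply: le_trans (MN x) _; rewrite -mulrA EFinM; apply: lee_wpmul2l.
    by rewrite lee_fin ltW.
  apply: (@le_trans _ _ (\int[lebn R n]_w ((c `^ r)%:E * (jw sg (w - x))%:E))%E).
    apply: ae_ge0_le_integral => //.
    - by move=> w _; rewrite mule_ge0 ?poweR_ge0.
    - exact: emeasurable_funM.
    - by move=> w _; rewrite mule_ge0 ?lee_fin ?powR_ge0.
    - exact: measurable_funeM.
    have := ess_sup_ge (lebn R n) N; apply: filterS => w Nw _.
    rewrite muleC; apply: lee_wpmul2r => //; rewrite -poweR_EFin.
    by apply: le_poweR; [exact: ltW|exact: N0|rewrite -EP].
  rewrite ge0_integralZl ?lee_fin ?powR_ge0//.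
  rewrite (integral_jw_sub nsg) -EFinM lee_fin mulrC ler_wpM2r ?powR_ge0//.
  by rewrite lerDl.
rewrite -(poweRK (M0 x) rr) -EFinM.
apply: le_trans (le_poweR ri0 (poweR_ge0 _ _) Mx) _.
rewrite poweR_EFin lee_fin powRM ?(ltW CJ) ?powR_ge0// -powRrM rr powRr1//.
Qed.

End mixed_norm.

(** * Boundedness of the multiplier *)

Section hypothesis.
Variables (R : realType) (n : nat).
Implicit Types (x y z w t u v xi : 'rV[R]_n).

Lemma dotexpP (p : \bar R) : (0 < p)%E -> 0 < dotexp p <= 1 /\ ((dotexp p)%:E <= p)%E.
Proof.
rewrite /dotexp minEle; case: p => [a| _|//]; last by rewrite leey /= ltr01 lexx leey.
rewrite lte_fin lee_fin => a0; case: ifPn => [a1|]; first by rewrite /= ltr01 lexx lee_fin.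
by rewrite -ltNge => a1; rewrite /= a0 (ltW a1) lexx.
Qed.

Lemma powR_jw (s r : R) x : jw s x `^ r = jw (s * r) x.
Proof. by rewrite /jw -powRrM mulNr. Qed.

Lemma cabs_vst1_bounded (f : 'rV[R]_n -> R[i]) : cintegrable (lebn R n) f ->
  exists B : R, forall w v, cabs (vst 1 f w v) <= B.
Proof.
move=> fi; exists (\int[lebn R n]_x cabs (f x))%R => w v.
have fw := cintegrable_mul_gauss w fi ler01.
apply: (cabs_cint_le _ (cintegrable_cabs fi)).
  exact: cintegrable_meas (cintegrable_phase v fw).
move=> x; rewrite mulrC cabs_expiM cabsMr ler_piMr ?cabs_ge0//.
by rewrite ger0_norm ?gauss_ge0// gauss_le1.
Qed.

(** Finiteness of the iterated essential supremum gives a null set of [xi] first, and then a null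
    set of [w] depending on [xi]; the weight is moved to the other side. *)
Lemma wnorm_oo_ae (j : 'I_n) (d : 'rV[R]_n -> R) (s : R) : continuous d ->
  (exists (C : R) (N : nat), forall x, `|d x| <= C * jbr x ^+ N) ->
  (wnorm +oo%E +oo%E s (fun x => (d x)%:C) < +oo)%E ->
  exists M : R, 0 <= M /\ {ae lebn R n, forall xi,
    {ae lebn R n, forall w, cabs (vst 1 (fun x => (d x)%:C) xi w) <= M * jw s w}}.
Proof.
move=> cd gd; rewrite /wnorm.
have stftE x xi : stft (fun x => (d x)%:C) x xi = vst 1 (fun x => (d x)%:C) x xi.
  have iw := cintegrable_dmu_window (fun=> cd) (fun=> gd) j x.
  transitivity (cintRn (fun y => (d y)%:C * (gauss 1 (y - x))%:C * expi (- (2 * pi * dotv y xi)))).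
    by rewrite /stft; congr cintRn; apply/funext => y; rewrite gwin_gauss.
  exact: (cintRnE (cintegrable_phase xi iw)).
pose H x xi := cabs (vst 1 (fun x => (d x)%:C) x xi) * jbr xi `^ s.
have -> : (fun x => LqRn +oo%E (fun xi => (cabs (stft (fun x => (d x)%:C) x xi) * jbr xi `^ s)%:E)) =
    (fun x => LqRn +oo%E (fun xi => (H x xi)%:E)).
  by apply/funext => x; congr LqRn; apply/funext => xi; rewrite stftE.
have md : cmeas (fun x => (d x)%:C) by apply: cmeas_real; exact: continuous_measurable_rV.
have mH : measurable_fun setT (fun p : 'rV[R]_n * 'rV[R]_n => H p.1 p.2).
  apply: measurable_funM.
    by apply: measurable_cabs; apply: cmeas_vst.
  apply: (measurableT_comp (measurable_powR s)).
  exact: (measurableT_comp (@measurable_jbr R n) measurable_snd).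
have mHx x : measurable_fun setT (fun xi => (H x xi)%:E).
  by apply/measurable_EFinP; exact: (measurable_slice1 (f := H) x mH).
rewrite LqRn_ess_sup; last exact: measurable_LqRn.
set P := ess_sup _ _ => Poo.
have [M [M0 PM]] : exists M : R, 0 <= M /\ (P <= M%:E)%E.
  (* The extended value [-oo] is covered by the bound 0. *)
  case: P Poo => [c _| |_] //; last by exists 0; split => //; rewrite leNye.
  by exists `|c|; split => //; rewrite lee_fin ler_norm.
exists M; split => //.
have := ess_sup_ge (lebn R n) (fun x => LqRn +oo%E (fun xi => (H x xi)%:E)).
rewrite -/P; apply: filterS => x; rewrite LqRn_ess_sup// => Px.
have := ess_sup_ge (lebn R n) (fun xi => (H x xi)%:E); apply: filterS => xi Hxi.
have : H x xi <= M by rewrite -lee_fin; apply: le_trans Hxi _; apply: le_trans Px PM.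
rewrite /H => h; have := ler_wpM2l (jw_ge0 s xi) h.
by rewrite mulrCA jw_jbr mulr1 mulrC.
Qed.

End hypothesis.

Theorem theorem1p1 (R : realType) (n : nat) (p q : \bar R)
  (mu : 'rV[R]_n -> R) (eps : R) :
  (0 < p)%E -> (0 < q)%E -> 0 < eps ->
  C1 mu ->
  (forall j : 'I_n,
     poly_growth (partialj j mu) /\
     (wnorm +oo%E +oo%E (n%:R / Num.min (dotexp p) (dotexp q) + eps)
        (fun x => (partialj j mu x)%:C) < +oo)%E) ->
  exists C : R, 0 < C /\
    forall f : 'rV[R]_n -> R[i], schwartz f ->
      (wnorm p q 0 (emuD mu f) <= C%:E * wnorm p q 0 f)%E.
Proof.
move=> p0 q0 eps0 [dmu cdmu] hyp.
have [/andP[dp0 dp1] dpp] := dotexpP p0.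
have [/andP[dq0 dq1] dqq] := dotexpP q0.
set r := Num.min (dotexp p) (dotexp q) in hyp.
have r0 : 0 < r by rewrite lt_min dp0.
have r1 : r <= 1 by rewrite ge_min dp1.
have rp : (r%:E <= p)%E by apply: le_trans dpp; rewrite lee_fin ge_min lexx.
have rq : (r%:E <= q)%E by apply: le_trans dqq; rewrite lee_fin ge_min lexx orbT.
set s := n%:R / r + eps in hyp.
(* As r <= 1, the quotient n / r is at least n, and [eps] makes the inequality strict. *)
have ns : n%:R < s.
  apply: (@le_lt_trans _ _ (n%:R / r)); last by rewrite ltrDl.
  by rewrite ler_pdivlMr// ler_piMr.
have s0 : 0 <= s by apply: ltW; apply: le_lt_trans ns.
have nsr : n%:R < s * r by rewrite mulrDl divfK ?gt_eqF// ltrDl mulr_gt0.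
have cmu : continuous mu by exact: differentiable_cont.
have growth j : exists (C : R) (N : nat), forall x, `|partialj j mu x| <= C * jbr x ^+ N.
  by case: (hyp j).
have dmuE j : dirder (ebasis R j) mu (partialj j mu) by exact: dirder_partialj.
have [Mj MjP] := choice (fun j => wnorm_oo_ae j (cdmu j) (growth j) (hyp j).2).
pose M := \sum_j Mj j.
have Mj0 j : 0 <= Mj j by case: (MjP j).
have M0 : 0 <= M by exact: sumr_ge0.
have MjM j : Mj j <= M by rewrite /M (bigD1 j)//= lerDl sumr_ge0.
have [b [M' [b0 [M'0 boot]]]] := bootstrap cmu cdmu dmuE growth ns M0.
have good : {ae lebn R n, forall xi, forall y,
    cabs (vst b (fun x => expi (mu x)) xi y) <= M' * jw s y}.
  have H j : {ae lebn R n, forall xi, {ae lebn R n, forall w,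
      cabs (vst 1 (fun x => (partialj j mu x)%:C) xi w) <= M * jw s w}}.
    have [_] := MjP j; apply: filterS => xi; apply: filterS => w hw.
    by apply: le_trans hw _; rewrite ler_wpM2r ?jw_ge0.
  have H' : {ae lebn R n, forall xi, forall j, {ae lebn R n, forall w,
      cabs (vst 1 (fun x => (partialj j mu x)%:C) xi w) <= M * jw s w}}.
    (* Finitely many null sets, one for each [j], are united. *)
    exact: filter_forall.
  by move: H'; apply: filterS => xi Hxi; exact: boot.
(* The trivial multiplier, whose derivatives vanish, so that the bootstrap applies with bound 0. It
   provides the domination of [F] by its own integral that [peetre_trick] requires. *)
have [b1 [M1 [b10 [M10 boot1]]]] : exists b1 M1 : R, 0 < b1 /\ 0 <= M1 /\
    forall xi y : 'rV[R]_n, cabs (vst b1 (fun=> expi (0 : R)) xi y) <= M1 * jw s y.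
  have c0 : continuous (fun _ : 'rV[R]_n => 0 : R) by exact: cst_continuous.
  have d0 (j : 'I_n) : dirder (ebasis R j) (fun=> 0) (fun=> 0) by move=> x; exact: is_derive_cst.
  have g0 (j : 'I_n) : exists (C : R) (N : nat), forall x : 'rV[R]_n, `|0 : R| <= C * jbr x ^+ N.
    by exists 0, 0%N => x; rewrite normr0 mul0r.
  have [b1 [M1 [b10 [M10 boot1]]]] := bootstrap c0 (fun=> c0) d0 g0 ns (lexx 0).
  exists b1, M1; split => //; split => // xi; apply: boot1 => j.
  apply: aeW => w; rewrite mul0r /vst /ft.
  rewrite (_ : cint _ _ = cint (lebn R n) (fun=> (0 : R)%:C)); last first.
    by apply: eq_cint => x; rewrite rmorph0 !mul0r.
  by rewrite cint_real /Rintegral integral0 cabs_real normr0.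
have mm : cmeas (fun x => expi (mu x)) by apply: cmeas_expi; exact: continuous_measurable_rV.
have m1 : cmeas (fun _ : 'rV[R]_n => expi 0 : R[i]) by exact: cmeas_cst.
have expi1 (t : R) : cabs (expi t) <= 1 by rewrite cabs_expi.
have [Cm [Cm0 HG]] := modulus_multiplier_le mm (fun=> expi1 _) b0 M'0 ns good.
have [C1 [C10 HF]] := modulus_multiplier_le m1 (fun=> expi1 _) b10 M10 ns (aeW _ boot1).
have C0 : 0 < Cm + C1 by rewrite addr_gt0.
have r01 : 0 < r <= 1 by rewrite r0.
have [C' [C'0 peetre]] := peetre_trick n s0 r01 C0.
set J : R := (\int[lebn R n]_t jw (s * r) t)%R.
have J1 : 0 < J + 1.
  by rewrite ltr_wpDl// Rintegral_ge0// => t _; exact: jw_ge0.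
(* [C'] comes from Peetre's trick, one factor [J + 1] from the norm in [xi], the other from the norm
   in [x]; the root undoes the [r]-th powers. *)
exists ((C' * (J + 1) * (J + 1)) `^ r^-1); split.
  by rewrite powR_gt0 ?mulr_gt0.
move=> f sf.
have fi := schwartz_integrable sf; have ffi := schwartz_ft_integrable sf.
have mf := cintegrable_meas fi; have mff := cintegrable_meas ffi.
pose F w v := cabs (vst 1 f w v).
pose G x xi := cabs (vst 1 (fun e => expi (mu e) * ft f e) xi (- x)).
have mF : measurable_fun setT (fun p : 'rV[R]_n * 'rV[R]_n => F p.1 p.2).
  by apply: measurable_cabs; apply: cmeas_vst.
have mG : measurable_fun setT (fun p : 'rV[R]_n * 'rV[R]_n => G p.1 p.2).
  apply: measurable_cabs; apply: cmeas_vst; first exact: cmeasM.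
    exact: measurable_snd.
  by apply: measurable_rVN; exact: measurable_fst.
have [B FB] := cabs_vst1_bounded fi.
have FB' w v : 0 <= F w v <= B by rewrite cabs_ge0 FB.
have G0 x xi : 0 <= G x xi by exact: cabs_ge0.
have I0 x xi : (0 <= \int[lebn R n]_t \int[lebn R n]_w (jw_kernel s F x xi t w)%:E)%E.
  by apply: integral_ge0 => t _; apply: integral_ge0 => w _; rewrite lee_fin jw_kernel_ge0// => *; exact: cabs_ge0.
have FC x xi : ((F x xi)%:E <= (Cm + C1)%:E *
    \int[lebn R n]_t \int[lebn R n]_w (jw_kernel s F x xi t w)%:E)%E.
  have -> : F x xi = cabs (vst 1 (fun e => expi 0 * ft f e) xi (- x)).
    rewrite (_ : (fun e => expi 0 * ft f e) = ft f); last by apply/funext => e; rewrite expi0 mul1r.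
    by rewrite vst1_ft// cabs_expiM opprK.
  apply: le_trans (HF f fi ffi x xi) _; apply: lee_wpmul2r; first exact: I0.
  by rewrite lee_fin lerDr ltW.
have GC x xi : ((G x xi)%:E <= (Cm + C1)%:E *
    \int[lebn R n]_t \int[lebn R n]_w (jw_kernel s F x xi t w)%:E)%E.
  apply: le_trans (HG f fi ffi x xi) _; apply: lee_wpmul2r; first exact: I0.
  by rewrite lee_fin lerDl ltW.
have Gr x xi := peetre F G B FB' G0 mF FC GC x xi.
have mGx x : measurable_fun setT (G x) by exact: (measurable_slice1 (f := G) x mG).
have mixed x := mixed_norm_le nsr (x := x) r0 rq C'0 mF FB' (mGx x) (G0 x).
have wE h (H : 'rV[R]_n -> 'rV[R]_n -> R) : (forall x xi, cabs (stft h x xi) = H x xi) ->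
    wnorm p q 0 h = LqRn p (fun x => LqRn q (fun xi => (H x xi)%:E)).
  move=> hH; rewrite /wnorm; congr LqRn; apply/funext => x; congr LqRn.
  by apply/funext => xi; rewrite powRr0 mulr1 hH.
rewrite (wE _ G); last by move=> x xi; exact: cabs_stft_emuD.
rewrite (wE _ F); last by move=> x xi; rewrite stft_schwartz.
apply: (convolution_LqRn nsr r0 rp).
- by rewrite mulr_gt0.
- exact: measurable_LqRn.
- exact: measurable_LqRn.
- move=> x; apply: LqRn_ge0 => [|xi]; last by rewrite lee_fin.
  exact/measurable_EFinP.
- move=> w; apply: LqRn_ge0 => [|v]; last by rewrite lee_fin cabs_ge0.
  by apply/measurable_EFinP; exact: (measurable_slice1 (f := F) w mF).
move=> x; apply: mixed => xi; apply: le_trans (Gr x xi) _.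
(* The [r]-th power of the kernel of exponent [s] is the kernel of exponent [s * r], against F^r. *)
rewrite le_eqVlt; apply/orP; left; apply/eqP; congr (_ * _)%E.
apply: eq_integral => t _; apply: eq_integral => w _.
by rewrite /jw_kernel !powRM ?mulr_ge0 ?jw_ge0 ?cabs_ge0// !powR_jw.
Qed.
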